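(* Let $F$ be a field of arbitrary characteristic, $\overline F$ a separable closure, $\Gamma=\operatorname{Gal}(\overline F/F)$. Let $(V,Q)$ be a nondegenerate quadratic space over $F$ with orthogonal group $O=O(Q)$, and let $\varphi:\Gamma\to O(F)$ be a homomorphism with open kernel. Let $(V_\varphi,Q_\varphi)$ be the twist of $(V,Q)$ by $\varphi$. Then the elements $\overline{SW}(\varphi)$ and $HW(Q_\varphi,Q)$ of $\operatorname{Br}_2(F)_s$ differ by the element $\xi(\delta\circ\varphi)$ of the subgroup $\operatorname{Br}_2(F)$ of $\operatorname{Br}_2(F)_s$; that is, $$HW(Q_\varphi,Q)=\overline{SW}(\varphi)+\xi(\delta\circ\varphi),$$ where $\delta:O(F)\to F^\times/(F^\times)^2$ is the spinor norm.
   Context: Nondegenerate means that $B(x,y)=Q(x+y)-Q(x)-Q(y)$ is nondegenerate. $\operatorname{Br}(F)=H^2(\Gamma,\overline F^\times)$ (additive notation), $\operatorname{Br}_2(F)=\{x:2x=0\}$. $\operatorname{Br}_2(F)_s$ is the set $H^1(F,\mathbb F_2)\times\operatorname{Br}_2(F)$ with group law $(\chi,x)+(\chi',x')=(\chi+\chi',x+x'+\chi\cup\chi')$, where $\cup$ is the cup product into $H^2(\Gamma,\overline F^\times)$ induced by $\mathbb F_2\otimes\mathbb F_2\to\overline F^\times$, $m\otimes n\mapsto(-1)^{mn}$. $\operatorname{Br}_2(F)$ is the subgroup of elements $(0,x)$. Clifford group. $C=C(Q)$ is the $\mathbb Z/2$-graded Clifford algebra ($v^2=Q(v)$), with anti-involution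 $x\mapsto x_t$ fixing $V$ pointwise. For homogeneous invertible $x$, $\operatorname{Int}_s(x)(y)=(-1)^{\deg x\deg y}xyx^{-1}$ for homogeneous $y$. $Cl(Q)$ is the algebraic group of homogeneous invertible $x$ with $\operatorname{Int}_s(x)(V)=V$; $\rho(x)=\operatorname{Int}_s(x)|_V$ gives an exact sequence $1\to\mathbb G_m\to Cl(Q)\xrightarrow{\rho}O(Q)\to1$, also exact on $F$-points. $N:Cl(Q)\to\mathbb G_m$ is $N(x)=x_tx$. The degree (parity) on $Cl(Q)$ induces $\deg:O(Q)\to\mathbb F_2$. The spinor norm $\delta:O(F)\to F^\times/(F^\times)^2$ sends $x$ to the class of $N(\dot x)$ for any $\dot x\in Cl(Q)(F)$ with $\rho(\dot x)=x$. Relative Hasse–Witt invariant. For nondegenerate $(V,Q),(V',Q')$ of equal dimension, $\operatorname{inv}(Q',Q)\in H^1(F,O(Q))$ is the class of $\sigma\mapsto u^{-1}\sigma(u)$ for an $\overline F$-isometry $u:(V,Q)\to(V',Q')$. $HW(Q',Q):=(\deg_*\operatorname{inv}(Q',Q),\partial\operatorname{inv}(Q',Q))\in\operatorname{Br}_2(F)_s$, where $\deg_*:H^1(F,O(Q))\to H^1(F,\mathbb F_2)$ is induced by $\deg$ and $\partial:H^1(F,O(Q))\to H^2(F,\mathbb G_m)$ is the connecting map for the exact sequence $1\to\mathbb G_m\to Cl(Q)\xrightarrow{\rho}O(Q)\to1$ (its image lies in $\operatorname{Br}_2(F)$). Twist. $V_\varphi=\{v\in\overline F\otimes_FV:\varphi(\sigma)(\sigma(v))=v\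 \forall\sigma\in\Gamma\}$ and $Q_\varphi$ is the restriction of $Q$ (extended to $\overline F\otimes_F V$) to $V_\varphi$. Stiefel–Whitney classes. Extend scalars to an algebraically closed field $k\supset F$. $SW_1(\varphi)=\deg\circ\varphi\in H^1(\Gamma,\mathbb F_2)$. If $\operatorname{char}F\ne2$, $SW_2(\varphi)\in H^2(\Gamma,\mu_2(k))=H^2(\Gamma,\mathbb F_2)$ is the image of $\varphi$ (viewed as a $1$-cocycle in $O(Q)(k)$ with trivial $\Gamma$-action) under the connecting map of $1\to\mu_2(k)\to\widetilde{\operatorname{Pin}}(Q)(k)\to O(Q)(k)\to1$ with $\widetilde{\operatorname{Pin}}(Q)=\ker(N:Cl(Q)\to\mathbb G_m)$. If $\operatorname{char}F=2$, $SW_2(\varphi)=0$. $\overline{SW}(\varphi)\in\operatorname{Br}_2(F)_s$ is the pair consisting of $SW_1(\varphi)$ and the image of $SW_2(\varphi)$ under $H^2(\Gamma,\mathbb F_2)\to H^2(\Gamma,\overline F^\times)$ induced by $n\mapsto(-1)^n$. The homomorphism $\xi$. For $\chi\in H^1(\Gamma,\mathbb F_2)$, $b\in F^\times$, put $\{\chi,b\}=b\cup\partial\chi\in\operatorname{Br}_2(F)$, where $\partial:H^1(\Gamma,\mathbb F_2)\to H^2(\Gamma,\mathbb Z)$ is the connecting map of $0\to\mathbb Z\xrightarrow{2}\mathbb Z\to\mathbb F_2\to0$. Using the canonical isomorphism $H^1(\Gamma,F^\times/(F^\times)^2)=H^1(\Gamma,\mathbb F_2)\otimes F^\times/(F^\times)^2$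 (trivial $\Gamma$-action on $F^\times/(F^\times)^2$), $\xi:H^1(\Gamma,F^\times/(F^\times)^2)\to\operatorname{Br}_2(F)$ is the homomorphism with $\xi(\chi\otimes b)=\{\chi,b\}$. *)

(* Defs.v *)
From HB Require Import structures.
From mathcomp Require Import all_boot all_order all_algebra.
From mathcomp Require Import separable.
From mathcomp Require Import all_classical.
From mathcomp Require Import topology ring.
Set Implicit Arguments.
Unset Strict Implicit.
Unset Printing Implicit Defensive.

Import GRing.Theory.
Local Open Scope classical_set_scope.
Local Open Scope quotient_scope.
Local Open Scope ring_scope.

(* Continuity of a map into a set with the discrete topology. *)
Definition locally_constant (X : topologicalType) (T : Type) (f : X -> T) :=
  forall x, \forall y \near x, f y = f x.

Lemma locally_constant_op2 (X : topologicalType) (A B C : Type)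
    (h : A -> B -> C) (f : X -> A) (g : X -> B) :
  locally_constant f -> locally_constant g ->
  locally_constant (fun x => h (f x) (g x)).
Proof.
move=> fc gc x; near=> y; congr h.
- by near: y; exact: fc.
- by near: y; exact: gc.
Unshelve. all: by end_near. Qed.

Lemma locally_constant_cst (X : topologicalType) (T : Type) (t : T) :
  locally_constant (fun _ : X => t).
Proof. by move=> x; apply: nearW. Qed.

Definition polar (V R : zmodType) (Q : V -> R) (x y : V) : R :=
  Q (x + y) - Q x - Q y.

Definition quadratic_form (K : fieldType) (V : lmodType K) (Q : V -> K) : Prop :=
  (forall a x, Q (a *: x) = a ^+ 2 * Q x) /\
  (forall a x y z, polar Q (a *: x + y) z = a * polar Q x z + polar Q y z).

Definition nondegenerate_qf (K : fieldType) (V : lmodType K) (Q : V -> K) : Prop :=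
  forall x, (forall y, polar Q x y = 0) -> x = 0.

Definition qf_isometry (K : fieldType) (V W : lmodType K)
    (Q : V -> K) (Q' : W -> K) (u : V -> W) : Prop :=
  [/\ linear u, bijective u & forall x, Q' (u x) = Q x].

Section OrthogonalGroup.
Variables (K : fieldType) (V : lmodType K) (Q : V -> K).

Record orthogonal_group := Orthogonal {
  orth_fun :> V -> V;
  orth_isometry : qf_isometry Q Q orth_fun }.

HB.instance Definition _ := gen_eqMixin orthogonal_group.
HB.instance Definition _ := gen_choiceMixin orthogonal_group.

Lemma orthogonal_eq (g h : orthogonal_group) : g =1 h -> g = h.
Proof.
case: g h => [g gP] [h hP] /= /funext gh.
by case: h / gh hP => hP; congr Orthogonal; exact: Prop_irrelevance.
Qed.

Lemma isometry_id : qf_isometry Q Q id.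
Proof. by split => //; exists id. Qed.

Lemma isometry_comp (g h : orthogonal_group) : qf_isometry Q Q (g \o h).
Proof.
case: g h => [g [gl gb gQ]] [h [hl hb hQ]]; split => /=.
- by move=> a x y /=; rewrite hl gl.
- exact: bij_comp.
- by move=> x; rewrite gQ hQ.
Qed.

Lemma orth_inv_subproof (g : orthogonal_group) :
  {h : V -> V | qf_isometry Q Q h & cancel h g /\ cancel g h}.
Proof.
apply: cid2; case: g => [g [gl gb gQ]] /=.
have [h gK hK] := gb; exists h => //; split.
- by move=> a x y; apply: (can_inj gK); rewrite gl !hK.
- by exists g.
- by move=> x; rewrite -[in RHS](hK x) gQ.
Qed.

Definition orth_one := Orthogonal isometry_id.
Definition orth_mul g h := Orthogonal (isometry_comp g h).
Definition orth_inv g := Orthogonal (s2valP (orth_inv_subproof g)).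

Lemma orth_mulA : associative orth_mul.
Proof. by move=> f g h; apply: orthogonal_eq. Qed.
Lemma orth_mul1 : left_id orth_one orth_mul.
Proof. by move=> f; apply: orthogonal_eq. Qed.
Lemma orth_1mul : right_id orth_one orth_mul.
Proof. by move=> f; apply: orthogonal_eq. Qed.
Lemma orth_mulV : left_inverse orth_one orth_inv orth_mul.
Proof.
move=> f; apply: orthogonal_eq => x.
by have [_ /= ->] := s2valP' (orth_inv_subproof f).
Qed.
Lemma orth_Vmul : right_inverse orth_one orth_inv orth_mul.
Proof.
move=> f; apply: orthogonal_eq => x.
by have [/= -> _] := s2valP' (orth_inv_subproof f).
Qed.

HB.instance Definition _ := isGroup.Build orthogonal_group
  orth_mulA orth_mul1 orth_1mul orth_mulV orth_Vmul.

End OrthogonalGroup.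

Section MultiplicativeGroup.
Variable K : fieldType.

(* K^x in additive notation: 0 is the unit 1 of K, x + y is the product, and
   u *~ n is the n-th power. *)
Record Gm := MkGm { gm_val : K; gm_neq0 : gm_val != 0 }.
HB.instance Definition _ := [isSub for gm_val].
HB.instance Definition _ := [Choice of Gm by <:].

Definition gm_one := MkGm (oner_neq0 K).
Lemma gm_mul_subproof (x y : Gm) : gm_val x * gm_val y != 0.
Proof. by rewrite mulf_neq0 ?gm_neq0. Qed.
Definition gm_mul x y := MkGm (gm_mul_subproof x y).
Lemma gm_inv_subproof (x : Gm) : (gm_val x)^-1 != 0.
Proof. by rewrite invr_eq0 gm_neq0. Qed.
Definition gm_inv x := MkGm (gm_inv_subproof x).

Lemma gm_mulA : associative gm_mul.
Proof. by move=> x y z; apply: val_inj; rewrite /= mulrA. Qed.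
Lemma gm_mulC : commutative gm_mul.
Proof. by move=> x y; apply: val_inj; rewrite /= mulrC. Qed.
Lemma gm_mul1 : left_id gm_one gm_mul.
Proof. by move=> x; apply: val_inj; rewrite /= mul1r. Qed.
Lemma gm_mulV : left_inverse gm_one gm_inv gm_mul.
Proof. by move=> x; apply: val_inj; rewrite /= mulVf ?gm_neq0. Qed.

HB.instance Definition _ :=
  GRing.isZmodule.Build Gm gm_mulA gm_mulC gm_mul1 gm_mulV.

Lemma gm_sign_subproof (n : 'F_2) : ((-1) ^+ (n : nat) : K) != 0.
Proof. by rewrite signr_eq0. Qed.
Definition gm_sign (n : 'F_2) : Gm := MkGm (gm_sign_subproof n).

Definition gm_squares : {pred Gm} := fun b => `[< exists c : Gm, b = c *+ 2 >].

Lemma gm_squares_closed : zmod_closed gm_squares.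
Proof.
split; first by apply/asboolP; exists 0; rewrite mul0rn.
move=> _ _ /asboolP[b ->] /asboolP[c ->]; apply/asboolP.
by exists (b - c); rewrite mulrnBl.
Qed.
HB.instance Definition _ := GRing.isZmodClosed.Build Gm gm_squares
  gm_squares_closed.

Definition square_classes : zmodType := Quotient.quot gm_squares.

End MultiplicativeGroup.

Lemma gm_map_subproof (K L : fieldType) (f : {rmorphism K -> L}) (x : Gm K) :
  f (gm_val x) != 0.
Proof. by rewrite fmorph_eq0 gm_neq0. Qed.
Definition gm_map (K L : fieldType) (f : {rmorphism K -> L}) (x : Gm K) : Gm L :=
  MkGm (gm_map_subproof f x).

Definition separable_closure (F E : fieldType) (iota : {rmorphism F -> E}) : Prop :=
  (forall x : E, exists2 p : {poly F},
     separable_poly p & root (map_poly iota p) x) /\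
  (forall p : {poly E}, separable_poly p -> (1 < size p)%N ->
     exists x, root p x).

Section GaloisGroup.
Variables (F E : fieldType) (iota : {rmorphism F -> E}).

Record gal := Gal {
  gal_fun :> E -> E;
  galP : [/\ zmod_morphism gal_fun, monoid_morphism gal_fun,
             bijective gal_fun & forall a, gal_fun (iota a) = iota a] }.

HB.instance Definition _ := gen_eqMixin gal.
HB.instance Definition _ := gen_choiceMixin gal.

HB.instance Definition _ (s : gal) :=
  GRing.isZmodMorphism.Build E E (gal_fun s) (let: And4 h _ _ _ := galP s in h).
HB.instance Definition _ (s : gal) :=
  GRing.isMonoidMorphism.Build E E (gal_fun s)
    (let: And4 _ h _ _ := galP s in h).

Lemma gal_eq (s t : gal) : s =1 t -> s = t.
Proof.
case: s t => [s sP] [t tP] /= /funext st.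
by case: t / st tP => tP; congr Gal; exact: Prop_irrelevance.
Qed.

Lemma gal_fix (s : gal) a : s (iota a) = iota a.
Proof. by have [_ _ _] := galP s. Qed.

Definition gal_one : gal.
Proof. by exists id; split => //; exists id. Defined.

Definition gal_mul (s t : gal) : gal.
Proof.
exists (s \o t); split => [x y||| a] /=.
- by rewrite !rmorphB.
- by split => [|x y] /=; rewrite ?rmorph1 ?rmorphM.
- by apply: bij_comp; [have [] := galP s|have [] := galP t].
- by rewrite !gal_fix.
Defined.

Lemma gal_inv_subproof (s : gal) :
  {t : gal | cancel s t & cancel t s}.
Proof.
apply: cid2; have [_ _ [t sK tK] _] := galP s.
have tP : [/\ zmod_morphism t, monoid_morphism t,
             bijective t & forall a, t (iota a) = iota a].
  split.
  - by move=> x y; apply: (can_inj sK); rewrite rmorphB /= !tK.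
  - split; first by apply: (can_inj sK); rewrite rmorph1 /= tK.
    by move=> x y; apply: (can_inj sK); rewrite rmorphM /= !tK.
  - by exists s.
  - by move=> a; apply: (can_inj sK); rewrite tK gal_fix.
by exists (Gal tP).
Qed.

Definition gal_inv (s : gal) : gal := s2val (gal_inv_subproof s).

Lemma gal_mulA : associative gal_mul.
Proof. by move=> r s t; apply: gal_eq. Qed.
Lemma gal_mul1 : left_id gal_one gal_mul.
Proof. by move=> s; apply: gal_eq. Qed.
Lemma gal_1mul : right_id gal_one gal_mul.
Proof. by move=> s; apply: gal_eq. Qed.
Lemma gal_mulV : left_inverse gal_one gal_inv gal_mul.
Proof.
by move=> s; apply: gal_eq => x; exact: (s2valP (gal_inv_subproof s)).
Qed.
Lemma gal_Vmul : right_inverse gal_one gal_inv gal_mul.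
Proof.
by move=> s; apply: gal_eq => x; exact: (s2valP' (gal_inv_subproof s)).
Qed.

HB.instance Definition _ := isGroup.Build gal
  gal_mulA gal_mul1 gal_1mul gal_mulV gal_Vmul.

(* The Krull topology: a neighbourhood base of s is given by the automorphisms
   agreeing with s on a finite set. *)
Definition gal_open (A : set gal) : Prop :=
  forall s, A s -> exists xs : seq E,
    forall t : gal, {in xs, t =1 s} -> A t.

Lemma gal_openT : gal_open setT.
Proof. by move=> s _; exists [::]. Qed.

Lemma gal_openI : setI_closed gal_open.
Proof.
move=> A B oA oB s [/oA[xs hA] /oB[ys hB]]; exists (xs ++ ys) => t ts.
by split; [apply: hA|apply: hB] => x xP; apply: ts; rewrite mem_cat xP ?orbT.
Qed.

Lemma gal_open_bigU (I : Type) (f : I -> set gal) :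
  (forall i, gal_open (f i)) -> gal_open (\bigcup_i f i).
Proof.
move=> of_ s [i _ /of_[xs hf]]; exists xs => t ts.
by exists i => //; exact: hf.
Qed.

HB.instance Definition _ :=
  isOpenTopological.Build gal gal_openT gal_openI gal_open_bigU.

Lemma gal_openE (A : set gal) : open A = gal_open A.
Proof. by []. Qed.

End GaloisGroup.

Lemma subrDD (M : zmodType) (x x' y y' : M) :
  (x - x') + (y - y') = (x + y) - (x' + y').
Proof. by rewrite opprD addrACA. Qed.

Lemma subrBB (M : zmodType) (x x' y y' : M) :
  (x - x') - (y - y') = (x - y) - (x' - y').
Proof. by rewrite !opprB [LHS]addrACA [RHS]addrACA [- x' - y]addrC. Qed.

Section Cohomology.
Variables (F E : fieldType) (iota : {rmorphism F -> E}).
Local Notation Gamma := (gal iota).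

Record gmod := GMod {
  gmod_car :> zmodType;
  gact : Gamma -> gmod_car -> gmod_car;
  gactB : forall s, zmod_morphism (gact s);
  gact1 : forall m, gact 1%g m = m;
  gactM : forall s t m, gact (s * t)%g m = gact s (gact t m);
  gact_discrete : forall m, locally_constant (fun s => gact s m) }.

HB.instance Definition _ (M : gmod) (s : Gamma) :=
  GRing.isZmodMorphism.Build M M (@gact M s) (@gactB M s).

Definition trivial_gmod (M : zmodType) : gmod :=
  @GMod M (fun _ m => m) (fun _ _ _ => erefl) (fun _ => erefl)
    (fun _ _ _ => erefl) (fun m => @locally_constant_cst _ _ m).

Section Modules.
Variable M : gmod.

Definition Z1_pred : {pred Gamma -> M} := fun c =>
  `[< locally_constant c /\
      forall s t, c (s * t)%g = c s + gact s (c t) >].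

Definition coboundary0 (m : M) : Gamma -> M := fun s => gact s m - m.

Definition Z2_pred : {pred Gamma * Gamma -> M} := fun z =>
  `[< locally_constant z /\
      forall s t u, gact s (z (t, u)) - z ((s * t)%g, u)
                    + z (s, (t * u)%g) - z (s, t) = 0 >].

Definition coboundary1 (b : Gamma -> M) : Gamma * Gamma -> M := fun st =>
  gact st.1 (b st.2) - b (st.1 * st.2)%g + b st.1.

Lemma Z1_closed : zmod_closed Z1_pred.
Proof.
split.
  apply/asboolP; split; first exact: locally_constant_cst.
  by move=> s t /=; rewrite raddf0 addr0.
move=> c d /asboolP[cc cP] /asboolP[dc dP]; apply/asboolP; split.
  exact: (locally_constant_op2 (fun x y : M => x - y) cc dc).
by move=> s t; rewrite !fctE cP dP raddfB opprD addrACA.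
Qed.
HB.instance Definition _ := GRing.isZmodClosed.Build (Gamma -> M) Z1_pred
  Z1_closed.

Record Z1 := MkZ1 { z1_fun :> Gamma -> M; _ : z1_fun \in Z1_pred }.
HB.instance Definition _ := [isSub for z1_fun].
HB.instance Definition _ := [Choice of Z1 by <:].
HB.instance Definition _ := [SubChoice_isSubZmodule of Z1 by <:].

Lemma Z2_closed : zmod_closed Z2_pred.
Proof.
split.
  apply/asboolP; split; first exact: locally_constant_cst.
  by move=> s t u /=; rewrite raddf0 !subr0 addr0.
move=> c d /asboolP[cc cP] /asboolP[dc dP]; apply/asboolP; split.
  exact: (locally_constant_op2 (fun x y : M => x - y) cc dc).
move=> s t u; rewrite !fctE raddfB /= subrBB subrDD subrBB.
by rewrite cP dP subr0.
Qed.

HB.instance Definition _ := GRing.isZmodClosed.Build (Gamma * Gamma -> M)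
  Z2_pred Z2_closed.

Record Z2 := MkZ2 { z2_fun :> Gamma * Gamma -> M; _ : z2_fun \in Z2_pred }.
HB.instance Definition _ := [isSub for z2_fun].
HB.instance Definition _ := [Choice of Z2 by <:].
HB.instance Definition _ := [SubChoice_isSubZmodule of Z2 by <:].

Definition B1_pred : {pred Z1} := fun c =>
  `[< exists m, val c = coboundary0 m >].

Lemma B1_closed : zmod_closed B1_pred.
Proof.
split.
  apply/asboolP; exists 0; rewrite raddf0; apply/funext => s.
  by rewrite /coboundary0 raddf0 subr0.
move=> c d /asboolP[m cm] /asboolP[n dn]; apply/asboolP; exists (m - n).
rewrite raddfB /= cm dn; apply/funext => s.
by rewrite !fctE /coboundary0 (raddfB (gact s)) /= subrBB.
Qed.
HB.instance Definition _ := GRing.isZmodClosed.Build Z1 B1_pred B1_closed.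

Definition B2_pred : {pred Z2} := fun z =>
  `[< exists2 b, locally_constant b & val z = coboundary1 b >].

Lemma B2_closed : zmod_closed B2_pred.
Proof.
split.
  apply/asboolP; exists (fun=> 0); first exact: locally_constant_cst.
  rewrite raddf0; apply/funext => st.
  by rewrite /coboundary1 raddf0 subr0 addr0.
move=> c d /asboolP[m mc cm] /asboolP[n nc dn]; apply/asboolP.
exists (fun s => m s - n s).
  exact: (locally_constant_op2 (fun x y : M => x - y) mc nc).
rewrite raddfB /= cm dn; apply/funext => st.
by rewrite !fctE /coboundary1 (raddfB (gact st.1)) /= subrBB subrDD.
Qed.
HB.instance Definition _ := GRing.isZmodClosed.Build Z2 B2_pred B2_closed.

Definition H1 : zmodType := Quotient.quot B1_pred.
Definition H2 : zmodType := Quotient.quot B2_pred.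

(* 0 when the cochain is not a cocycle. *)
Definition H1_class (c : Gamma -> M) : H1 := \pi_(Quotient.quot B1_pred) (insubd 0 c).
Definition H2_class (z : Gamma * Gamma -> M) : H2 :=
  \pi_(Quotient.quot B2_pred) (insubd 0 z).

Definition H1_cocycle (x : H1) : Gamma -> M := val (repr (x : Quotient.quot B1_pred)).
Definition H2_cocycle (x : H2) : Gamma * Gamma -> M :=
  val (repr (x : Quotient.quot B2_pred)).

End Modules.

Definition H2_map (M N : gmod) (f : M -> N) (x : H2 M) : H2 N :=
  H2_class (fun st => f (H2_cocycle x st)).

(* The cup products H^1 x H^1 -> H^2 and H^0 x H^2 -> H^2 for a biadditive
   equivariant pairing p. *)
Definition cup11 (M N P : gmod) (p : M -> N -> P) (x : H1 M) (y : H1 N) : H2 P :=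
  H2_class (fun st => p (H1_cocycle x st.1) (gact st.1 (H1_cocycle y st.2))).
Definition cup02 (M N P : gmod) (p : M -> N -> P) (m : M) (y : H2 N) : H2 P :=
  H2_class (fun st => p m (H2_cocycle y st)).

End Cohomology.

Inductive tterm (E V : Type) :=
  TPure of E & V | TAdd of tterm E V & tterm E V.

HB.instance Definition _ (E V : Type) := gen_eqMixin (tterm E V).
HB.instance Definition _ (E V : Type) := gen_choiceMixin (tterm E V).

Section Tensor.
Variables (F E : fieldType) (iota : {rmorphism F -> E}) (V : lmodType F).
Local Notation term := (tterm E V).
Implicit Types r s t : term.

(* The congruence on sums of pure symbols defining the tensor product
   of E and V over F. *)
Inductive teq : term -> term -> Prop :=
| teq_refl t : teq t t
| teq_sym s t : teq s t -> teq t s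
| teq_trans r s t : teq r s -> teq s t -> teq r t
| teq_add s s' t t' : teq s s' -> teq t t' -> teq (TAdd s t) (TAdd s' t')
| teq_addA r s t : teq (TAdd r (TAdd s t)) (TAdd (TAdd r s) t)
| teq_addC s t : teq (TAdd s t) (TAdd t s)
| teq_add0 t : teq (TAdd (TPure 0 0) t) t
| teq_pureDl a b v : teq (TPure (a + b) v) (TAdd (TPure a v) (TPure b v))
| teq_pureDr a v w : teq (TPure a (v + w)) (TAdd (TPure a v) (TPure a w))
| teq_pureZ a c v : teq (TPure (a * iota c) v) (TPure a (c *: v)).

Definition teqb : rel term := fun s t => `[< teq s t >].

Lemma teqb_equiv : equiv_class_of teqb.
Proof.
split=> [t|s t|s r t].
- by apply/asboolP; exact: teq_refl.
- by apply/asboolP/asboolP; exact: teq_sym.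
- by move=> /asboolP rs /asboolP st; apply/asboolP; exact: teq_trans rs st.
Qed.
Canonical teqb_equivRel := EquivRelPack teqb_equiv.

Definition tensor := {eq_quot teqb}.
HB.instance Definition _ : EqQuotient term teqb tensor := EqQuotient.on tensor.
HB.instance Definition _ := Choice.on tensor.

Lemma tensorP s t : reflect (teq s t) (s == t %[mod tensor]).
Proof. by rewrite piE; exact: asboolP. Qed.

Lemma tensor_repr t : teq (repr (\pi_tensor t)) t.
Proof. by apply/tensorP; rewrite reprK. Qed.

Fixpoint tscale (a : E) t : term :=
  match t with
  | TPure b v => TPure (a * b) v
  | TAdd s t => TAdd (tscale a s) (tscale a t)
  end.

Lemma tscale_teq a s t : teq s t -> teq (tscale a s) (tscale a t).
Proof.
move=> st; elim: s t / st; try by move=> * /=; constructor.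
- by move=> q r p _ qr _; exact: teq_trans qr.
- by move=> r /=; rewrite mulr0; exact: teq_add0.
- by move=> b c v /=; rewrite mulrDr; exact: teq_pureDl.
- by move=> b c v /=; rewrite mulrA; exact: teq_pureZ.
Qed.

Definition tens (a : E) (v : V) : tensor := \pi_tensor (TPure a v).
Definition tensor_zero : tensor := tens 0 0.
Definition tensor_add (x y : tensor) : tensor := \pi_tensor (TAdd (repr x) (repr y)).
Definition tensor_scale (a : E) (x : tensor) : tensor := \pi_tensor (tscale a (repr x)).
Definition tensor_opp := tensor_scale (-1).

Lemma tensor_addE s t : tensor_add (\pi_tensor s) (\pi_tensor t) = \pi_tensor (TAdd s t).
Proof. by apply/eqP/tensorP; apply: teq_add; exact: tensor_repr. Qed.

Lemma tensor_scaleE a t : tensor_scale a (\pi_tensor t) = \pi_tensor (tscale a t).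
Proof. by apply/eqP/tensorP; apply: tscale_teq; exact: tensor_repr. Qed.

Lemma tensor_addA : associative tensor_add.
Proof.
elim/quotW => x; elim/quotW => y; elim/quotW => z.
rewrite (tensor_addE y z) (tensor_addE x y) (tensor_addE x).
by rewrite (tensor_addE (TAdd x y)); apply/eqP/tensorP; exact: teq_addA.
Qed.

Lemma tensor_addC : commutative tensor_add.
Proof.
elim/quotW => x; elim/quotW => y.
by rewrite (tensor_addE x) (tensor_addE y); apply/eqP/tensorP; exact: teq_addC.
Qed.

Lemma tensor_add0 : left_id tensor_zero tensor_add.
Proof.
elim/quotW => x; rewrite tensor_addE; apply/eqP/tensorP; exact: teq_add0.
Qed.

Lemma tpure0 v : teq (TPure 0 v) (TPure 0 0).
Proof.
have := teq_pureZ 0 0 v; rewrite mul0r scale0r; exact.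
Qed.

Lemma tscale0 t : teq (tscale 0 t) (TPure 0 0).
Proof.
elim: t => [a v|s sP t tP] /=; first by rewrite mul0r; exact: tpure0.
by apply: teq_trans (teq_add sP tP) _; exact: teq_add0.
Qed.

Lemma tscaleDl a b t : teq (tscale (a + b) t) (TAdd (tscale a t) (tscale b t)).
Proof.
elim: t => [c v|s sP t tP] /=; first by rewrite mulrDl; exact: teq_pureDl.
apply: teq_trans (teq_add sP tP) _.
apply: teq_trans (teq_sym (teq_addA _ _ _)) _.
apply: teq_trans (teq_addA _ _ _); apply: teq_add; first exact: teq_refl.
apply: teq_trans (teq_addA _ _ _) _.
apply: teq_trans (teq_add (teq_addC _ _) (teq_refl _)) _.
exact: teq_sym (teq_addA _ _ _).
Qed.

Lemma tscale1 t : tscale 1 t = t.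
Proof. by elim: t => [c v|s sP t tP] /=; rewrite ?mul1r ?sP ?tP. Qed.

Lemma tscaleA a b t : tscale a (tscale b t) = tscale (a * b) t.
Proof. by elim: t => [c v|s sP t tP] /=; rewrite ?mulrA ?sP ?tP. Qed.

Lemma tensor_addN : left_inverse tensor_zero tensor_opp tensor_add.
Proof.
elim/quotW => x; rewrite /tensor_opp tensor_scaleE tensor_addE.
apply/eqP/tensorP; rewrite -{2}[x]tscale1.
apply: teq_trans (teq_sym (tscaleDl (-1) 1 x)) _.
by rewrite addNr; exact: tscale0.
Qed.

HB.instance Definition _ := GRing.isZmodule.Build tensor
  tensor_addA tensor_addC tensor_add0 tensor_addN.

Lemma tensor_piD s t : \pi_tensor s + \pi_tensor t = \pi_tensor (TAdd s t).
Proof. exact: tensor_addE. Qed.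

Lemma tensor_scaleA a b x :
  tensor_scale a (tensor_scale b x) = tensor_scale (a * b) x.
Proof.
by elim/quotW: x => x; rewrite (tensor_scaleE b) !tensor_scaleE tscaleA.
Qed.
Lemma tensor_scale1 : left_id 1 tensor_scale.
Proof. by elim/quotW => x; rewrite tensor_scaleE tscale1. Qed.
Lemma tensor_scaleDr : right_distributive tensor_scale +%R.
Proof.
move=> a; elim/quotW => x; elim/quotW => y.
by rewrite tensor_piD !(tensor_scaleE a) tensor_piD.
Qed.
Lemma tensor_scaleDl x : {morph tensor_scale^~ x : a b / a + b}.
Proof.
move=> a b; elim/quotW: x => x.
rewrite (tensor_scaleE a) (tensor_scaleE b) tensor_scaleE tensor_piD.
by apply/eqP/tensorP; exact: tscaleDl.
Qed.

HB.instance Definition _ := GRing.Zmodule_isLmodule.Build E tensor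
  tensor_scaleA tensor_scale1 tensor_scaleDr tensor_scaleDl.

Lemma tensor_piZ a t : a *: \pi_tensor t = \pi_tensor (tscale a t).
Proof. exact: tensor_scaleE. Qed.

Lemma tens_is_bilinear :
  [/\ forall a, {morph tens a : v w / v + w},
      forall v, {morph tens^~ v : a b / a + b},
      forall a b v, a *: tens b v = tens (a * b) v
    & forall a c v, tens (a * iota c) v = tens a (c *: v)].
Proof.
split.
- move=> a v w; rewrite /tens tensor_piD.
  by apply/eqP/tensorP; exact: teq_pureDr.
- move=> v a b; rewrite /tens tensor_piD.
  by apply/eqP/tensorP; exact: teq_pureDl.
- by move=> a b v; rewrite /tens tensor_piZ.
- by move=> a c v; apply/eqP/tensorP; exact: teq_pureZ.
Qed.

End Tensor.

Section TensorMap.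
Variables (F E E' : fieldType) (iota : {rmorphism F -> E}).
Variables (iota' : {rmorphism F -> E'}) (V V' : lmodType F).

Fixpoint tmap (f : E -> E') (u : V -> V') (t : tterm E V) : tterm E' V' :=
  match t with
  | TPure a v => TPure (f a) (u v)
  | TAdd s t => TAdd (tmap f u s) (tmap f u t)
  end.

(* Sends a (x) v to f a (x) u v; for f a morphism of F-algebras and u linear. *)
Definition tensor_map (f : E -> E') (u : V -> V') (x : tensor iota V) :
  tensor iota' V' := \pi_(tensor iota' V') (tmap f u (repr x)).

Lemma tensor_mapE (f : {rmorphism E -> E'}) (u : V -> V') t :
  (forall a, f (iota a) = iota' a) -> linear u ->
  tensor_map f u (\pi_(tensor iota V) t) = \pi_(tensor iota' V') (tmap f u t).
Proof.
move=> fi ul; have u0 : u 0 = 0.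
  by have := ul (-1) 0 0; rewrite scaler0 add0r scaleN1r addNr.
have uD v w : u (v + w) = u v + u w by have := ul 1 v w; rewrite !scale1r.
have uZ a v : u (a *: v) = a *: u v by rewrite -[a *: v]addr0 ul u0 addr0.
apply/eqP/tensorP; have := tensor_repr iota t; move: (repr _) => s st.
elim: s t / st; try by move=> * /=; constructor.
- by move=> q r p _ qr _; exact: teq_trans qr.
- by move=> r /=; rewrite rmorph0 u0; exact: teq_add0.
- by move=> a b v /=; rewrite rmorphD; exact: teq_pureDl.
- by move=> a v w /=; rewrite uD; exact: teq_pureDr.
- by move=> a c v /=; rewrite rmorphM fi uZ; exact: teq_pureZ.
Qed.

Lemma tensor_map_tens (f : {rmorphism E -> E'}) (u : V -> V') a v :
  (forall a, f (iota a) = iota' a) -> linear u ->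
  tensor_map f u (tens iota a v) = tens iota' (f a) (u v).
Proof. by move=> fi ul; rewrite /tens tensor_mapE. Qed.

Lemma tensor_map_semilinear (f : {rmorphism E -> E'}) (u : V -> V') a x y :
  (forall a, f (iota a) = iota' a) -> linear u ->
  tensor_map f u (a *: x + y) = f a *: tensor_map f u x + tensor_map f u y.
Proof.
move=> fi ul; elim/quotW: x => x; elim/quotW: y => y.
rewrite tensor_piZ tensor_piD !tensor_mapE // tensor_piZ tensor_piD /=.
congr (\pi_(tensor iota' V') (TAdd _ _)).
by elim: x => [b v|s sP t tP] /=; rewrite ?rmorphM ?sP ?tP.
Qed.

End TensorMap.
Arguments tensor_map {F E E'} iota iota' {V V'} f u x.

Section ExtendedForm.
Variables (F E : fieldType) (iota : {rmorphism F -> E}) (V : lmodType F).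
Variable Q : V -> F.

(* The unique quadratic form on E (x) V extending Q. Here and below, xget x0 A
   is an element of A if there is one, and the junk value x0 otherwise. *)
Definition ext_form : tensor iota V -> E :=
  xget (fun=> 0)
    [set q | quadratic_form q /\ forall v, q (tens iota 1 v) = iota (Q v)].

Fixpoint tpolar1 (a : E) (v : V) (t : tterm E V) : E :=
  match t with
  | TPure b w => a * b * iota (polar Q v w)
  | TAdd s t => tpolar1 a v s + tpolar1 a v t
  end.

Fixpoint tpolar (s t : tterm E V) : E :=
  match s with
  | TPure a v => tpolar1 a v t
  | TAdd r s => tpolar r t + tpolar s t
  end.

Fixpoint tquad (t : tterm E V) : E :=
  match t with
  | TPure a v => a ^+ 2 * iota (Q v)
  | TAdd s t => tquad s + tquad t + tpolar s t
  end.

Lemma tpolarDr s t u : tpolar s (TAdd t u) = tpolar s t + tpolar s u.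
Proof. by elim: s => [a v|r IHr s IHs] //=; rewrite IHr IHs addrACA. Qed.

Lemma tpolarC s t : tpolar s t = tpolar t s.
Proof.
elim: s t => [a v|r IHr s IHs] t; last by rewrite tpolarDr /= IHr IHs.
elim: t => [b w|t IHt u IHu] /=; last by rewrite [LHS]/= -IHt -IHu.
by rewrite (mulrC a) /polar (addrC v) -!addrA (addrC (- Q v)).
Qed.

Hypothesis Qquad : quadratic_form Q.

Lemma polarDl v w x : polar Q (v + w) x = polar Q v x + polar Q w x.
Proof. by rewrite -[in LHS](scale1r v) Qquad.2 mul1r. Qed.

Lemma polar0l x : polar Q 0 x = 0.
Proof. by apply: (addrI (polar Q 0 x)); rewrite -polarDl !addr0. Qed.

Lemma polarZl a v x : polar Q (a *: v) x = a * polar Q v x.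
Proof. by rewrite -[a *: v]addr0 Qquad.2 polar0l addr0. Qed.

Lemma quadratic_form0 : Q 0 = 0.
Proof. by rewrite -(scale0r 0) Qquad.1 expr0n mul0r. Qed.

Lemma tpolar_teql s s' t : teq iota s s' -> tpolar s t = tpolar s' t.
Proof.
move=> ss; elim: s s' / ss => //=.
- by move=> r s u _ -> _ ->.
- by move=> ? ? ? ? _ -> _ ->.
- by move=> *; rewrite addrA.
- by move=> *; rewrite addrC.
- move=> s; rewrite -[RHS]add0r; congr (_ + _).
  by elim: t => [b w|t IHt u IHu] /=; rewrite ?IHt ?IHu ?addr0 // !mul0r.
- move=> a b v; elim: t => [c w|t IHt u IHu] /=; first by rewrite !mulrDl.
  by rewrite IHt IHu addrACA.
- move=> a v w; elim: t => [c x|t IHt u IHu] /=.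
    by rewrite polarDl rmorphD mulrDr.
  by rewrite IHt IHu addrACA.
- move=> a c v; elim: t => [b x|t IHt u IHu] /=; last by rewrite IHt IHu.
  by rewrite polarZl rmorphM !mulrA; congr (_ * _); rewrite mulrAC.
Qed.

Lemma tquad_teq s t : teq iota s t -> tquad s = tquad t.
Proof.
move=> st; elim: s t / st => //=.
- by move=> r s t _ -> _ ->.
- move=> s s' t t' ss -> tt ->; congr (_ + _).
  by rewrite (tpolar_teql _ ss) !(tpolarC s') (tpolar_teql _ tt).
- by move=> r s t; rewrite tpolarDr; ring.
- by move=> s t; rewrite tpolarC; ring.
- move=> t; rewrite expr0n mul0r add0r -[RHS]addr0; congr (_ + _).
  by elim: t => [b w|t IHt u IHu] /=; rewrite ?IHt ?IHu ?addr0 // !mul0r.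
- move=> a b v; have -> : polar Q v v = Q v + Q v.
    by rewrite /polar -mulr2n -scaler_nat Qquad.1; ring.
  by rewrite rmorphD; ring.
- by move=> a v w; rewrite /polar !rmorphB; ring.
- by move=> a c v; rewrite Qquad.1 rmorphM rmorphXn; ring.
Qed.

Let q (x : tensor iota V) : E := tquad (repr x).

Let qE t : q (\pi t) = tquad t.
Proof. by apply: tquad_teq; exact: tensor_repr. Qed.

Lemma tquad_scale a t : tquad (tscale a t) = a ^+ 2 * tquad t.
Proof.
have pZ s u : tpolar (tscale a s) (tscale a u) = a ^+ 2 * tpolar s u.
  elim: s => [b v|r IHr s IHs] /=; last by rewrite IHr IHs mulrDr.
  by elim: u => [c w|r IHr s IHs] /=; [ring|rewrite IHr IHs mulrDr].
elim: t => [b v|s IHs t IHt] /=; first by ring.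
by rewrite IHs IHt pZ; ring.
Qed.

Lemma tpolar_scale a s t : tpolar (tscale a s) t = a * tpolar s t.
Proof.
elim: s => [b v|r IHr s IHs] /=; last by rewrite IHr IHs mulrDr.
by elim: t => [c w|r IHr s IHs] /=; [ring|rewrite IHr IHs mulrDr].
Qed.

Lemma ext_formP :
  quadratic_form ext_form /\ forall v, ext_form (tens iota 1 v) = iota (Q v).
Proof.
pose P := [set q : tensor iota V -> E |
  quadratic_form q /\ forall v, q (tens iota 1 v) = iota (Q v)].
suff: P q by exact: (@xgetI _ (fun=> 0) P).
have pE s t : polar q (\pi s) (\pi t) = tpolar s t.
  by rewrite /polar tensor_piD !qE /=; ring.
split; last by move=> v; rewrite qE /= expr1n mul1r.
split=> [a x|a x y z].
  by elim/quotW: x => t; rewrite tensor_piZ !qE tquad_scale.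
elim/quotW: x => x; elim/quotW: y => y; elim/quotW: z => z.
by rewrite tensor_piZ tensor_piD !pE /= tpolar_scale.
Qed.

End ExtendedForm.

Section GaloisDescent.
Variables (F E : fieldType) (iota : {rmorphism F -> E}) (V : lmodType F).

Definition tensor_gal (s : gal iota) : tensor iota V -> tensor iota V :=
  tensor_map iota iota s id.

Definition tensor_lin (u : V -> V) : tensor iota V -> tensor iota V :=
  tensor_map iota iota id u.

Variables (Q : V -> F) (phi : gal iota -> orthogonal_group Q).

Definition twist_pred : {pred tensor iota V} := fun x =>
  `[< forall s, tensor_lin (phi s) (tensor_gal s x) = x >].

Lemma twist_semilinear s a x y :
  tensor_lin (phi s) (tensor_gal s (a *: x + y)) =
  s a *: tensor_lin (phi s) (tensor_gal s x)
  + tensor_lin (phi s) (tensor_gal s y).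
Proof.
have [phil _ _] := orth_isometry (phi s).
rewrite /tensor_gal tensor_map_semilinear //; last exact: gal_fix.
by rewrite /tensor_lin (@tensor_map_semilinear _ _ _ _ _ _ _ idfun).
Qed.

Lemma twist_closed : zmod_closed twist_pred.
Proof.
have sl := twist_semilinear.
split.
  apply/asboolP => s; have := sl s (-1) 0 0.
  by rewrite scaler0 add0r rmorphN1 scaleN1r addNr.
move=> x y /asboolP xP /asboolP yP; apply/asboolP => s.
by rewrite addrC -scaleN1r sl xP yP rmorphN1.
Qed.
HB.instance Definition _ := GRing.isZmodClosed.Build (tensor iota V) twist_pred
  twist_closed.

Record twist := Twist { twist_val :> tensor iota V; _ : twist_val \in twist_pred }.
HB.instance Definition _ := [isSub for twist_val].
HB.instance Definition _ := [Choice of twist by <:].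
HB.instance Definition _ := [SubChoice_isSubZmodule of twist by <:].

Lemma twist_scale_subproof (a : F) (x : twist) :
  iota a *: twist_val x \in twist_pred.
Proof.
case: x => x /= /asboolP xP; apply/asboolP => s.
have := twist_semilinear s (iota a) x 0.
have := twist_semilinear s 1 0 0.
rewrite scaler0 addr0 rmorph1 scale1r => /(canLR (addrK _)).
by rewrite subrr => <-; rewrite !addr0 gal_fix xP.
Qed.
Definition twist_scale a x := Twist (twist_scale_subproof a x).

Lemma twist_scaleA a b x :
  twist_scale a (twist_scale b x) = twist_scale (a * b) x.
Proof. by apply: val_inj; rewrite /= scalerA rmorphM. Qed.
Lemma twist_scale1 : left_id 1 twist_scale.
Proof. by move=> x; apply: val_inj; rewrite /= rmorph1 scale1r. Qed.
Lemma twist_scaleDr : right_distributive twist_scale +%R.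
Proof. by move=> a x y; apply: val_inj; rewrite /= scalerDr. Qed.
Lemma twist_scaleDl x : {morph twist_scale^~ x : a b / a + b}.
Proof. by move=> a b; apply: val_inj; rewrite /= rmorphD scalerDl. Qed.

HB.instance Definition _ := GRing.Zmodule_isLmodule.Build F twist
  twist_scaleA twist_scale1 twist_scaleDr twist_scaleDl.

(* ext_form takes values in iota(F) on V_phi. *)
Definition twist_form (x : twist) : F :=
  xget 0 [set a | iota a = ext_form Q (twist_val x)].

End GaloisDescent.
Arguments twist_form {F E iota V Q} phi x.

Inductive cterm (K W : Type) :=
  | CVec of W
  | CScal of K
  | CAdd of cterm K W & cterm K W
  | CMul of cterm K W & cterm K W.

HB.instance Definition _ (K W : Type) := gen_eqMixin (cterm K W).
HB.instance Definition _ (K W : Type) := gen_choiceMixin (cterm K W).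

Section Clifford.
Variables (K : fieldType) (W : lmodType K) (q : W -> K).
Local Notation term := (cterm K W).
Local Notation CVec := (@CVec K W).
Local Notation CScal := (@CScal K W).
Implicit Types x y z : term.

(* The congruence presenting the Clifford algebra: unital associative
   K-algebra axioms, linearity of W -> C(q), and v^2 = q(v). *)
Inductive ceq : term -> term -> Prop :=
| ceq_refl x : ceq x x
| ceq_sym x y : ceq x y -> ceq y x
| ceq_trans x y z : ceq x y -> ceq y z -> ceq x z
| ceq_add x x' y y' : ceq x x' -> ceq y y' -> ceq (CAdd x y) (CAdd x' y')
| ceq_mul x x' y y' : ceq x x' -> ceq y y' -> ceq (CMul x y) (CMul x' y')
| ceq_addA x y z : ceq (CAdd x (CAdd y z)) (CAdd (CAdd x y) z)
| ceq_addC x y : ceq (CAdd x y) (CAdd y x)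
| ceq_add0 x : ceq (CAdd (CScal 0) x) x
| ceq_addN x : ceq (CAdd (CMul (CScal (-1)) x) x) (CScal 0)
| ceq_mulA x y z : ceq (CMul x (CMul y z)) (CMul (CMul x y) z)
| ceq_1mul x : ceq (CMul (CScal 1) x) x
| ceq_mulDl x y z : ceq (CMul (CAdd x y) z) (CAdd (CMul x z) (CMul y z))
| ceq_mulDr x y z : ceq (CMul z (CAdd x y)) (CAdd (CMul z x) (CMul z y))
| ceq_scalD a b : ceq (CScal (a + b)) (CAdd (CScal a) (CScal b))
| ceq_scalM a b : ceq (CScal (a * b)) (CMul (CScal a) (CScal b))
| ceq_scalC a x : ceq (CMul (CScal a) x) (CMul x (CScal a))
| ceq_vecD v w : ceq (CVec (v + w)) (CAdd (CVec v) (CVec w))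
| ceq_vecZ a v : ceq (CVec (a *: v)) (CMul (CScal a) (CVec v))
| ceq_vec2 v : ceq (CMul (CVec v) (CVec v)) (CScal (q v)).

Definition ceqb : rel term := fun x y => `[< ceq x y >].

Lemma ceqb_equiv : equiv_class_of ceqb.
Proof.
split=> [x|x y|y x z].
- by apply/asboolP; exact: ceq_refl.
- by apply/asboolP/asboolP; exact: ceq_sym.
- by move=> /asboolP xy /asboolP yz; apply/asboolP; exact: ceq_trans xy yz.
Qed.
Canonical ceqb_equivRel := EquivRelPack ceqb_equiv.

Definition clifford := {eq_quot ceqb}.
HB.instance Definition _ : EqQuotient term ceqb clifford := EqQuotient.on clifford.
HB.instance Definition _ := Choice.on clifford.

Lemma cliffordP x y : reflect (ceq x y) (x == y %[mod clifford]).
Proof. by rewrite piE; exact: asboolP. Qed.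

Lemma clifford_eq x y : ceq x y -> \pi_clifford x = \pi_clifford y.
Proof. by move=> xy; apply/eqP/cliffordP. Qed.

Lemma clifford_repr x : ceq (repr (\pi_clifford x)) x.
Proof. by apply/cliffordP; rewrite reprK. Qed.

Definition cliff_vec (v : W) : clifford := \pi_clifford (CVec v).
Definition cliff_scal (a : K) : clifford := \pi_clifford (CScal a).
Definition cliff_zero : clifford := cliff_scal 0.
Definition cliff_one : clifford := cliff_scal 1.
Definition cliff_add (x y : clifford) : clifford :=
  \pi_clifford (CAdd (repr x) (repr y)).
Definition cliff_mul (x y : clifford) : clifford :=
  \pi_clifford (CMul (repr x) (repr y)).
Definition cliff_scale (a : K) (x : clifford) : clifford :=
  cliff_mul (cliff_scal a) x.
Definition cliff_opp := cliff_scale (-1).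

Lemma cliff_addE x y :
  cliff_add (\pi_clifford x) (\pi_clifford y) = \pi_clifford (CAdd x y).
Proof. by apply: clifford_eq; apply: ceq_add; exact: clifford_repr. Qed.

Lemma cliff_mulE x y :
  cliff_mul (\pi_clifford x) (\pi_clifford y) = \pi_clifford (CMul x y).
Proof. by apply: clifford_eq; apply: ceq_mul; exact: clifford_repr. Qed.

Lemma cliff_addA : associative cliff_add.
Proof.
elim/quotW => x; elim/quotW => y; elim/quotW => z.
rewrite (cliff_addE y z) (cliff_addE x y) (cliff_addE x).
by rewrite (cliff_addE (CAdd x y)); apply: clifford_eq; exact: ceq_addA.
Qed.
Lemma cliff_addC : commutative cliff_add.
Proof.
elim/quotW => x; elim/quotW => y.
by rewrite (cliff_addE x) (cliff_addE y); apply: clifford_eq; exact: ceq_addC.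
Qed.
Lemma cliff_add0 : left_id cliff_zero cliff_add.
Proof.
by elim/quotW => x; rewrite cliff_addE; apply: clifford_eq; exact: ceq_add0.
Qed.
Lemma cliff_mulA : associative cliff_mul.
Proof.
elim/quotW => x; elim/quotW => y; elim/quotW => z.
rewrite (cliff_mulE y z) (cliff_mulE x y) (cliff_mulE x).
by rewrite (cliff_mulE (CMul x y)); apply: clifford_eq; exact: ceq_mulA.
Qed.
Lemma cliff_scalC a (x : clifford) : cliff_mul (cliff_scal a) x = cliff_mul x (cliff_scal a).
Proof.
elim/quotW: x => x; rewrite cliff_mulE (cliff_mulE x).
by apply: clifford_eq; exact: ceq_scalC.
Qed.
Lemma cliff_1mul : left_id cliff_one cliff_mul.
Proof.
by elim/quotW => x; rewrite cliff_mulE; apply: clifford_eq; exact: ceq_1mul.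
Qed.
Lemma cliff_mul1 : right_id cliff_one cliff_mul.
Proof. by move=> x; rewrite -cliff_scalC cliff_1mul. Qed.
Lemma cliff_mulDl : left_distributive cliff_mul cliff_add.
Proof.
elim/quotW => x; elim/quotW => y; elim/quotW => z.
rewrite (cliff_addE x) (cliff_mulE x) (cliff_mulE y) (cliff_mulE (CAdd x y)).
by rewrite (cliff_addE (CMul x z)); apply: clifford_eq; exact: ceq_mulDl.
Qed.
Lemma cliff_mulDr : right_distributive cliff_mul cliff_add.
Proof.
elim/quotW => z; elim/quotW => x; elim/quotW => y.
rewrite (cliff_addE x) (cliff_mulE z x) (cliff_mulE z y) (cliff_mulE z).
by rewrite (cliff_addE (CMul z x)); apply: clifford_eq; exact: ceq_mulDr.
Qed.
Lemma cliff_scalD a b :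
  cliff_scal (a + b) = cliff_add (cliff_scal a) (cliff_scal b).
Proof.
by rewrite [RHS]cliff_addE; apply: clifford_eq; exact: ceq_scalD.
Qed.
Lemma cliff_scalM a b :
  cliff_scal (a * b) = cliff_mul (cliff_scal a) (cliff_scal b).
Proof.
by rewrite [RHS]cliff_mulE; apply: clifford_eq; exact: ceq_scalM.
Qed.
Lemma cliff_addN : left_inverse cliff_zero cliff_opp cliff_add.
Proof.
elim/quotW => x; rewrite /cliff_opp /cliff_scale cliff_mulE cliff_addE.
by apply: clifford_eq; exact: ceq_addN.
Qed.

HB.instance Definition _ := GRing.isZmodule.Build clifford
  cliff_addA cliff_addC cliff_add0 cliff_addN.
HB.instance Definition _ := GRing.Zmodule_isPzRing.Build clifford
  cliff_mulA cliff_1mul cliff_mul1 cliff_mulDl cliff_mulDr.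

Lemma cliff_scaleA a b (x : clifford) :
  cliff_scale a (cliff_scale b x) = cliff_scale (a * b) x.
Proof. by rewrite /cliff_scale cliff_mulA -cliff_scalM. Qed.
Lemma cliff_scaleDl (x : clifford) : {morph cliff_scale^~ x : a b / a + b}.
Proof. by move=> a b; rewrite /cliff_scale cliff_scalD cliff_mulDl. Qed.

HB.instance Definition _ := GRing.Zmodule_isLmodule.Build K clifford
  cliff_scaleA cliff_1mul (fun a => cliff_mulDr (cliff_scal a)) cliff_scaleDl.

Lemma cliff_piD x y :
  \pi_clifford x + \pi_clifford y = \pi_clifford (CAdd x y).
Proof. exact: cliff_addE. Qed.
Lemma cliff_piM x y :
  \pi_clifford x * \pi_clifford y = \pi_clifford (CMul x y).
Proof. exact: cliff_mulE. Qed.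

Lemma cliff_vec_sqr v : cliff_vec v * cliff_vec v = cliff_scal (q v).
Proof.
by rewrite /cliff_vec cliff_piM; apply: clifford_eq; exact: ceq_vec2.
Qed.

Lemma cliff_vec_linear : linear cliff_vec.
Proof.
move=> a v w.
have -> : a *: cliff_vec v = \pi_clifford (CMul (CScal a) (CVec v)).
  exact: cliff_mulE.
rewrite /cliff_vec cliff_piD.
apply: clifford_eq; apply: ceq_trans (ceq_vecD _ _) _.
by apply: ceq_add; [exact: ceq_vecZ|exact: ceq_refl].
Qed.

(* cliff_homog d is the homogeneous component of degree d (true is odd). *)
Inductive cliff_homog : bool -> clifford -> Prop :=
| homog_scal a : cliff_homog false (cliff_scal a)
| homog_vec v : cliff_homog true (cliff_vec v)
| homog_add d (x y : clifford) : cliff_homog d x -> cliff_homog d y -> cliff_homog d (x + y)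
| homog_mul d e (x y : clifford) : cliff_homog d x -> cliff_homog e y ->
    cliff_homog (d (+) e) (x * y).

Fixpoint ctr (x : term) : term :=
  match x with
  | CAdd x y => CAdd (ctr x) (ctr y)
  | CMul x y => CMul (ctr y) (ctr x)
  | _ => x
  end.

Definition cliff_tr (x : clifford) : clifford := \pi_clifford (ctr (repr x)).

Lemma cliff_trE x : cliff_tr (\pi_clifford x) = \pi_clifford (ctr x).
Proof.
apply: clifford_eq; have := clifford_repr x; move: (repr _) => y yx.
elim: y x / yx; try by move=> * /=; constructor.
- by move=> x y z _ xy _; exact: (ceq_trans xy).
- move=> x /=; apply: (ceq_trans _ (ceq_addN (ctr x))); apply: ceq_add.
    by apply: ceq_sym; exact: ceq_scalC.
  exact: ceq_refl.
- by move=> x y z /=; apply: ceq_sym; exact: ceq_mulA.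
- move=> x /=; apply: ceq_trans (ceq_sym (ceq_scalC _ _)) _; exact: ceq_1mul.
- by move=> a b /=; rewrite mulrC; exact: ceq_scalM.
- by move=> a x /=; apply: ceq_sym; exact: ceq_scalC.
- move=> a v /=; apply: ceq_trans (ceq_vecZ _ _) _; exact: ceq_scalC.
Qed.

(* For x homogeneous of degree d with inverse y, and z of degree 1, this is
   Int_s(x)(z). *)
Definition cliff_int (d : bool) (x y z : clifford) : clifford :=
  (-1) ^+ d * (x * z * y).

Definition clifford_group (x : clifford) : Prop :=
  exists d (y : clifford), [/\ cliff_homog d x, x * y = 1, y * x = 1 &
    [set cliff_int d x y (cliff_vec w) | w in [set: W]] =
    [set cliff_vec w | w in [set: W]]].

Definition cliff_rho (x : clifford) (w : W) : W :=
  xget 0 [set w' | exists d (y : clifford), [/\ cliff_homog d x, x * y = 1, y * x = 1 &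
    cliff_vec w' = cliff_int d x y (cliff_vec w)]].

Definition clifford_lift (x : clifford) (g : W -> W) : Prop :=
  clifford_group x /\ cliff_rho x = g.

Definition orth_deg (g : W -> W) : 'F_2 :=
  if `[< exists2 x : clifford, clifford_lift x g & cliff_homog true x >] then 1 else 0.

Definition cliff_norm_is (x : clifford) (b : Gm K) : Prop :=
  cliff_tr x * x = cliff_scal (gm_val b).

Definition spinor_norm (g : orthogonal_group q) : square_classes K :=
  xget 0 [set c | exists (x : clifford) b,
    [/\ clifford_lift x g, cliff_norm_is x b &
        c = \pi_(Quotient.quot (@gm_squares K)) b]].

End Clifford.

Section CliffordMap.
Variables (K L : fieldType) (W : lmodType K) (X : lmodType L).
Variables (q : W -> K) (r : X -> L).

Fixpoint cmap (f : K -> L) (u : W -> X) (x : cterm K W) : cterm L X :=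
  match x with
  | CVec w => CVec L (u w)
  | CScal a => CScal X (f a)
  | CAdd x y => CAdd (cmap f u x) (cmap f u y)
  | CMul x y => CMul (cmap f u x) (cmap f u y)
  end.

(* The ring morphism C(q) -> C(r) extending f and u, for u an f-semilinear map
   such that r (u w) = f (q w). *)
Definition cliff_map (f : K -> L) (u : W -> X) (x : clifford q) : clifford r :=
  \pi_(clifford r) (cmap f u (repr x)).

Lemma cliff_mapE (f : {rmorphism K -> L}) (u : W -> X) x :
  (forall a v w, u (a *: v + w) = f a *: u v + u w) ->
  (forall w, r (u w) = f (q w)) ->
  cliff_map f u (\pi_(clifford q) x) = \pi_(clifford r) (cmap f u x).
Proof.
move=> ul ur.
have u0 : u 0 = 0.
  by have := ul (-1) 0 0; rewrite scaler0 add0r rmorphN1 scaleN1r addNr.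
have uD v w : u (v + w) = u v + u w.
  by have := ul 1 v w; rewrite rmorph1 !scale1r.
have uZ a v : u (a *: v) = f a *: u v by rewrite -[a *: v]addr0 ul u0 addr0.
apply: clifford_eq; have := clifford_repr q x; move: (repr _) => y yx.
elim: y x / yx; try by move=> * /=; constructor.
- by move=> x y z _ xy _; exact: (ceq_trans xy).
- by move=> x /=; rewrite rmorph0; exact: ceq_add0.
- by move=> x /=; rewrite rmorphN1 rmorph0; exact: ceq_addN.
- by move=> x /=; rewrite rmorph1; exact: ceq_1mul.
- by move=> a b /=; rewrite rmorphD; exact: ceq_scalD.
- by move=> a b /=; rewrite rmorphM; exact: ceq_scalM.
- by move=> v w /=; rewrite uD; exact: ceq_vecD.
- by move=> a v /=; rewrite uZ; exact: ceq_vecZ.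
- by move=> v /=; rewrite -ur; exact: ceq_vec2.
Qed.

End CliffordMap.

Section Brauer.
Variables (F E : fieldType) (iota : {rmorphism F -> E}).
Local Notation Gamma := (gal iota).

Lemma gm_gact_discrete (b : Gm E) :
  locally_constant (fun s : Gamma => gm_map s b).
Proof.
move=> s; have : nbhs s [set t : Gamma | t (gm_val b) = s (gm_val b)].
  apply: open_nbhs_nbhs; split => //; rewrite gal_openE => t /= tb.
  by exists [:: gm_val b] => u /(_ _ (mem_head _ _)) ->.
by apply: filterS => t tb; apply: val_inj.
Qed.

Definition gm_gmod : gmod iota.
Proof.
exists (Gm E) (fun s => gm_map s); last exact: gm_gact_discrete.
- by move=> s x y; apply: val_inj; rewrite /= rmorphM fmorphV.
- by move=> m; apply: val_inj.
- by move=> s t m; apply: val_inj.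
Defined.

Definition F2_gmod : gmod iota := trivial_gmod iota 'F_2.

Definition Br : zmodType := H2 gm_gmod.

Definition Br2_pred : {pred Br} := fun x => x *+ 2 == 0.

Lemma Br2_closed : zmod_closed Br2_pred.
Proof.
split; first by rewrite unfold_in mul0rn.
by move=> x y; rewrite !unfold_in mulrnBl => /eqP -> /eqP ->; rewrite subr0.
Qed.
HB.instance Definition _ := GRing.isZmodClosed.Build Br Br2_pred Br2_closed.

Record Br2 := MkBr2 { br2_val :> Br; _ : br2_val \in Br2_pred }.
HB.instance Definition _ := [isSub for br2_val].
HB.instance Definition _ := [Choice of Br2 by <:].
HB.instance Definition _ := [SubChoice_isSubZmodule of Br2 by <:].

Lemma H2_class_Br2 (z : Gamma * Gamma -> gm_gmod) :
  (forall st, z st *+ 2 = 0) -> H2_class z \in Br2_pred.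
Proof.
move=> z2; rewrite unfold_in /H2_class mulr2n -[X in X == _]Quotient.pi_add.
have -> : insubd (0 : Z2 gm_gmod) z + insubd 0 z = 0.
  rewrite /insubd; case: insubP => [c _ cz|_]; last by rewrite addr0.
  apply: val_inj; apply/funext => st.
  by rewrite raddfD /= fctE -[LHS]mulr2n -[RHS](z2 st) -cz.
by apply/eqP; exact: pi_zeror.
Qed.

Lemma gm_sign2 (n : 'F_2) : gm_sign E n *+ 2 = 0.
Proof.
apply: val_inj; rewrite mulr2n.
change ((-1) ^+ (n : nat) * (-1) ^+ (n : nat) = 1 :> E).
by rewrite -expr2 sqrr_sign.
Qed.

Lemma sign_Br2_subproof (x : H2 F2_gmod) :
  H2_map (fun n : F2_gmod => gm_sign E n : gm_gmod) x \in Br2_pred.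
Proof. by apply: H2_class_Br2 => st; exact: gm_sign2. Qed.
Definition sign_Br2 (x : H2 F2_gmod) : Br2 := MkBr2 (sign_Br2_subproof x).

Lemma cup_Br2_subproof (x y : H1 F2_gmod) :
  cup11 (fun m n : F2_gmod => gm_sign E (m * n) : gm_gmod) x y \in Br2_pred.
Proof. by apply: H2_class_Br2 => st; exact: gm_sign2. Qed.
Definition cup_Br2 (x y : H1 F2_gmod) : Br2 := MkBr2 (cup_Br2_subproof x y).

Definition Brs : Type := (H1 F2_gmod * Br2)%type.
Definition Brs_add (x y : Brs) : Brs :=
  (x.1 + y.1, x.2 + y.2 + cup_Br2 x.1 y.1).
Definition Brs_of_Br2 (x : Br2) : Brs := (0, x).

(* The connecting map of 0 -> Z -> Z -> F_2 -> 0, computed with the lifts 0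
   and 1 of the elements of F_2. *)
Definition bockstein (chi : H1 F2_gmod) : H2 (trivial_gmod iota int) :=
  let l s : int := (H1_cocycle chi s : nat)%:Z in
  H2_class (M := trivial_gmod iota int)
    (fun st => ((l st.1 + l st.2 - l (st.1 * st.2)%g) %/ 2)%Z).

(* {chi, b} = b cup (bockstein chi), with b an invariant element of E^x. *)
Definition symbol (chi : H1 F2_gmod) (b : Gm F) : Br :=
  cup02 (P := gm_gmod) (fun (u : gm_gmod) (n : trivial_gmod iota int) => u *~ n)
    (gm_map iota b) (bockstein chi).

Definition sq_gmod : gmod iota := trivial_gmod iota (square_classes F).

(* The image of chi (x) b in H^1(Gamma, F^x / (F^x)^2). *)
Definition H1_tensor (chi : H1 F2_gmod) (b : square_classes F) : H1 sq_gmod :=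
  H1_class (M := sq_gmod) (fun s => b *+ (H1_cocycle chi s : nat)).

(* The classes H1_tensor chi b generate H^1(Gamma, F^x / (F^x)^2), so that at
   most one homomorphism takes the prescribed values. *)
Definition xi : H1 sq_gmod -> Br2 :=
  xget (fun=> 0) [set f | zmod_morphism f /\ forall chi (b : Gm F),
    br2_val (f (H1_tensor chi (\pi_(Quotient.quot (@gm_squares F)) b)))
      = symbol chi b].

End Brauer.

Section HasseWitt.
Variables (F E : fieldType) (iota : {rmorphism F -> E}).
Local Notation Gamma := (gal iota).

Definition gal_conj (V V' : lmodType F) (s : Gamma)
    (u : tensor iota V -> tensor iota V') : tensor iota V -> tensor iota V' :=
  tensor_gal s \o u \o tensor_gal s^-1%g.

Variables (V : lmodType F) (Q : V -> F).
Local Notation QE := (ext_form (iota := iota) Q).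
Local Notation VE := (tensor iota V).

Definition orth_cocycle (c : Gamma -> VE -> VE) : Prop :=
  [/\ locally_constant c, forall s, qf_isometry QE QE (c s)
    & forall s t, c (s * t)%g = c s \o gal_conj s (c t)].

(* c' s = g^-1 (c s) s(g), written without the inverse. *)
Definition orth_cohomologous (c c' : Gamma -> VE -> VE) : Prop :=
  exists2 g, qf_isometry QE QE g & forall s, g \o c' s = c s \o gal_conj s g.

(* An element of H^1(F, O(Q)) is represented by the set of its cocycles. *)
Definition H1_orth_class (c : Gamma -> VE -> VE) : set (Gamma -> VE -> VE) :=
  [set c' | orth_cocycle c' /\ orth_cohomologous c c'].

(* The class of the cocycle c s = u^-1 s(u), for u an isometry over E. *)
Definition HW_inv (V' : lmodType F) (Q' : V' -> F) : set (Gamma -> VE -> VE) :=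
  xget set0 [set X | exists u c,
    [/\ qf_isometry QE (ext_form (iota := iota) Q') u,
        forall s, u \o c s = gal_conj s u & X = H1_orth_class c]].

Definition deg_star (X : set (Gamma -> VE -> VE)) : H1 (F2_gmod iota) :=
  xget 0 [set y | exists2 c, X c &
    y = H1_class (M := F2_gmod iota) (fun s => orth_deg QE (c s))].

Definition cliff_gal (s : Gamma) : clifford QE -> clifford QE :=
  cliff_map QE s (tensor_gal s).

(* The connecting map of 1 -> Gm -> Cl(Q) -> O(Q) -> 1: if x lifts c, the
   2-cocycle is z(s,t) = x(s) s(x(t)) x(st)^-1. *)
Definition connecting (X : set (Gamma -> VE -> VE)) : Br2 iota :=
  xget 0 [set y | exists c (x : Gamma -> clifford QE) (z : Z2 (gm_gmod iota)),
    [/\ X c, locally_constant x, forall s, clifford_lift (x s) (c s),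
        forall s t, x s * cliff_gal s (x t)
                    = cliff_scal QE (gm_val (z (s, t))) * x (s * t)%g
      & br2_val y = H2_class z]].

End HasseWitt.

Definition HW (F E : fieldType) (iota : {rmorphism F -> E})
    (V' : lmodType F) (Q' : V' -> F) (V : lmodType F) (Q : V -> F) : Brs iota :=
  let X := HW_inv (iota := iota) Q Q' in
  (deg_star Q X, connecting Q X).

Section StiefelWhitney.
Variables (F E : fieldType) (iota : {rmorphism F -> E}).
Variables (k : fieldType) (j : {rmorphism F -> k}).
Variables (V : lmodType F) (Q : V -> F) (phi : gal iota -> orthogonal_group Q).
Local Notation Qk := (ext_form (iota := j) Q).
Local Notation phik s := (tensor_lin (iota := j) (phi s)).

Definition SW1 : H1 (F2_gmod iota) :=
  H1_class (M := F2_gmod iota) (fun s => orth_deg Qk (phik s)).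

(* The x(s) lie in the kernel of N on Cl(Q)(k), and the 2-cocycle
   x(s) x(t) x(st)^-1 = (-1)^z(s,t) takes values in mu_2(k). *)
Definition SW2 : H2 (F2_gmod iota) :=
  if 2%N \in [pchar F] then 0 else
  xget 0 [set y | exists (x : gal iota -> clifford Qk) (z : Z2 (F2_gmod iota)),
    [/\ locally_constant x,
        forall s, clifford_lift (x s) (phik s) /\ cliff_tr (x s) * x s = 1,
        forall s t, x s * x t
                    = cliff_scal Qk (gm_val (gm_sign k (z (s, t)))) * x (s * t)%g
      & y = H2_class z]].

Definition SWbar : Brs iota := (SW1, sign_Br2 SW2).

End StiefelWhitney.

(* Main.v *)
Require Import Defs.
From HB Require Import structures.
From mathcomp Require Import all_boot all_order all_algebra.
From mathcomp Require Import separable.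
From mathcomp Require Import all_classical.
From mathcomp Require Import topology ring.
Set Implicit Arguments.
Unset Strict Implicit.
Unset Printing Implicit Defensive.

Import GRing.Theory.
Local Open Scope classical_set_scope.
Local Open Scope quotient_scope.
Local Open Scope ring_scope.

(* A lift x of g in O(Q) to the Clifford group is determined up to scalars by
   the relation g(v) x = (-1)^deg(x) x v, and can be chosen over F. With lifts
   x(s) of phi(s) over F one has x(s) x(t) = z(s,t) x(st) for a 2-cocycle z with
   values in F^x. By Galois descent the cocycle attached to the twist is phi
   itself, and since the x(s) are Galois invariant, z represents the connecting
   class in HW. Over the algebraically closed field k one normalizes x(s) to
   x(s) / h(s) with h(s)^2 = N(x(s)); then z(s,t) is the sign defining SW_2 times
   h(s) h(t) / h(st). As N(x(s)) represents the spinor norm of phi(s), the second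
   factor represents xi of the spinor norm: for chi (x) b one takes h = sqrt(b)^chi,
   which gives the cocycle b^(chi(s) chi(t)) of the symbol {chi, b}. *)

(** * Clifford algebras and their lifts of isometries *)

(** The Clifford algebra is given by generators and relations, so even the injectivity of the
    scalars needs proof: the algebra is made to act on an exterior algebra. This action also
    separates even from odd invertible elements in characteristic 2, where the sign automorphism is
    trivial. To cover all characteristics, neither orthogonal bases nor products of reflections are
    used; lifts are found and compared by means of anticommuting odd operators on the algebra. The
    fields E and k are unrelated extensions of F. Identities involving square roots are checked in k
    with trivial action and carried to E through $F^\times$, where all scalars in question lie. The
    invariants select an arbitrary object with a given property, so each of them requires both a
    suitable object and the independence of the choice. For xi, independence rests on the fact that
    a locally constant homomorphism on $\Gamma$ has finite image, hence is a finite sum of classes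
    $\chi\otimes b$. *)

Section CliffordCalculus.
Variables (K : fieldType) (W : lmodType K) (q : W -> K).
Local Notation C := (clifford q).
Local Notation vec := (cliff_vec q).
Local Notation scal := (cliff_scal q).
Implicit Types (x y z : C) (v w : W) (a b : K).

Lemma cliff_ind (P : C -> Prop) :
  (forall v, P (vec v)) -> (forall a, P (scal a)) ->
  (forall x y, P x -> P y -> P (x + y)) ->
  (forall x y, P x -> P y -> P (x * y)) -> forall x, P x.
Proof.
move=> Pv Ps PD PM; elim/quotW; elim=> [v|a|x Px y Py|x Px y Py].
- exact: Pv.
- exact: Ps.
- by rewrite -cliff_piD; exact: PD.
- by rewrite -cliff_piM; exact: PM.
Qed.

Lemma cliff_scalC_ring a x : scal a * x = x * scal a.
Proof. exact: cliff_scalC. Qed.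

Lemma cliff_scalDE a b : scal (a + b) = scal a + scal b.
Proof. exact: cliff_scalD. Qed.

Lemma cliff_scalME a b : scal (a * b) = scal a * scal b.
Proof. exact: cliff_scalM. Qed.

Lemma cliff_scal0 : scal 0 = 0. Proof. by []. Qed.
Lemma cliff_scal1 : scal 1 = 1. Proof. by []. Qed.

Lemma cliff_scalN a : scal (- a) = - scal a.
Proof. by apply/eqP; rewrite -addr_eq0 -cliff_scalDE addNr. Qed.

Lemma cliff_vecD v w : vec (v + w) = vec v + vec w.
Proof. by have := cliff_vec_linear q 1 v w; rewrite !scale1r. Qed.

Lemma cliff_vec0 : vec 0 = 0.
Proof. by apply: (addrI (vec 0)); rewrite -cliff_vecD !addr0. Qed.

Lemma cliff_vecZ a v : vec (a *: v) = scal a * vec v.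
Proof.
by have := cliff_vec_linear q a v 0; rewrite !addr0 cliff_vec0 addr0.
Qed.

Lemma cliff_vecN v : vec (- v) = - vec v.
Proof. by rewrite -scaleN1r cliff_vecZ cliff_scalN mulNr mul1r. Qed.

Lemma cliff_anticomm v w : vec v * vec w + vec w * vec v = scal (polar q v w).
Proof.
rewrite /polar !cliff_scalDE !cliff_scalN -!cliff_vec_sqr cliff_vecD.
rewrite mulrDl !mulrDr; set x := vec v; set y := vec w.
by apply/eqP; rewrite -addrA -opprD eq_sym subr_eq [x * x + _]addrC addrACA.
Qed.

Fixpoint alpha_term (t : cterm K W) : C :=
  match t with
  | CVec v => - vec v
  | CScal a => scal a
  | CAdd s t => alpha_term s + alpha_term t
  | CMul s t => alpha_term s * alpha_term t
  end.

(* The grading automorphism: it acts on homogeneous elements of degree d as (-1)^d. *)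
Definition alpha x := alpha_term (repr x).

Lemma alphaE t : alpha (\pi_C t) = alpha_term t.
Proof.
rewrite /alpha; have := clifford_repr q t; move: (repr _) => s st.
elim: s t / st => //=.
- by move=> x y z _ -> _ ->.
- by move=> x x' y y' _ -> _ ->.
- by move=> x x' y y' _ -> _ ->.
- by move=> x y z; rewrite addrA.
- by move=> x y; rewrite addrC.
- by move=> x; rewrite cliff_scal0 add0r.
- by move=> x; rewrite cliff_scalN mulNr mul1r addNr.
- by move=> x y z; rewrite mulrA.
- by move=> x; rewrite cliff_scal1 mul1r.
- by move=> x y z; rewrite mulrDl.
- by move=> x y z; rewrite mulrDr.
- exact: cliff_scalD.
- exact: cliff_scalM.
- by move=> a x; rewrite cliff_scalC_ring.
- by move=> v w; rewrite cliff_vecD opprD.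
- by move=> a v; rewrite cliff_vecZ mulrN.
- by move=> v; rewrite mulrNN cliff_vec_sqr.
Qed.

Lemma alpha_vec v : alpha (vec v) = - vec v.
Proof. exact: alphaE. Qed.
Lemma alpha_scal a : alpha (scal a) = scal a.
Proof. exact: alphaE. Qed.
Lemma alphaD x y : alpha (x + y) = alpha x + alpha y.
Proof.
elim/quotW: x => x; elim/quotW: y => y; by rewrite cliff_piD !alphaE.
Qed.
Lemma alphaM x y : alpha (x * y) = alpha x * alpha y.
Proof.
elim/quotW: x => x; elim/quotW: y => y; by rewrite cliff_piM !alphaE.
Qed.
Lemma alpha1 : alpha 1 = 1.
Proof. exact: alpha_scal. Qed.

Lemma alphaK : involutive alpha.
Proof.
elim/cliff_ind => [v|a|x y Hx Hy|x y Hx Hy].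
- by rewrite alpha_vec -cliff_vecN alpha_vec cliff_vecN opprK.
- by rewrite !alpha_scal.
- by rewrite !alphaD Hx Hy.
- by rewrite !alphaM Hx Hy.
Qed.

Fixpoint contr_term (f : W -> K) (t : cterm K W) : C :=
  match t with
  | CVec v => scal (f v)
  | CScal a => 0
  | CAdd s t => contr_term f s + contr_term f t
  | CMul s t => contr_term f s * \pi_C t + alpha_term s * contr_term f t
  end.

(* The graded derivation of degree -1 extending a linear form. *)
Definition contr (f : W -> K) x := contr_term f (repr x).

Section Contraction.
Variable f : W -> K.
Hypothesis fD : {morph f : v w / v + w}.
Hypothesis fZ : forall a v, f (a *: v) = a * f v.

(** The decisive relation is $v^2=q(v)$: the product rule turns its left side into $f(v)v-vf(v)=0$,
    and scalars are killed. *)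
Lemma contrE t : contr f (\pi_C t) = contr_term f t.
Proof.
rewrite /contr; have := clifford_repr q t; move: (repr _) => s st.
have aE u : alpha_term u = alpha (\pi_C u) by rewrite alphaE.
elim: s t / st => //=.
- by move=> x y z _ -> _ ->.
- by move=> x x' y y' _ -> _ ->.
- move=> x x' y y' xx -> yy ->; rewrite !aE.
  by rewrite (clifford_eq xx) (clifford_eq yy).
- by move=> x y z; rewrite addrA.
- by move=> x y; rewrite addrC.
- by move=> x; rewrite add0r.
- by move=> x; rewrite mul0r add0r cliff_scalN mulNr mul1r addNr.
- move=> x y z; rewrite -!cliff_piM mulrDr mulrDl !mulrA addrA.
  by [].
- by move=> x; rewrite mul0r add0r mul1r.
- by move=> x y z; rewrite !mulrDl addrACA.
- by move=> x y z; rewrite -cliff_piD !mulrDr addrACA.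
- by move=> a b; rewrite addr0.
- by move=> a b; rewrite mul0r mulr0 addr0.
- by move=> a x; rewrite mul0r mulr0 add0r addr0; exact: cliff_scalC_ring.
- by move=> v w; rewrite fD cliff_scalDE.
- by move=> a v; rewrite fZ mul0r add0r cliff_scalME.
- by move=> v; rewrite mulNr [X in _ + X](_ : _ = - (scal (f v) * vec v)) ?subrr // cliff_scalC_ring.
Qed.

Lemma contr_vec v : contr f (vec v) = scal (f v).
Proof. exact: contrE. Qed.
Lemma contr_scal a : contr f (scal a) = 0.
Proof. exact: contrE. Qed.
Lemma contr0 : contr f 0 = 0.
Proof. exact: contr_scal. Qed.
Lemma contrD x y : contr f (x + y) = contr f x + contr f y.
Proof.
elim/quotW: x => x; elim/quotW: y => y; by rewrite cliff_piD !contrE.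
Qed.
Lemma contrM x y : contr f (x * y) = contr f x * y + alpha x * contr f y.
Proof.
elim/quotW: x => x; elim/quotW: y => y.
by rewrite cliff_piM !contrE /= alphaE.
Qed.

Lemma contr_alpha x : contr f (alpha x) = - alpha (contr f x).
Proof.
elim/cliff_ind: x => [v|a|x y Hx Hy|x y Hx Hy].
- rewrite alpha_vec contr_vec alpha_scal -cliff_vecN contr_vec.
  by rewrite -scaleN1r fZ mulN1r cliff_scalN.
- by rewrite alpha_scal contr_scal -cliff_scal0 alpha_scal cliff_scal0 oppr0.
- by rewrite alphaD !contrD Hx Hy alphaD opprD.
- by rewrite alphaM !contrM Hx Hy alphaD !alphaM alphaK opprD mulrN mulNr.
Qed.

(** The square of an odd derivation is a derivation, since the cross terms cancel by [contr_alpha];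
    it vanishes on generators because a vector is contracted to a scalar. *)
Lemma contr_contr x : contr f (contr f x) = 0.
Proof.
elim/cliff_ind: x => [v|a|x y Hx Hy|x y Hx Hy].
- by rewrite contr_vec contr_scal.
- by rewrite contr_scal contr0.
- by rewrite !contrD Hx Hy addr0.
- rewrite !(contrD, contrM) Hx Hy mul0r mulr0 add0r addr0 contr_alpha.
  by rewrite mulNr addrN.
Qed.

End Contraction.

Lemma contr_anticomm (f g : W -> K) x :
  {morph f : v w / v + w} -> (forall a v, f (a *: v) = a * f v) ->
  {morph g : v w / v + w} -> (forall a v, g (a *: v) = a * g v) ->
  contr f (contr g x) = - contr g (contr f x).
Proof.
move=> fD fZ gD gZ; elim/cliff_ind: x => [v|a|x y Hx Hy|x y Hx Hy].
- by rewrite !contr_vec // !contr_scal // oppr0.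
- by rewrite (contr_scal gD) // (contr_scal fD) // !contr0 // oppr0.
- by rewrite !contrD // Hx Hy opprD.
- rewrite !(contrD, contrM) // Hx Hy !contr_alpha // !mulNr !mulrN !opprD !opprK.
  rewrite -!addrA; congr (_ + _); rewrite addrC -!addrA; congr (_ + _).
  by rewrite addrC.
Qed.

Inductive cgen (P : W -> Prop) : C -> Prop :=
| cgen_scal a : cgen P (scal a)
| cgen_vec v : P v -> cgen P (vec v)
| cgen_add x y : cgen P x -> cgen P y -> cgen P (x + y)
| cgen_mul x y : cgen P x -> cgen P y -> cgen P (x * y).

Lemma cgen_opp (P : W -> Prop) x : cgen P x -> cgen P (- x).
Proof.
move=> Px; rewrite -[x]mul1r -mulNr -cliff_scal1 -cliff_scalN.
by apply: cgen_mul => //; exact: cgen_scal.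
Qed.

Lemma cgen_alpha (P : W -> Prop) x : cgen P x -> cgen P (alpha x).
Proof.
elim=> [a|v Pv|y z _ Hy _ Hz|y z _ Hy _ Hz].
- by rewrite alpha_scal; exact: cgen_scal.
- by rewrite alpha_vec; apply: cgen_opp; exact: cgen_vec.
- by rewrite alphaD; exact: cgen_add.
- by rewrite alphaM; exact: cgen_mul.
Qed.

Lemma cgen_contr (P : W -> Prop) f x :
  {morph f : v w / v + w} -> (forall a v, f (a *: v) = a * f v) ->
  cgen P x -> cgen P (contr f x).
Proof.
move=> fD fZ; elim=> [a|v Pv|y z _ Hy _ Hz|y z Py Hy Pz Hz].
- by rewrite contr_scal //; exact: (cgen_scal P 0).
- by rewrite contr_vec //; exact: cgen_scal.
- by rewrite contrD //; exact: cgen_add.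
- by rewrite contrM //; apply: cgen_add; apply: cgen_mul => //; exact: cgen_alpha.
Qed.

Lemma cgen_contr0 (P : W -> Prop) f x :
  {morph f : v w / v + w} -> (forall a v, f (a *: v) = a * f v) ->
  (forall v, P v -> f v = 0) -> cgen P x -> contr f x = 0.
Proof.
move=> fD fZ f0; elim=> [a|v Pv|y z _ Hy _ Hz|y z Py Hy Pz Hz].
- by rewrite contr_scal.
- by rewrite contr_vec // f0.
- by rewrite contrD // Hy Hz addr0.
- by rewrite contrM // Hy Hz mul0r mulr0 addr0.
Qed.

(** There is no converse in characteristic 2, where [alpha] is the identity and cannot detect the
    degree; homogeneity is therefore tracked by [cliff_homog]. *)
Lemma homog_alpha d x : cliff_homog d x -> alpha x = (-1) ^+ d * x.
Proof.
elim=> {d x} [a|v|d x y _ Hx _ Hy|d e x y _ Hx _ Hy].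
- by rewrite alpha_scal mul1r.
- by rewrite alpha_vec mulN1r.
- by rewrite alphaD Hx Hy mulrDr.
- by rewrite alphaM Hx Hy; case: d e {Hx Hy} => [] [];
    rewrite /= ?expr1 ?expr0 ?mul1r ?mulN1r ?mulrN ?mulNr ?opprK.
Qed.

End CliffordCalculus.

Lemma polarC (V R : zmodType) (Q : V -> R) x y : polar Q x y = polar Q y x.
Proof. by rewrite /polar [x + y]addrC addrAC. Qed.

(* The families are indexed by [nat] so that the flag of subspaces spanned by
   [e 0, ..., e (m - 1)] can be handled by induction on [m]. *)
Definition dual_bases (K : fieldType) (W : lmodType K) (q : W -> K) (n : nat)
    (e e' : nat -> W) : Prop :=
  (forall i j, (i < n)%N -> (j < n)%N -> polar q (e i) (e' j) = (i == j)%:R) /\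
  forall w, w = \sum_(i < n) polar q w (e' i) *: e i.

(** * Contractions and the graded centre *)

Section GradedCenter.
Variables (K : fieldType) (W : lmodType K) (q : W -> K).
Hypothesis q_quad : quadratic_form q.
Variables (n : nat) (e e' : nat -> W).
Hypothesis ee' : dual_bases q n e e'.
Local Notation C := (clifford q).
Local Notation vec := (cliff_vec q).
Local Notation scal := (cliff_scal q).
Implicit Types (x y z : C) (v w : W) (a b : K).

Local Notation B := (polar q).

Lemma polarDr v w (z : W) : B z (v + w) = B z v + B z w.
Proof. by rewrite !(polarC q z) polarDl. Qed.
Lemma polarZr a v (z : W) : B z (a *: v) = a * B z v.
Proof. by rewrite !(polarC q z) polarZl. Qed.

Let cD i : {morph B^~ (e' i) : v w / v + w}.
Proof. by move=> v w; rewrite polarDl. Qed.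
Let cZ i a v : B (a *: v) (e' i) = a * B v (e' i).
Proof. by rewrite polarZl. Qed.
Let wD (z : W) : {morph B z : v w / v + w}.
Proof. by move=> v w; rewrite polarDr. Qed.
Let wZ (z : W) a v : B z (a *: v) = a * B z v.
Proof. by rewrite polarZr. Qed.

(** Both sides are odd derivations in x, and on vectors this is the Clifford relation. Contractions
    thus become inner: they kill whatever supercommutes with vectors. *)
Lemma supercomm w x : vec w * x - alpha x * vec w = contr (B w) x.
Proof.
elim/cliff_ind: x => [v|a|x y Hx Hy|x y Hx Hy].
- by rewrite contr_vec // alpha_vec mulNr opprK cliff_anticomm.
- by rewrite contr_scal // alpha_scal cliff_scalC_ring subrr.
- by rewrite contrD // -Hx -Hy alphaD mulrDr mulrDl opprD addrACA.
- rewrite contrM // -Hx -Hy alphaM mulrBl mulrBr !mulrA.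
  by rewrite addrA subrK.
Qed.

(** For [m <= n] this is the span of [e 0], ..., [e (m - 1)], expressed by vanishing coordinates. *)
Let flag m v := forall i, (m <= i < n)%N -> B v (e' i) = 0.

Let flag_split m x : (m < n)%N -> cgen (flag m.+1) x ->
  exists a b : C, [/\ cgen (flag m) a, cgen (flag m) b & x = a + vec (e m) * b].
Proof.
move=> mn; elim=> [a|v Pv|y z _ [a [b [Pa Pb ->]]] _ [c [d [Pc Pd ->]]]
                  |y z _ [a [b [Pa Pb ->]]] _ [c [d [Pc Pd ->]]]].
- exists (scal a), (scal 0); split; try exact: cgen_scal.
  by rewrite cliff_scal0 mulr0 addr0.
- exists (vec (v - B v (e' m) *: e m)), (scal (B v (e' m))).
  split; [apply: cgen_vec|exact: cgen_scal|].
    move=> i /andP[mi i_n]; rewrite -scaleNr cD cZ mulNr.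
    rewrite ee'.1 //; move: mi; rewrite leq_eqVlt eq_sym => /orP[/eqP ->|mi].
      by rewrite eqxx mulr1 subrr.
    by rewrite Pv ?mi // gtn_eqF // mulr0 subr0.
  by rewrite -cliff_scalC_ring -cliff_vecZ -cliff_vecD subrK.
- exists (a + c), (b + d); split; try exact: cgen_add.
  by rewrite mulrDr addrACA.
- pose f := B (e m).
  (* Moving [e m] to the left costs the grading automorphism and a contraction, and both preserve
     [cgen (flag m)]. The two witnesses collect the terms of $(a+e_mb)(c+e_md)$ without and with a
     leading $e_m$. *)
  have comm u : u * vec (e m) = vec (e m) * alpha u - contr f (alpha u).
    by rewrite -supercomm alphaK opprB addrC subrK.
  exists (a * c + (scal (q (e m)) * alpha b * d - contr f (alpha a) * d)).
  exists (b * c + alpha a * d - contr f (alpha b) * d).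
  have cg u : cgen (flag m) u -> cgen (flag m) (contr f (alpha u)).
    by move=> Pu; apply: (cgen_contr (wD _) (wZ _)); exact: cgen_alpha.
  split.
  - apply: cgen_add; first exact: cgen_mul.
    apply: cgen_add; last by apply: cgen_opp; apply: cgen_mul => //; exact: cg.
    do 2 apply: cgen_mul => //; [exact: cgen_scal|exact: cgen_alpha].
  - apply: cgen_add; last by apply: cgen_opp; apply: cgen_mul => //; exact: cg.
    by apply: cgen_add; apply: cgen_mul => //; exact: cgen_alpha.
  - rewrite mulrDl !mulrDr -!mulrA (mulrA a) comm (mulrA b) comm !mulrBl.
    rewrite !mulrBr ?mulrN -!mulrA (mulrA (vec _) (vec _)) cliff_vec_sqr.
    set t1 := a * c; set t2 := vec (e m) * _; set t3 := contr f _ * _.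
    set t4 := vec (e m) * _; set t5 := scal _ * _; set t6 := vec (e m) * _.
    rewrite -/t6 -!addrA; congr (_ + _).
    rewrite [LHS]addrCA [RHS]addrCA; congr (_ + _).
    by rewrite [LHS]addrCA [RHS]addrCA; congr (_ + _); exact: addrCA.
Qed.

(** Descent along the flag: if $x=a+e_mb$ with a and b free of $e_m$, contraction by the m-th
    coordinate returns b, so b = 0 and x lies one step lower. *)
Lemma contr_coord_scal x : (forall i, (i < n)%N -> contr (B^~ (e' i)) x = 0) ->
  exists a, x = scal a.
Proof.
move=> x0; have : cgen (flag n) x.
  elim/cliff_ind: {x0} x => [v|a|x y Hx Hy|x y Hx Hy].
  - by apply: cgen_vec => i /andP[/leq_ltn_trans h /h]; rewrite ltnn.
  - exact: cgen_scal.
  - exact: cgen_add.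
  - exact: cgen_mul.
suff H m : (m <= n)%N -> cgen (flag m) x -> cgen (flag 0) x.
  move=> /(H _ (leqnn _)); elim=> [a|v v0|_ _ _ [a ->] _ [b ->]|_ _ _ [a ->] _ [b ->]].
  - by exists a.
  - exists 0; rewrite cliff_scal0 (ee'.2 v) big1 ?cliff_vec0 // => i _.
    by rewrite v0 ?scale0r //= ltn_ord.
  - by exists (a + b); rewrite cliff_scalDE.
  - by exists (a * b); rewrite cliff_scalME.
elim: m => [//|m IH] mn /(flag_split mn)[a [b [Pa Pb xE]]].
have f0 v : flag m v -> B v (e' m) = 0 by apply; rewrite leqnn.
have := x0 m mn; rewrite {1}xE contrD // contrM // contr_vec // alpha_vec.
rewrite (cgen_contr0 (cD m) (cZ m) f0 Pa) (cgen_contr0 (cD m) (cZ m) f0 Pb).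
rewrite ee'.1 // eqxx cliff_scal1 mul1r mulr0 addr0 add0r => b0.
by apply: IH; [exact: ltnW|rewrite xE b0 mulr0 addr0].
Qed.

(** The graded centre is the right one here, as the ordinary centre can exceed the scalars in odd
    dimension. The lemma supplies the scalars in norms and in comparisons of lifts. *)
Lemma supercenter_scal x :
  (forall w, vec w * x = alpha x * vec w) -> exists a, x = scal a.
Proof.
move=> xc; apply: contr_coord_scal => i i_n.
have -> : B^~ (e' i) = B (e' i) by apply/funext => v; rewrite polarC.
by rewrite -supercomm xc subrr.
Qed.

(* The contractions by the coordinate forms anticommute and have square zero,
   so that applying them in turn, as long as the result is nonzero, ends in
   their common kernel, which consists of scalars. *)
Lemma ideal_scal (I : C -> Prop) x : x <> 0 -> I x ->
  (forall w y, I y -> I (contr (B w) y)) -> exists2 a, a != 0 & I (scal a).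
Proof.
move=> x0 Ix Ic.
suff /(_ n (leqnn n)) [y [y0 Iy /contr_coord_scal [a ya]]] : forall m, (m <= n)%N ->
    exists y, [/\ y <> 0, I y & forall i, (i < m)%N -> contr (B^~ (e' i)) y = 0].
  exists a; last by rewrite -ya.
  by apply/eqP => a0; apply: y0; rewrite ya a0.
have BC i : B^~ (e' i) = B (e' i) by apply/funext => v; rewrite polarC.
elim=> [|m IH] mn; first by exists x; split.
have [y [y0 Iy yk]] := IH (ltnW mn).
have [c0|c0] := pselect (contr (B^~ (e' m)) y = 0).
  exists y; split=> // i; rewrite ltnS leq_eqVlt => /orP[/eqP ->//|]; exact: yk.
exists (contr (B^~ (e' m)) y); split => //; first by rewrite BC; exact: Ic.
move=> i; rewrite ltnS leq_eqVlt => /orP[/eqP ->|im].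
  by rewrite contr_contr.
by rewrite contr_anticomm // yk // contr0 // oppr0.
Qed.

End GradedCenter.

(* The exterior algebra on n generators, split along the last generator:
   the pair (a, b) stands for a + e_(n-1) b. *)
Section ExteriorModel.
Variable K : fieldType.

Fixpoint ext_alg (n : nat) : lmodType K :=
  if n is m.+1 then (ext_alg m * ext_alg m)%type : lmodType K else K^o : lmodType K.

(** Left multiplication by $\sum f_ie_i$; the minus sign comes from passing the last generator. *)
Fixpoint wedge (n : nat) (f : nat -> K) : ext_alg n -> ext_alg n :=
  match n return ext_alg n -> ext_alg n with
  | 0 => fun=> 0
  | m.+1 => fun x => (wedge f x.1, f m *: x.1 - wedge f x.2)
  end.

Fixpoint interior (n : nat) (f : nat -> K) : ext_alg n -> ext_alg n :=
  match n return ext_alg n -> ext_alg n with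
  | 0 => fun=> 0
  | m.+1 => fun x => (interior f x.1 + f m *: x.2, - interior f x.2)
  end.

Fixpoint ext_parity (n : nat) (d : bool) : ext_alg n -> Prop :=
  match n return ext_alg n -> Prop with
  | 0 => fun x => d -> x = 0
  | m.+1 => fun x => ext_parity d x.1 /\ ext_parity (~~ d) x.2
  end.

Fixpoint ext_one (n : nat) : ext_alg n :=
  match n return ext_alg n with
  | 0 => (1 : K)
  | m.+1 => (ext_one m, 0)
  end.

Implicit Types (n : nat) (f g : nat -> K).

Lemma wedge_linear n f : linear (@wedge n f).
Proof.
elim: n => [|n IH] a x y /=; first by rewrite scaler0 addr0.
rewrite !IH; congr (_, _) => /=.
by rewrite scalerDr opprD addrACA scalerBr !scalerA mulrC.
Qed.

Lemma interior_linear n f : linear (@interior n f).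
Proof.
elim: n => [|n IH] a x y /=; first by rewrite scaler0 addr0.
rewrite !IH; congr (_, _) => /=; last by rewrite opprD scalerN.
by rewrite !scalerDr addrACA !scalerA [f n * a]mulrC.
Qed.

Lemma wedge_linearl n a f g x :
  wedge (fun i => a * f i + g i) x = a *: @wedge n f x + wedge g x.
Proof.
elim: n x => [|n IH] x /=; first by rewrite scaler0 addr0.
rewrite !IH; congr (_, _) => /=.
by rewrite scalerDl opprD addrACA scalerBr scalerA.
Qed.

Lemma interior_linearl n a f g x :
  interior (fun i => a * f i + g i) x = a *: @interior n f x + interior g x.
Proof.
elim: n x => [|n IH] x /=; first by rewrite scaler0 addr0.
rewrite !IH; congr (_, _) => /=; last by rewrite opprD scalerN.
by rewrite scalerDl scalerDr addrACA scalerA.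
Qed.

Lemma lin0 (U V : lmodType K) (h : U -> V) : linear h -> h 0 = 0.
Proof. by move=> hl; have := hl (-1) 0 0; rewrite scaler0 add0r scaleN1r addNr. Qed.
Lemma linD (U V : lmodType K) (h : U -> V) : linear h -> {morph h : x y / x + y}.
Proof. by move=> hl x y; have := hl 1 x y; rewrite !scale1r. Qed.
Lemma linZ (U V : lmodType K) (h : U -> V) a : linear h -> {morph h : x / a *: x}.
Proof. by move=> hl x; have := hl a x 0; rewrite (lin0 hl) !addr0. Qed.
Lemma linN (U V : lmodType K) (h : U -> V) : linear h -> {morph h : x / - x}.
Proof. by move=> hl x; rewrite -scaleN1r (linZ _ hl) scaleN1r. Qed.

Lemma wedge_wedge n f x : @wedge n f (wedge f x) = 0.
Proof.
have wl := @wedge_linear _ f; elim: n x => [|n IH] x //=.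
rewrite IH; congr (_, _).
by rewrite (linD (wl n)) (linN (wl n)) IH oppr0 addr0 (linZ _ (wl n)) subrr.
Qed.

Lemma interior_interior n f x : @interior n f (interior f x) = 0.
Proof.
have il := @interior_linear _ f; elim: n x => [|n IH] x //=.
rewrite (linN (il n)) IH !oppr0; congr (_, _).
by rewrite (linD (il n)) IH add0r (linZ _ (il n)) scalerN subrr.
Qed.

(** Together with [wedge_wedge] and [interior_interior], this makes the sum of the two operators
    square to the scalar $\sum f_ig_i$, which is how the Clifford relation enters the model. *)
Lemma wedge_interior n f g x :
  @wedge n f (interior g x) + interior g (wedge f x) = (\sum_(i < n) f i * g i) *: x.
Proof.
have il := @interior_linear _ g; have wl := @wedge_linear _ f.
elim: n x => [|n IH] x /=; first by rewrite big_ord0 scale0r addr0.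
rewrite big_ord_recr /= [RHS]surjective_pairing; congr (_, _) => /=.
- rewrite (linD (wl n)) (linZ _ (wl n)) scalerDr scalerN scalerA [g n * _]mulrC.
  rewrite -addrA [_ + (interior _ _ + _)]addrC -!addrA addNr addr0.
  by rewrite scalerDl -IH -!addrA; congr (_ + _).
- rewrite (linD (il n)) (linZ _ (il n)) !(linN (il n)) (linN (wl n)) scalerDr scalerDl -IH.
  rewrite opprK opprB scalerA; set a := _ *: interior _ _; set b := _ *: x.2.
  by rewrite addrC -!addrA addKr addrC [b + _]addrC addrAC -addrA.
Qed.

Lemma ext_parity_lin n d a x y :
  ext_parity d x -> ext_parity d y -> @ext_parity n d (a *: x + y).
Proof.
elim: n d x y => [|n IH] d x y /=.
  by move=> hx hy dT; rewrite (hx dT) (hy dT) scaler0 addr0.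
by move=> [hx1 hx2] [hy1 hy2]; split; apply: IH.
Qed.

Lemma ext_parity0 n d : @ext_parity n d 0.
Proof. by elim: n d => [|n IH] d /=; [|split; apply: IH]. Qed.

Lemma ext_parityD n d x y :
  ext_parity d x -> ext_parity d y -> @ext_parity n d (x + y).
Proof. by move=> hx hy; rewrite -[x]scale1r; exact: ext_parity_lin. Qed.

Lemma ext_parityZ n d a x : ext_parity d x -> @ext_parity n d (a *: x).
Proof. by move=> hx; rewrite -[_ *: _]addr0; apply: ext_parity_lin => //; exact: ext_parity0. Qed.

Lemma ext_parityN n d x : ext_parity d x -> @ext_parity n d (- x).
Proof. by move=> hx; rewrite -scaleN1r; exact: ext_parityZ. Qed.

Lemma wedge_parity n d f x : ext_parity d x -> ext_parity (~~ d) (@wedge n f x).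
Proof.
elim: n d x => [//|n IH] d x /= [h1 h2]; split; first exact: IH.
apply: ext_parityD; first by rewrite negbK; exact: ext_parityZ.
by apply: ext_parityN; exact: IH.
Qed.

Lemma interior_parity n d f x : ext_parity d x -> ext_parity (~~ d) (@interior n f x).
Proof.
elim: n d x => [//|n IH] d x /= [h1 h2]; split.
  by apply: ext_parityD; [exact: IH|exact: ext_parityZ].
by apply: ext_parityN; exact: IH.
Qed.

Lemma ext_parity_eq0 n x : ext_parity true x -> ext_parity false x -> x = 0 :> ext_alg n.
Proof.
elim: n x => [x h _|n IH [x y] /= [x1 y0] [x0 y1]]; first exact: h.
by rewrite (IH x) // (IH y).
Qed.

Lemma ext_one_parity n : ext_parity false (ext_one n).
Proof. by elim: n => [//|n IH] /=; split => //; exact: ext_parity0. Qed.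

Lemma ext_one_neq0 n : ext_one n <> 0.
Proof. by elim: n => [/eqP|n IH] /=; [rewrite oner_eq0|case]. Qed.

End ExteriorModel.

(** * The action of the Clifford algebra on the exterior algebra *)

Section CliffordModel.
Variables (K : fieldType) (W : lmodType K) (q : W -> K).
Hypothesis q_quad : quadratic_form q.
Variables (n : nat) (e e' : nat -> W).
Hypothesis ee' : dual_bases q n e e'.
Local Notation C := (clifford q).
Local Notation scal := (cliff_scal q).
Local Notation B := (polar q).

(* The values beta (v, e_j) of a bilinear form beta with beta (v, v) = q v,
   whose matrix in the basis e is triangular: this works in every
   characteristic. *)
Definition half_form (v : W) (j : nat) : K :=
  B v (e' j) * q (e j) + \sum_(i < j) B v (e' i) * B (e i) (e j).

Lemma quadratic_sum m (a : nat -> K) :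
  q (\sum_(j < m) a j *: e j) =
  \sum_(j < m) a j * (a j * q (e j) + \sum_(i < j) a i * B (e i) (e j)).
Proof.
elim: m => [|m IH]; first by rewrite !big_ord0 (quadratic_form0 q_quad).
rewrite !big_ord_recr /= -IH; set u := \sum_(j < m) _.
have -> : q (u + a m *: e m) = polar q u (a m *: e m) + q u + q (a m *: e m).
  by rewrite /polar; ring.
rewrite q_quad.1 polarZr //.
have -> : polar q u (e m) = \sum_(i < m) a i * B (e i) (e m).
  rewrite /u; elim: (index_enum _) => [|i s IHs].
    by rewrite !big_nil (polar0l q_quad).
  by rewrite !big_cons (polarDl q_quad) (polarZl q_quad) IHs.
by ring.
Qed.

Lemma half_formE v : \sum_(j < n) B v (e' j) * half_form v j = q v.
Proof. by rewrite [in RHS](ee'.2 v) (quadratic_sum n (fun j => B v (e' j))). Qed.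

(** Chevalley's operator: multiplication by v plus contraction by $\beta(v,\cdot)$, with square
    $\beta(v,v)=q(v)$. *)
Definition clifford_op (v : W) (m : ext_alg K n) : ext_alg K n :=
  wedge (fun i => B v (e' i)) m + interior (half_form v) m.

Lemma clifford_op_linear v : linear (clifford_op v).
Proof.
move=> a x y; rewrite /clifford_op wedge_linear interior_linear.
by rewrite scalerDr addrACA.
Qed.

Lemma clifford_op_linearl a v w m :
  clifford_op (a *: v + w) m = a *: clifford_op v m + clifford_op w m.
Proof.
rewrite /clifford_op scalerDr addrACA -wedge_linearl -interior_linearl.
congr (wedge _ _ + interior _ _); apply/funext => i.
  by rewrite (polarDl q_quad) (polarZl q_quad).
rewrite /half_form (polarDl q_quad) (polarZl q_quad) mulrDl -mulrA mulrDr.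
rewrite addrACA; congr (_ + _); rewrite mulr_sumr -big_split.
by apply: eq_bigr => j _; rewrite (polarDl q_quad) (polarZl q_quad) mulrDl mulrA.
Qed.

Lemma clifford_op_sqr v m : clifford_op v (clifford_op v m) = q v *: m.
Proof.
rewrite {1}/clifford_op /clifford_op (linD (@wedge_linear _ _ _)).
rewrite (linD (@interior_linear _ _ _)) wedge_wedge interior_interior.
by rewrite add0r addr0 wedge_interior half_formE.
Qed.

Fixpoint cliff_act_term (t : cterm K W) (m : ext_alg K n) : ext_alg K n :=
  match t with
  | CVec v => clifford_op v m
  | CScal a => a *: m
  | CAdd s t => cliff_act_term s m + cliff_act_term t m
  | CMul s t => cliff_act_term s (cliff_act_term t m)
  end.

Definition cliff_act (x : C) := cliff_act_term (repr x).

Lemma cliff_act_term_linear t : linear (cliff_act_term t).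
Proof.
elim: t => [v|b|s IHs t IHt|s IHs t IHt] a x y /=.
- exact: clifford_op_linear.
- by rewrite scalerDr !scalerA mulrC.
- by rewrite IHs IHt scalerDr addrACA.
- by rewrite IHt IHs.
Qed.

Lemma cliff_actE t : cliff_act (\pi_C t) = cliff_act_term t.
Proof.
have tl := cliff_act_term_linear.
rewrite /cliff_act; have := clifford_repr q t; move: (repr _) => s st.
elim: s t / st => //=.
- by move=> x y z _ -> _ ->.
- by move=> x x' y y' _ -> _ ->.
- by move=> x x' y y' _ -> _ ->.
- by move=> x y z; apply/funext => m; rewrite addrA.
- by move=> x y; apply/funext => m; rewrite addrC.
- by move=> x; apply/funext => m; rewrite scale0r add0r.
- by move=> x; apply/funext => m; rewrite scaleN1r addNr scale0r.
- by move=> x; apply/funext => m; rewrite scale1r.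
- by move=> x y z; apply/funext => m; rewrite (linD (tl z)).
- by move=> a b; apply/funext => m; rewrite scalerDl.
- by move=> a b; apply/funext => m; rewrite scalerA.
- by move=> a x; apply/funext => m; rewrite (linZ _ (tl x)).
- move=> v w; apply/funext => m.
  by have := clifford_op_linearl 1 v w m; rewrite !scale1r.
- move=> a v; apply/funext => m.
  have := clifford_op_linearl a v 0 m; rewrite addr0 => ->.
  by have := clifford_op_linearl (-1) 0 0 m; rewrite scaler0 addr0 scaleN1r addNr => ->; rewrite addr0.
- by move=> v; apply/funext => m; rewrite clifford_op_sqr.
Qed.

Lemma cliff_actM x y m : cliff_act (x * y) m = cliff_act x (cliff_act y m).
Proof.
by elim/quotW: x => x; elim/quotW: y => y; rewrite cliff_piM !cliff_actE.
Qed.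

Lemma cliff_act_scal a m : cliff_act (scal a) m = a *: m.
Proof. by rewrite /cliff_scal cliff_actE. Qed.

Lemma cliff_act_parity d x c m : cliff_homog d x -> ext_parity c m ->
  ext_parity (d (+) c) (cliff_act x m).
Proof.
move=> xd; elim: xd c m => {d x} [a|v|d x y _ Hx _ Hy|d f x y _ Hx _ Hy] c m cm.
- by rewrite cliff_act_scal; exact: ext_parityZ.
- rewrite /cliff_vec cliff_actE /=; apply: ext_parityD.
    exact: wedge_parity.
  exact: interior_parity.
- have -> : cliff_act (x + y) m = cliff_act x m + cliff_act y m.
    by elim/quotW: x {Hx} => x; elim/quotW: y {Hy} => y; rewrite cliff_piD !cliff_actE.
  by apply: ext_parityD; [exact: Hx|exact: Hy].
- by rewrite cliff_actM -addbA; apply: Hx; exact: Hy.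
Qed.

Lemma cliff_scal_inj : injective scal.
Proof.
move=> a b ab; have := cliff_act_scal (a - b) (ext_one K n).
rewrite cliff_scalDE cliff_scalN ab subrr -cliff_scal0 cliff_act_scal scale0r => h.
apply/eqP; rewrite -subr_eq0; case: eqP => // /eqP ab0.
case: (@ext_one_neq0 K n); rewrite -[ext_one K n]scale1r -(mulVf ab0) -scalerA.
by rewrite -h scaler0.
Qed.

(** If x had both parities, its value at 1 in the model would be even and odd, hence zero, which a
    left inverse excludes. The degree of a lift is thus determined in characteristic 2 as well. *)
Lemma cliff_homog_inj d d' (x y : C) :
  cliff_homog d x -> cliff_homog d' x -> y * x = 1 -> d = d'.
Proof.
move=> xd xd' yx; apply/eqP; case: eqP => // dd'.
have x0 : cliff_act x (ext_one K n) = 0.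
  have h1 := cliff_act_parity xd (ext_one_parity K n).
  have h2 := cliff_act_parity xd' (ext_one_parity K n).
  by apply: ext_parity_eq0; case: d d' dd' h1 h2 {xd xd'} => [] [].
case: (@ext_one_neq0 K n); rewrite -[LHS]scale1r -cliff_act_scal cliff_scal1 -yx.
rewrite cliff_actM x0 -(scale0r 0) -[0 *: 0]cliff_act_scal -cliff_actM.
by rewrite cliff_scal0 mulr0 -cliff_scal0 cliff_act_scal.
Qed.

End CliffordModel.

(** * The Clifford group: norms, uniqueness and existence of lifts *)

Section CliffordLifts.
Variables (K : fieldType) (W : lmodType K) (q : W -> K).
Hypothesis q_quad : quadratic_form q.
Variables (n : nat) (e e' : nat -> W).
Hypothesis ee' : dual_bases q n e e'.
Local Notation C := (clifford q).
Local Notation vec := (cliff_vec q).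
Local Notation scal := (cliff_scal q).
Local Notation B := (polar q).
Implicit Types (x y z : C) (v w : W) (a b : K) (g h : W -> W).

Lemma cliff_trD x y : cliff_tr (x + y) = cliff_tr x + cliff_tr y.
Proof.
by elim/quotW: x => x; elim/quotW: y => y; rewrite cliff_piD !cliff_trE -cliff_piD.
Qed.
Lemma cliff_trM x y : cliff_tr (x * y) = cliff_tr y * cliff_tr x.
Proof.
by elim/quotW: x => x; elim/quotW: y => y; rewrite cliff_piM !cliff_trE -cliff_piM.
Qed.
Lemma cliff_tr_vec v : cliff_tr (vec v) = vec v.
Proof. exact: cliff_trE. Qed.
Lemma cliff_tr_scal a : cliff_tr (scal a) = scal a.
Proof. exact: cliff_trE. Qed.
Lemma cliff_tr1 : cliff_tr 1 = 1 :> C.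
Proof. exact: cliff_tr_scal. Qed.
Lemma cliff_sign_scal (d : bool) : (-1) ^+ d = scal ((-1) ^+ d).
Proof. by case: d => //=; rewrite !expr1 cliff_scalN. Qed.
Lemma cliff_tr_sign (d : bool) : cliff_tr ((-1) ^+ d) = (-1) ^+ d :> C.
Proof. by rewrite cliff_sign_scal cliff_tr_scal. Qed.

Lemma cliff_tr_homog d x : cliff_homog d x -> cliff_homog d (cliff_tr x).
Proof.
elim=> {d x} [a|v|d x y _ Hx _ Hy|d f x y _ Hx _ Hy].
- by rewrite cliff_tr_scal; exact: homog_scal.
- by rewrite cliff_tr_vec; exact: homog_vec.
- by rewrite cliff_trD; exact: homog_add.
- by rewrite cliff_trM addbC; exact: homog_mul.
Qed.

Lemma homogZ d a x : cliff_homog d x -> cliff_homog d (scal a * x).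
Proof. by move=> hx; apply: (@homog_mul _ _ q false) => //; exact: homog_scal. Qed.

Lemma homogN d x : cliff_homog d x -> cliff_homog d (- x).
Proof. by move=> hx; rewrite -mulN1r -cliff_scal1 -cliff_scalN; exact: homogZ. Qed.

Lemma dual_bases_nondeg v : (forall w, B v w = 0) -> v = 0.
Proof. by move=> v0; rewrite (ee'.2 v) big1 // => i _; rewrite v0 scale0r. Qed.

Lemma cliff_vec_inj : injective vec.
Proof.
move=> v w vw; apply/eqP; rewrite -subr_eq0; apply/eqP.
apply: dual_bases_nondeg => z; apply: (cliff_scal_inj q_quad ee').
by rewrite -cliff_anticomm cliff_vecD cliff_vecN vw subrr mul0r mulr0 addr0.
Qed.

(* [Int_s x] restricts to [g] on vectors, written without the inverse of [x]. *)
Definition homog_lift (d : bool) x g :=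
  [/\ cliff_homog d x, exists y, x * y = 1 /\ y * x = 1 &
      forall w, vec (g w) * x = (-1) ^+ d * (x * vec w)].

Lemma cliff_rhoE d x y w w' : cliff_homog d x -> x * y = 1 -> y * x = 1 ->
  vec w' = cliff_int d x y (vec w) -> cliff_rho x w = w'.
Proof.
move=> xd xy yx w'E; rewrite /cliff_rho.
set P := [set _ | _]; have [d' [y' [xd' xy' y'x w2E]]] : P (xget 0 P).
  by apply: (@xgetI _ 0 P w'); exists d, y.
apply: cliff_vec_inj; rewrite w2E w'E.
have <- : y = y' by rewrite -[y']mul1r -yx -mulrA xy' mulr1.
by rewrite (cliff_homog_inj q_quad ee' xd xd' yx).
Qed.

(** The degree and the inverse of x are determined, so the choice in [cliff_rho] has one possible
    value; surjectivity of g yields the equality of the two image sets in [clifford_group]. *)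
Lemma clifford_liftP x g : (forall w, exists w', g w' = w) ->
  clifford_lift x g <-> exists d, homog_lift d x g.
Proof.
move=> gs; split.
  move=> [[d [y [xd xy yx im]]] rho]; exists d; split=> //; first by exists y.
  move=> w; have [w' _ w'E] : [set vec w | w in setT] (cliff_int d x y (vec w)).
    by rewrite -im; exists w.
  rewrite -rho (cliff_rhoE xd xy yx w'E) w'E /cliff_int.
  by rewrite -!mulrA yx mulr1.
move=> [d [xd [y [xy yx]] gx]].
have gE w : vec (g w) = cliff_int d x y (vec w).
  by rewrite /cliff_int mulrA -gx -mulrA xy mulr1.
split.
  exists d, y; split => //; apply/seteqP; split=> z /= [w _ <-].
    by exists (g w).
  by have [w' <-] := gs w; exists w'.
by apply/funext => w; apply: (cliff_rhoE xd xy yx).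
Qed.

(** Transposing the relation for x gives one that carries $g(w)$ back to w with the same sign. The
    signs cancel in $x_tx$, which is even and commutes with vectors, so it is a scalar; it is
    nonzero since x is invertible. *)
Lemma homog_lift_unit_norm d x g : homog_lift d x g ->
  exists b : Gm K, cliff_norm_is x b.
Proof.
move=> [xd [y [xy yx]] gx].
have gxt w : cliff_tr x * vec (g w) = (-1) ^+ d * (vec w * cliff_tr x).
  have := congr1 (@cliff_tr _ _ _) (gx w).
  by rewrite !cliff_trM !cliff_tr_vec cliff_tr_sign commr_sign.
have [b bE] : exists b, cliff_tr x * x = scal b.
  apply: (supercenter_scal q_quad ee') => w.
  have /homog_alpha -> : cliff_homog false (cliff_tr x * x).
    by rewrite -(addbb d); apply: homog_mul => //; exact: cliff_tr_homog.
  rewrite mul1r mulrA -[vec w * _](signrMK d) -gxt -[LHS]mulrA -[_ * _ * x]mulrA gx.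
  by rewrite (mulrA (cliff_tr x)) commr_sign -!mulrA signrMK.
have b0 : b != 0.
  apply/eqP => b0; have /eqP := congr1 (fun z => cliff_tr y * z * y) bE.
  rewrite mulrA -cliff_trM -mulrA xy cliff_tr1 mul1r b0 cliff_scal0 mulr0 mul0r.
  move/eqP => /(cliff_scal_inj q_quad ee')/eqP; by rewrite oner_eq0.
by exists (MkGm b0).
Qed.

Lemma homog_liftM d f x y g h : homog_lift d x g -> homog_lift f y h ->
  homog_lift (d (+) f) (x * y) (g \o h).
Proof.
move=> [xd [x' [xx' x'x]] gx] [yf [y' [yy' y'y]] hy]; split.
- exact: homog_mul.
- exists (y' * x'); split.
    by rewrite -mulrA (mulrA y) yy' mul1r.
  by rewrite -mulrA (mulrA x') x'x mul1r.
move=> w /=; rewrite mulrA gx -[LHS]mulrA -[x * _ * y]mulrA hy.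
by rewrite (mulrA x (_ ^+ _)) commr_sign signr_addb !mulrA.
Qed.

Lemma homog_liftV d x y g h : homog_lift d x g -> x * y = 1 -> cancel h g ->
  homog_lift d y h.
Proof.
move=> xg xy gh; have [b bE] := homog_lift_unit_norm xg.
have [xd [y' [xy' y'x]] gx] := xg.
have yy' : y = y' by rewrite -[y]mul1r -y'x -mulrA xy mulr1.
have yx : y * x = 1 by rewrite yy'.
(* An inverse is not visibly homogeneous; this formula makes it so, since transposition preserves
   degrees. *)
have yE : y = scal (gm_val b)^-1 * cliff_tr x.
  rewrite -[RHS]mulr1 -xy mulrA -[_ * _ * x]mulrA bE -cliff_scalME.
  by rewrite mulVf ?gm_neq0 // mul1r.
split.
- by rewrite yE; apply: homogZ; exact: cliff_tr_homog.
- by exists x.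
- move=> w; have := gx (h w); rewrite gh => /(congr1 (fun z => y * z * y)).
  rewrite -!mulrA xy mulr1 => ->.
  by rewrite (mulrA y (_ ^+ _)) commr_sign -!mulrA signrMK (mulrA y x) yx mul1r.
Qed.

Lemma homog_lift_scal a : a != 0 -> homog_lift false (scal a) id.
Proof.
move=> a0; split; first exact: homog_scal.
  by exists (scal a^-1); rewrite -!cliff_scalME mulVf ?divff.
by move=> w; rewrite mul1r cliff_scalC_ring.
Qed.

(** The quotient $x^{-1}x'$ supercommutes with all vectors, as both elements induce g. Equality of
    degrees comes last, once x' is known to be a scalar multiple of x. *)
Lemma homog_lift_unique d d' x x' g : homog_lift d x g -> homog_lift d' x' g ->
  d = d' /\ exists a : Gm K, x' = scal (gm_val a) * x.
Proof.
move=> [xd [y [xy yx]] gx] [x'd [y' [x'y' y'x']] gx'].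
have ay : alpha y = (-1) ^+ d * y.
  have := alphaM x y; rewrite xy alpha1 (homog_alpha xd).
  move=> /(congr1 (fun z => (-1) ^+ d * (y * z))); rewrite mulr1 => ->.
  by rewrite -!mulrA (mulrA y (_ ^+ _)) commr_sign -!mulrA signrMK (mulrA y x) yx mul1r.
have [a aE] : exists a, y * x' = scal a.
  apply: (supercenter_scal q_quad ee') => w.
  rewrite alphaM ay (homog_alpha x'd).
  rewrite -[RHS]mulrA -[_ * x' * _]mulrA -gx' !mulrA; congr (_ * _).
  rewrite -mulrA.
  have := gx w => /(congr1 (fun z => y * z * y)).
  rewrite -!mulrA xy mulr1 => ->.
  by rewrite (mulrA y (_ ^+ _)) commr_sign -!mulrA signrMK (mulrA y x) yx mul1r.
have x'E : x' = scal a * x by rewrite cliff_scalC_ring -aE mulrA xy mul1r.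
have a0 : a != 0.
  apply/eqP => a0; have := x'y'; rewrite x'E a0 cliff_scal0 !mul0r.
  by move/(cliff_scal_inj q_quad ee')/eqP; rewrite eq_sym oner_eq0.
split; last by exists (MkGm a0).
have x'd2 : cliff_homog d x' by rewrite x'E; exact: homogZ.
exact: (cliff_homog_inj q_quad ee' x'd2 x'd y'x').
Qed.

Lemma isometry_polar g : qf_isometry q q g -> forall v w, B (g v) (g w) = B v w.
Proof. by move=> [gl _ gq] v w; rewrite /polar -(linD gl) !gq. Qed.

(* The operators [D v x = g v * x - alpha x * v] anticommute and have square
   zero, so they have a common kernel vector; starting from 1, one finds a
   homogeneous one. It generates a two-sided ideal, hence is invertible. *)
Lemma homog_lift_exists g : qf_isometry q q g -> exists d x, homog_lift d x g.
Proof.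
move=> gi; have [gl gb gq] := gi; have [h hg gh] := gb.
pose D v x := vec (g v) * x - alpha x * vec v.
have DD v w x : D w (D v x) =
    vec (g w) * vec (g v) * x - x * (vec v * vec w)
    + (vec (g v) * alpha x * vec w - vec (g w) * alpha x * vec v).
  rewrite /D mulrBr -mulN1r -cliff_scal1 -cliff_scalN alphaD !alphaM alphaK.
  rewrite alpha_scal !alpha_vec cliff_scalN cliff_scal1 !mulrN !mulNr !mul1r.
  rewrite opprK mulrDl mulNr opprD opprK !mulrA.
  by rewrite addrACA [X in _ + X = _]addrC addrACA.
have Danti v w x : D w (D v x) = - D v (D w x).
  apply/eqP; rewrite -addr_eq0 !DD addrACA -[X in _ + (_ + X)]opprB subrr addr0 addrACA.
  rewrite -mulrDl -opprD -mulrDr.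
  by rewrite !cliff_anticomm (isometry_polar gi) polarC cliff_scalC_ring subrr.
have Dsq v x : D v (D v x) = 0.
  by rewrite DD !cliff_vec_sqr gq subrr addr0 cliff_scalC_ring subrr.
have D0 v : D v 0 = 0.
  by rewrite /D -cliff_scal0 alpha_scal cliff_scal0 mulr0 mul0r subrr.
have Dhomog d v x : cliff_homog d x -> cliff_homog (~~ d) (D v x).
  move=> xd; rewrite /D (homog_alpha xd) cliff_sign_scal; apply: homog_add.
    by apply: (@homog_mul _ _ q true) => //; exact: homog_vec.
  apply: homogN; rewrite -mulrA; apply: homogZ.
  by rewrite -(addbT d); apply: homog_mul => //; exact: homog_vec.
have [d [x [x0 xd xk]]] : exists d x, [/\ x <> 0, cliff_homog d x
    & forall i, (i < n)%N -> D (e i) x = 0].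
  suff H m : (m <= n)%N -> exists d x, [/\ x <> 0, cliff_homog d x
      & forall i, (i < m)%N -> D (e i) x = 0] by exact: H (leqnn n).
  elim: m => [|m IH] mn.
    exists false, 1; split=> //; last exact: homog_scal.
    by move/(cliff_scal_inj q_quad ee')/eqP; rewrite oner_eq0.
  have [d [x [x0 xd xk]]] := IH (ltnW mn).
  have [c0|c0] := pselect (D (e m) x = 0).
    exists d, x; split=> // i; rewrite ltnS leq_eqVlt => /orP[/eqP ->//|]; exact: xk.
  exists (~~ d), (D (e m) x); split => //; first exact: Dhomog.
  move=> i; rewrite ltnS leq_eqVlt => /orP[/eqP ->//|im].
  by rewrite Danti xk // D0 oppr0.
have gx v : vec (g v) * x = (-1) ^+ d * (x * vec v).
  apply/eqP; rewrite mulrA -(homog_alpha xd) -subr_eq0; apply/eqP.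
  rewrite -/(D v x) (ee'.2 v); elim: (index_enum _) => [|i s IHs].
    by rewrite big_nil /D (lin0 gl) cliff_vec0 mulr0 mul0r subrr.
  rewrite big_cons /D gl !cliff_vecD !cliff_vecZ mulrDl mulrDr opprD addrACA.
  rewrite -/(D _ x) IHs addr0 [alpha x * _]mulrA -cliff_scalC_ring -!mulrA.
  by rewrite -mulrBr -/(D _ x) xk ?mulr0 //= ltn_ord.
have hx w : vec w * x = (-1) ^+ d * (x * vec (h w)) by rewrite -gx gh.
(* The left ideal of x is stable under contractions because $xw$ can be rewritten as $\pm g(w)x$; so
   it contains a nonzero scalar. The right ideal is treated below in the same way with the inverse
   of g. *)
have [y yx] : exists y, y * x = 1.
  have [|w _ [c ->]|a a0 [c cE]] :=
      ideal_scal q_quad ee' (I := fun z => exists c, z = c * x) x0.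
  - by exists 1; rewrite mul1r.
  - exists (vec w * c - alpha c * vec (g w)).
    rewrite -(supercomm q_quad) alphaM (homog_alpha xd) mulrBl mulrA; congr (_ - _).
    by rewrite -!mulrA gx.
  - by exists (scal a^-1 * c); rewrite -mulrA -cE -cliff_scalME mulVf.
have [z xz] : exists z, x * z = 1.
  have [|w _ [c ->]|a a0 [c cE]] :=
      ideal_scal q_quad ee' (I := fun z => exists c, z = x * c) x0.
  - by exists 1; rewrite mulr1.
  - exists ((-1) ^+ d * (vec (h w) * c - alpha c * vec w)).
    rewrite -(supercomm q_quad) alphaM (homog_alpha xd) mulrA hx.
    by rewrite (mulrA x (_ ^+ _)) commr_sign -!mulrA !mulrBr.
  - exists (scal a^-1 * c); rewrite mulrA -cliff_scalC_ring -mulrA -cE.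
    by rewrite -cliff_scalME mulVf.
exists d, x; split=> //; exists y; split=> //.
by have -> : y = z by rewrite -[y]mulr1 -xz mulrA yx mul1r.
Qed.

End CliffordLifts.

(** * Base change *)

Section SemilinearMap.
Variables (K L : fieldType) (W : lmodType K) (X : lmodType L).
Variables (q : W -> K) (r : X -> L) (f : {rmorphism K -> L}) (u : W -> X).
Hypothesis u_lin : forall a v w, u (a *: v + w) = f a *: u v + u w.
Hypothesis u_q : forall w, r (u w) = f (q w).
Local Notation cm := (@cliff_map K L W X q r f u).

Lemma cliff_mapD x y : cm (x + y) = cm x + cm y.
Proof.
elim/quotW: x => x; elim/quotW: y => y.
by rewrite cliff_piD !cliff_mapE //= cliff_piD.
Qed.
Lemma cliff_mapM x y : cm (x * y) = cm x * cm y.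
Proof.
elim/quotW: x => x; elim/quotW: y => y.
by rewrite cliff_piM !cliff_mapE //= cliff_piM.
Qed.
Lemma cliff_map_vec w : cm (cliff_vec q w) = cliff_vec r (u w).
Proof. by rewrite /cliff_vec cliff_mapE. Qed.
Lemma cliff_map_scal a : cm (cliff_scal q a) = cliff_scal r (f a).
Proof. by rewrite /cliff_scal cliff_mapE. Qed.
Lemma cliff_map1 : cm 1 = 1.
Proof. by rewrite -cliff_scal1 cliff_map_scal rmorph1. Qed.
Lemma cliff_map_sign (d : bool) : cm ((-1) ^+ d) = (-1) ^+ d.
Proof. by rewrite cliff_sign_scal cliff_map_scal rmorph_sign cliff_sign_scal. Qed.
Lemma cliff_map_tr x : cm (cliff_tr x) = cliff_tr (cm x).
Proof.
elim/cliff_ind: x => [w|a|x y Hx Hy|x y Hx Hy].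
- by rewrite cliff_tr_vec cliff_map_vec cliff_tr_vec.
- by rewrite cliff_tr_scal cliff_map_scal cliff_tr_scal.
- by rewrite cliff_trD !cliff_mapD cliff_trD Hx Hy.
- by rewrite cliff_trM !cliff_mapM cliff_trM Hx Hy.
Qed.
Lemma cliff_map_homog d x : cliff_homog d x -> cliff_homog d (cm x).
Proof.
elim=> {d x} [a|v|d x y _ Hx _ Hy|d e x y _ Hx _ Hy].
- by rewrite cliff_map_scal; exact: homog_scal.
- by rewrite cliff_map_vec; exact: homog_vec.
- by rewrite cliff_mapD; exact: homog_add.
- by rewrite cliff_mapM; exact: homog_mul.
Qed.

Lemma cliff_map_norm x b : cliff_norm_is x b -> cliff_norm_is (cm x) (gm_map f b).
Proof.
by move=> xb; rewrite /cliff_norm_is -cliff_map_tr -cliff_mapM xb cliff_map_scal.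
Qed.

(** The spanning hypothesis lets one lemma serve scalar extension, where the image of u only spans,
    and Galois conjugation, where u is a semilinear bijection. *)
Lemma cliff_map_lift d x (g : W -> W) (g' : X -> X) :
  (forall P : X -> Prop, (forall a w, P (a *: u w)) ->
     (forall v w, P v -> P w -> P (v + w)) -> forall v, P v) ->
  linear g' -> (forall w, g' (u w) = u (g w)) ->
  homog_lift d x g -> homog_lift d (cm x) g'.
Proof.
move=> span g'l g'u [xd [y [xy yx]] gx]; split; first exact: cliff_map_homog.
  by exists (cm y); rewrite -!cliff_mapM xy yx cliff_map1.
apply: span => [a w|v w Hv Hw].
  rewrite (linZ _ g'l) g'u !cliff_vecZ -mulrA -!cliff_map_vec -cliff_mapM gx.
  rewrite !cliff_mapM cliff_map_sign mulrA cliff_scalC_ring -!mulrA.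
  by congr (_ * _); rewrite mulrA (mulrA (cm x)) cliff_scalC_ring.
by rewrite (linD g'l) !cliff_vecD mulrDl Hv Hw !mulrDr.
Qed.

End SemilinearMap.

Section TensorForms.
Variables (F E : fieldType) (iota : {rmorphism F -> E}) (V : lmodType F).
Implicit Types (x y : tensor iota V).

Lemma tensor_ind (P : tensor iota V -> Prop) :
  (forall a v, P (tens iota a v)) -> (forall x y, P x -> P y -> P (x + y)) ->
  forall x, P x.
Proof.
move=> Pt PD; elim/quotW; elim=> [a v|x Px y Py]; first exact: Pt.
by rewrite -tensor_piD; exact: PD.
Qed.

Lemma tensZ a (v : V) : tens iota a v = a *: tens iota 1 v.
Proof. by have [_ _ -> _] := tens_is_bilinear iota V; rewrite mulr1. Qed.

Lemma tens1_semilinear a (v w : V) :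
  tens iota 1 (a *: v + w) = iota a *: tens iota 1 v + tens iota 1 w.
Proof.
have [h1 _ h3 h4] := tens_is_bilinear iota V.
by rewrite h1 h3 mulr1 -(h4 1) mul1r.
Qed.

Lemma tensor_scalar_span (P : tensor iota V -> Prop) :
  (forall a v, P (a *: tens iota 1 v)) -> (forall x y, P x -> P y -> P (x + y)) ->
  forall x, P x.
Proof. by move=> PZ PD; apply: tensor_ind => // a v; rewrite tensZ. Qed.

(** The values at $1\otimes v$ determine the polar form, and with it the values on sums. Forms on an
    extension can therefore be identified without unfolding [ext_form]. *)
Lemma quadratic_form_ext (q1 q2 : tensor iota V -> E) :
  quadratic_form q1 -> quadratic_form q2 ->
  (forall v, q1 (tens iota 1 v) = q2 (tens iota 1 v)) -> q1 =1 q2.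
Proof.
move=> h1 h2 h12.
have p12 x y : polar q1 x y = polar q2 x y.
  elim/tensor_scalar_span: x => [a v|x x' Hx Hx']; last by rewrite !polarDl // Hx Hx'.
  rewrite !polarZl //; congr (_ * _).
  elim/tensor_scalar_span: y => [b w|y y' Hy Hy']; last by rewrite !polarDr // Hy Hy'.
  rewrite !polarZr //; congr (_ * _); rewrite /polar.
  have [hD _ _ _] := tens_is_bilinear iota V.
  by rewrite -hD !h12.
elim/tensor_scalar_span => [a v|x y Hx Hy]; first by rewrite h1.1 h2.1 h12.
have := p12 x y; rewrite /polar Hx Hy => /eqP.
by rewrite !subr_eq !subrK => /eqP.
Qed.

Variable Q : V -> F.
Hypothesis Q_quad : quadratic_form Q.
Local Notation QE := (ext_form (iota := iota) Q).

Lemma ext_form_quad : quadratic_form QE.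
Proof. by have [] := ext_formP iota Q_quad. Qed.

Lemma ext_form1 v : QE (tens iota 1 v) = iota (Q v).
Proof. by have [_ ->] := ext_formP iota Q_quad. Qed.

Lemma ext_polar1 v w :
  polar QE (tens iota 1 v) (tens iota 1 w) = iota (polar Q v w).
Proof.
have [hD _ _ _] := tens_is_bilinear iota V.
by rewrite /polar -hD !ext_form1 !rmorphB.
Qed.

Lemma ext_dual_bases n e e' : dual_bases Q n e e' ->
  dual_bases QE n (fun i => tens iota 1 (e i)) (fun i => tens iota 1 (e' i)).
Proof.
move=> [ee' eV]; split => [i j i_n j_n|].
  by rewrite ext_polar1 ee' // rmorph_nat.
have h := ext_form_quad.
apply: tensor_scalar_span => [a v|x y Hx Hy].
  under eq_bigr do rewrite polarZl // -scalerA ext_polar1.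
  rewrite -scaler_sumr; congr (_ *: _); rewrite {1}(eV v).
  elim: (index_enum _) => [|i s IHs].
    rewrite !big_nil; have := tens1_semilinear (-1) 0 0.
    by rewrite scaler0 addr0 rmorphN1 scaleN1r addNr.
  by rewrite !big_cons tens1_semilinear IHs.
rewrite {1}Hx {1}Hy -big_split /=; apply: eq_bigr => i _.
by rewrite (polarDl h) [RHS]scalerDl.
Qed.

End TensorForms.

(** The coordinates of the second family are the columns of the inverse Gram matrix of a basis; a
    row vector killed by the Gram matrix would give a vector of the radical. *)
Lemma nondegenerate_dual_bases (F : fieldType) (V : vectType F) (Q : V -> F) :
  quadratic_form Q -> nondegenerate_qf Q ->
  exists n e e', dual_bases Q n e e'.
Proof.
move=> hQ nd; pose n := \dim {:V}; pose b := vbasis {:V}.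
pose G : 'M[F]_n := \matrix_(i, j) polar Q b`_i b`_j.
have vE v : v = \sum_i coord b i v *: b`_i by exact/coord_vbasis/memvf.
have polar_sum (I : finType) (c : I -> F) (u : I -> V) v :
    polar Q (\sum_i c i *: u i) v = \sum_i c i * polar Q (u i) v.
  elim: (index_enum _) => [|i s IHs]; first by rewrite !big_nil polar0l.
  by rewrite !big_cons polarDl // polarZl // IHs.
have Gu : G \in unitmx.
  rewrite unitmxE unitfE; apply/det0P => -[k k0 kG]; case/negP: k0.
  have k0 : \sum_j k 0 j *: b`_j = 0.
    apply: nd => v; rewrite (vE v) polarC polar_sum big1 // => j _.
    rewrite polarC polar_sum.
    have := congr1 (fun M : 'rV_n => M 0 j) kG; rewrite !mxE => kGj.
    rewrite [X in _ * X](_ : _ = 0) ?mulr0 // -[RHS]kGj.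
    by apply: eq_bigr => i _; rewrite mxE.
  apply/eqP/rowP => j; rewrite mxE.
  by have /freeP := basis_free (vbasisP {:V}); apply.
pose m (j : nat) : 'cV[F]_n := invmx G *m \col_i (i == j :> nat)%:R.
have bm (i : 'I_n) (j : nat) : polar Q b`_i (\sum_k m j k 0 *: b`_k) = (i == j :> nat)%:R.
  rewrite polarC polar_sum.
  have -> : (i == j :> nat)%:R = (G *m m j) i 0 by rewrite mulKVmx // mxE.
  by rewrite mxE; apply: eq_bigr => k _; rewrite [G i k]mxE polarC mulrC.
exists n, (fun i => b`_i), (fun j => \sum_k m j k 0 *: b`_k); split=> [i j i_n j_n|w].
  exact: (bm (Ordinal i_n)).
rewrite {1}(vE w); apply: eq_bigr => i _; congr (_ *: _).
rewrite /= {2}(vE w) polar_sum (bigD1 i) //= bm eqxx mulr1 big1 ?addr0 // => k ki.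
by rewrite bm val_eqE (negPf ki) mulr0.
Qed.

(** * Galois theory of a separable closure *)

Lemma poly_roots_seq (K : fieldType) (p : {poly K}) : p != 0 ->
  exists2 rs : seq K, uniq rs & forall x, root p x = (x \in rs).
Proof.
have [m] := ubnP (size p); elim: m p => [//|m IH] p /ltnSE pm p0.
have [[x px]|no] := pselect (exists x, root p x); last first.
  by exists [::] => // x; apply/negP => px; apply: no; exists x.
have /factor_theorem[p' pE] := px.
have p'0 : p' != 0 by apply: contraNneq p0 => p'0; rewrite pE p'0 mul0r.
have [|rs urs rsP] := IH p' _ p'0.
  by move: pm; rewrite pE size_Mmonic ?monicXsubC // size_XsubC addn2.
exists (undup (x :: rs)); first exact: undup_uniq.
by move=> y; rewrite mem_undup inE -rsP pE rootM root_XsubC orbC.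
Qed.

Section PartialEmbeddings.
Variables (F E : fieldType) (iota : {rmorphism F -> E}).
Hypothesis iota_sep : separable_closure iota.
Implicit Types (S : set (E * E)) (x y : E) (P Q M R : {poly E}).

(* Graphs of embeddings over F of intermediate fields into E. *)
Definition embedding_graph S :=
  [/\ forall a, S (iota a, iota a),
      forall x y x' y', S (x, y) -> S (x', y') -> S (x - x', y - y'),
      forall x y x' y', S (x, y) -> S (x', y') -> S (x * x', y * y') &
      forall y, S (0, y) -> y = 0].

Definition coef_in S P Q := forall i, S (P`_i, Q`_i).

(** Cancelling factors X from a polynomial that kills x leaves a nonzero constant term, which
    expresses $x^{-1}$ as a polynomial in x. This is why [embedding_graph] asks only for ring
    operations. *)
Lemma algebraic_inverse x : x != 0 -> exists q : {poly F}, x * (map_poly iota q).[x] = 1.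
Proof.
move=> x0; have [p /separable_poly_neq0 p0] := iota_sep.1 x.
elim/poly_ind: p p0 => [|p c IH]; first by rewrite eqxx.
rewrite rmorphD rmorphM /= map_polyX map_polyC rootE hornerD hornerMX hornerC.
have [-> p0 px|c0 _ px] := eqVneq c 0.
  apply: IH; first by apply: contraNneq p0 => ->; rewrite mul0r addr0.
  by move: px; rewrite raddf0 addr0 mulf_eq0 (negPf x0) orbF rootE.
exists (- c^-1 *: p); rewrite map_polyZ hornerZ rmorphN fmorphV.
move: px; rewrite addrC addr_eq0 => /eqP px.
rewrite mulrCA [x * _]mulrC -[_ * x]opprK -px mulNr mulrN opprK mulVf //.
by rewrite fmorph_eq0.
Qed.

Section Graph.
Variable S : set (E * E).
Hypothesis gS : embedding_graph S.

Lemma graph0 : S (0, 0).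
Proof. by have [h _ _ _] := gS; have := h 0; rewrite rmorph0. Qed.
Lemma graph1 : S (1, 1).
Proof. by have [h _ _ _] := gS; have := h 1; rewrite rmorph1. Qed.
Lemma graphB x y x' y' : S (x, y) -> S (x', y') -> S (x - x', y - y').
Proof. by have [_ h _ _] := gS; exact: h. Qed.
Lemma graphN x y : S (x, y) -> S (- x, - y).
Proof. by move=> h; have := graphB graph0 h; rewrite !sub0r. Qed.
Lemma graphD x y x' y' : S (x, y) -> S (x', y') -> S (x + x', y + y').
Proof. by move=> h /graphN h'; have := graphB h h'; rewrite !opprK. Qed.
Lemma graphM x y x' y' : S (x, y) -> S (x', y') -> S (x * x', y * y').
Proof. by have [_ _ h _] := gS; exact: h. Qed.
Lemma graph_eq0 y : S (0, y) -> y = 0.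
Proof. by have [_ _ _ h] := gS; exact: h. Qed.
Lemma graph_fun x y y' : S (x, y) -> S (x, y') -> y = y'.
Proof.
move=> h h'; have := graphB h h'; rewrite subrr => /graph_eq0/eqP.
by rewrite subr_eq0 => /eqP.
Qed.

Lemma graph_sum (I : Type) (r : seq I) (f g : I -> E) :
  (forall i, S (f i, g i)) -> S (\sum_(i <- r) f i, \sum_(i <- r) g i).
Proof.
move=> fg; elim: r => [|i r IH]; first by rewrite !big_nil; exact: graph0.
by rewrite !big_cons; exact: graphD.
Qed.

Lemma graph_horner (q : {poly F}) x y : S (x, y) ->
  S ((map_poly iota q).[x], (map_poly iota q).[y]).
Proof.
move=> xy; elim/poly_ind: q => [|q c IH]; first by rewrite rmorph0 !horner0; exact: graph0.
rewrite rmorphD rmorphM /= map_polyX map_polyC !hornerD !hornerMX !hornerC.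
by apply: graphD; [exact: graphM|have [h _ _ _] := gS; exact: h].
Qed.

Lemma graph_inv x y : S (x, y) -> x != 0 -> y != 0 /\ S (x^-1, y^-1).
Proof.
move=> xy x0; have [q qx] := algebraic_inverse x0.
have qxy := graph_horner q xy.
have := graphB (graphM xy qxy) graph1; rewrite qx subrr => /graph_eq0/eqP.
rewrite subr_eq0 => /eqP qy.
have y0 : y != 0 by apply: contra_eq_neq qy => ->; rewrite mul0r eq_sym oner_neq0.
split=> //; move: qxy.
by rewrite -[X in S (X, _)](mulKf x0) -[X in S (_, X)](mulKf y0) qx qy !mulr1.
Qed.

Lemma graph_neq0 x y : S (x, y) -> (x == 0) = (y == 0).
Proof.
move=> xy; apply/idP/idP => /eqP z0; first by move: xy; rewrite z0 => /graph_eq0 ->.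
by apply/negPn/negP => /(graph_inv xy)[]; rewrite z0 eqxx.
Qed.

Lemma coef_in0 : coef_in S 0 0.
Proof. by move=> i; rewrite !coef0; exact: graph0. Qed.
Lemma coef_inB P Q P' Q' : coef_in S P Q -> coef_in S P' Q' -> coef_in S (P - P') (Q - Q').
Proof. by move=> h h' i; rewrite !coefB; exact: graphB. Qed.
Lemma coef_inD P Q P' Q' : coef_in S P Q -> coef_in S P' Q' -> coef_in S (P + P') (Q + Q').
Proof. by move=> h h' i; rewrite !coefD; exact: graphD. Qed.
Lemma coef_inM P Q P' Q' : coef_in S P Q -> coef_in S P' Q' -> coef_in S (P * P') (Q * Q').
Proof. by move=> h h' i; rewrite !coefM; apply: graph_sum => j; exact: graphM. Qed.
Lemma coef_inC x y : S (x, y) -> coef_in S x%:P y%:P.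
Proof. by move=> h i; rewrite !coefC; case: eqP => _ //; exact: graph0. Qed.
Lemma coef_inXn n : coef_in S 'X^n 'X^n.
Proof. by move=> i; rewrite !coefXn; case: eqP => _; [exact: graph1|exact: graph0]. Qed.
Lemma coef_in_base (p : {poly F}) : coef_in S (map_poly iota p) (map_poly iota p).
Proof. by move=> i; rewrite coef_map; have [h _ _ _] := gS; exact: h. Qed.

Lemma coef_in_size P Q : coef_in S P Q -> size P = size Q.
Proof.
move=> h; apply/eqP; rewrite eqn_leq; apply/andP; split; apply/leq_sizeP => j;
  by [move/(nth_default 0) => h0; apply/eqP; have := graph_neq0 (h j); rewrite h0 eqxx // => <-
     |move/(nth_default 0) => h0; apply/eqP; have := graph_neq0 (h j); rewrite h0 eqxx].
Qed.

Lemma coef_in_eq0 Q : coef_in S 0 Q -> Q = 0.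
Proof. by move=> /coef_in_size; rewrite size_poly0 => /esym/eqP; rewrite size_poly_eq0 => /eqP. Qed.

(** Long division of P and of its image Q runs in parallel, so that quotients and remainders again
    correspond under S. *)
Lemma coef_in_div M N P Q : coef_in S M N -> M \is monic -> N \is monic -> coef_in S P Q ->
  exists A B R T, [/\ coef_in S A B, coef_in S R T, P = A * M + R, Q = B * N + T &
    (size R < size M)%N].
Proof.
move=> MN Mm Nm; have M0 := monic_neq0 Mm.
have [n] := ubnP (size P); elim: n P Q => [//|n IH] P Q /ltnSE Pn PQ.
have [PM|MP] := ltnP (size P) (size M).
  by exists 0, 0, P, Q; rewrite !mul0r !add0r; split=> //; exact: coef_in0.
have sMN := coef_in_size MN.
pose c := P`_(size P).-1; pose d := Q`_(size P).-1; pose k := (size P - size M)%N.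
have cd : coef_in S (c%:P * 'X^k) (d%:P * 'X^k).
  by apply: coef_inM; [exact/coef_inC/PQ|exact: coef_inXn].
have P'Q' := coef_inB PQ (coef_inM cd MN).
have sM : (0 < size M)%N by rewrite size_poly_gt0.
have P'n : (size (P - c%:P * 'X^k * M)%R < n)%N.
  have sP : (0 < size P)%N by exact: leq_trans sM MP.
  apply: leq_trans Pn; rewrite -(prednK sP) ltnS; apply/leq_sizeP => j.
  rewrite coefB -mulrA coefCM coefXnM leq_eqVlt => /orP[/eqP <-|Pj].
    rewrite ltnNge -subn1 leq_sub2l //=.
    have -> : ((size P - 1) - k = (size M).-1)%N by rewrite /k subnAC subKn // subn1.
    by rewrite -lead_coefE (monicP Mm) mulr1 /c subn1 subrr.
  have Pj' : (size P <= j)%N by rewrite -(prednK sP).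
  rewrite nth_default // (_ : (j < k)%N = false); last first.
    by apply/negbTE; rewrite -leqNgt; apply: leq_trans Pj'; exact: leq_subr.
  rewrite [M`__]nth_default ?mulr0 ?subrr //.
  by rewrite leq_subRL /k ?subnK //; exact: leq_trans (leq_subr _ _) Pj'.
have [A [B [R [T [AB RT PE QE sR]]]]] := IH _ _ P'n P'Q'.
exists (A + c%:P * 'X^k), (B + d%:P * 'X^k), R, T; split=> //.
- exact: coef_inD.
- by rewrite mulrDl addrAC -PE subrK.
- by rewrite mulrDl addrAC -QE subrK.
Qed.

(** Least size of M makes every remainder of a polynomial vanishing at x zero; parallel division
    then makes its image a multiple of N, so x may be sent to any root of N. *)
Lemma graph_min_poly x : exists M N, [/\ coef_in S M N, M \is monic, N \is monic,
  root M x & forall P Q, coef_in S P Q -> root P x -> exists A B, P = A * M /\ Q = B * N].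
Proof.
pose A n := `[< exists P Q, [/\ coef_in S P Q, P != 0, root P x & size P = n] >].
have exA : exists n, A n.
  have [p /separable_poly_neq0 p0 px] := iota_sep.1 x.
  exists (size (map_poly iota p)); apply/asboolP.
  exists (map_poly iota p), (map_poly iota p); split=> //; first exact: coef_in_base.
  by rewrite map_poly_eq0.
case: (ex_minnP exA) => _ /asboolP[P [Q [PQ P0 Px <-]]] Pmin.
have sPQ := coef_in_size PQ.
have Q0 : Q != 0 by rewrite -size_poly_eq0 -sPQ size_poly_eq0.
have [c0 d0] : lead_coef P != 0 /\ lead_coef Q != 0 by rewrite !lead_coef_eq0.
have cd : S ((lead_coef P)^-1, (lead_coef Q)^-1).
  by apply: (graph_inv _ c0).2; rewrite !lead_coefE -sPQ; exact: PQ.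
exists ((lead_coef P)^-1 *: P), ((lead_coef Q)^-1 *: Q).
have MN : coef_in S ((lead_coef P)^-1 *: P) ((lead_coef Q)^-1 *: Q).
  by rewrite -!mul_polyC; apply: coef_inM => //; exact: coef_inC.
have Mm : (lead_coef P)^-1 *: P \is monic by rewrite monicE lead_coefZ mulVf.
have Nm : (lead_coef Q)^-1 *: Q \is monic by rewrite monicE lead_coefZ mulVf.
have Mx : root ((lead_coef P)^-1 *: P) x by rewrite rootZ // invr_eq0.
split=> // P' Q' P'Q' P'x.
have [B [D [R [T [BD RT PE QE sR]]]]] := coef_in_div MN Mm Nm P'Q'.
have Rx : root R x.
  move: P'x; rewrite PE !rootE hornerD hornerM; move/rootP: Mx => ->.
  by rewrite mulr0 add0r.
have R0 : R = 0.
  apply/eqP/negPn/negP => R0.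
  have /Pmin : A (size R) by apply/asboolP; exists R, T.
  by rewrite leqNgt; move: sR; rewrite size_scale ?invr_eq0 // => ->.
exists B, D; split; first by rewrite PE R0 addr0.
by rewrite QE; move: RT; rewrite R0 => /coef_in_eq0 ->; rewrite addr0.
Qed.

End Graph.

(* The simple extension step, by the factorization of the minimal polynomial
   M of x and of its image N. *)
Lemma graph_extend S x : embedding_graph S -> exists M N,
  [/\ coef_in S M N, M \is monic, root M x,
      separable.separable_poly N &
      forall y, root N y -> exists S', [/\ embedding_graph S', S `<=` S' & S' (x, y)]].
Proof.
move=> gS; have [M [N [MN Mm Nm Mx MNdiv]]] := graph_min_poly gS x.
exists M, N; split=> //.
  (* A polynomial over F corresponds to itself under S, so N divides the separable polynomial that
     kills x. *)
  have [p sp px] := iota_sep.1 x.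
  have [A [B [_ pE]]] := MNdiv _ _ (coef_in_base gS p) px.
  apply: (@separable.dvdp_separable _ (map_poly iota p)); last by rewrite separable.separable_map.
  by apply/dvdpP; exists B.
move=> y Ny; exists [set z | exists P Q, coef_in S P Q /\ z = (P.[x], Q.[y])]; split.
- split.
  + move=> a; exists (iota a)%:P, (iota a)%:P; rewrite !hornerC; split=> //.
    by apply: (coef_inC gS); have [h _ _ _] := gS; exact: h.
  + move=> _ _ _ _ [P [Q [PQ [-> ->]]]] [P' [Q' [PQ' [-> ->]]]].
    by exists (P - P'), (Q - Q'); rewrite !hornerD !hornerN; split=> //; exact: coef_inB.
  + move=> _ _ _ _ [P [Q [PQ [-> ->]]]] [P' [Q' [PQ' [-> ->]]]].
    by exists (P * P'), (Q * Q'); rewrite !hornerM; split=> //; exact: coef_inM.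
  + move=> _ [P [Q [PQ [Px ->]]]].
    have /(MNdiv _ _ PQ)[A [B [_ ->]]] : root P x by rewrite rootE -Px.
    by rewrite hornerM (rootP Ny) mulr0.
- move=> [u v] uv; exists u%:P, v%:P; rewrite !hornerC; split=> //; exact: coef_inC.
- exists 'X, 'X; rewrite !hornerX; split=> //; rewrite -(expr1 'X); exact: coef_inXn.
Qed.

Lemma embedding_graph_base : embedding_graph [set z | exists a, z = (iota a, iota a)].
Proof.
split.
- by move=> a; exists a.
- by move=> _ _ _ _ [a [-> ->]] [b [-> ->]]; exists (a - b); rewrite rmorphB.
- by move=> _ _ _ _ [a [-> ->]] [b [-> ->]]; exists (a * b); rewrite rmorphM.
- by move=> y [a [a0 ->]].
Qed.

Lemma embedding_graph_total S : embedding_graph S ->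
  exists T, [/\ embedding_graph T, S `<=` T & forall x, exists y, T (x, y)].
Proof.
move=> gS.
(* The chains consist of the parts adjoined to S, so that the empty chain is no exception: its union
   leaves S itself. *)
have [|A [gA Amax]] := @Zorn_bigcup _ [set X | embedding_graph (S `|` X)].
  move=> C CP Ctot /=; pose U := S `|` \bigcup_(X in C) X.
  have UP u v : U u -> U v -> exists T, [/\ embedding_graph T, T u, T v & T `<=` U].
    have sub X : C X -> S `|` X `<=` U.
      by move=> CX z [Sz|Xz]; [left|right; exists X].
    move=> [Su|[X CX Xu]] [Sv|[Y CY Yv]].
    - by exists S; split=> // z Sz; left.
    - by exists (S `|` Y); split; [exact: CP|left|right|exact: sub].
    - by exists (S `|` X); split; [exact: CP|right|left|exact: sub].
    - have [XY|YX] := Ctot _ _ CX CY.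
        by exists (S `|` Y); split; [exact: CP|right; exact: XY|right|exact: sub].
      by exists (S `|` X); split; [exact: CP|right|right; exact: YX|exact: sub].
  split.
  - by move=> a; left; have [h _ _ _] := gS; exact: h.
  - move=> x y x' y' xy xy'; have [T [gT Txy Txy' TU]] := UP _ _ xy xy'.
    by apply: TU; exact: graphB.
  - move=> x y x' y' xy xy'; have [T [gT Txy Txy' TU]] := UP _ _ xy xy'.
    by apply: TU; exact: graphM.
  - move=> y Uy; have [T [gT Ty _ _]] := UP _ _ Uy Uy; exact: (graph_eq0 gT).
exists (S `|` A); split; [exact: gA|by move=> z; left|].
move=> x; have [M [N [MN Mm Mx sN ext]]] := graph_extend x gA.
have [y Ny] : exists y, root N y.
  apply: iota_sep.2 => //; rewrite -(coef_in_size gA MN).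
  by apply: root_size_gt1 Mx; exact: monic_neq0.
have [S' [gS' AS' xy]] := ext y Ny; exists y; right.
have S'E : S `|` S' = S' by apply/setUidr; move=> z Sz; apply: AS'; left.
apply: contrapT => nA; apply: (Amax S'); last by rewrite /= S'E.
split; first by move=> z Az; apply: AS'; right.
by move=> S'A; apply: nA; exact: S'A.
Qed.

Lemma embedding_graph_gal T : embedding_graph T -> (forall x, exists y, T (x, y)) ->
  exists s : gal iota, forall x y, T (x, y) -> s x = y.
Proof.
move=> gT /choice[s Ts].
have sE x y : T (x, y) -> s x = y by move=> h; exact: (graph_fun gT (Ts x)).
have sB : zmod_morphism s by move=> x y; apply: sE; exact: (graphB gT).
have s1 : monoid_morphism s.
  by split=> [|x y]; apply: sE; [exact: (graph1 gT)|exact: (graphM gT)].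
have sF a : s (iota a) = iota a by apply: sE; have [h _ _ _] := gT; exact: h.
have sinj : injective s.
  move=> x y xy; apply/eqP; rewrite -subr_eq0.
  by rewrite (graph_neq0 gT (Ts _)) sB xy subrr.
(* The injective map s sends the finite set of roots of a polynomial over F into itself, hence onto
   itself, and y is such a root. *)
have surj y : exists x, s x = y.
  have [p /separable_poly_neq0 p0 py] := iota_sep.1 y.
  have [|rs urs rsP] := @poly_roots_seq _ (map_poly iota p); first by rewrite map_poly_eq0.
  have rss : {subset map s rs <= rs}.
    move=> _ /mapP[x xrs ->]; rewrite -rsP rootE; apply/eqP/(graph_eq0 gT).
    by move: xrs; rewrite -rsP => /rootP {1}<-; exact: graph_horner (Ts x).
  have us : uniq (map s rs) by rewrite map_inj_uniq.
  have [|_ rsE] := uniq_min_size us rss; first by rewrite size_map.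
  by move: py; rewrite rsP -rsE => /mapP[x _ ->]; exists x.
have [h sh] := choice surj.
have sb : bijective s by exists h => // x; apply: sinj; rewrite sh.
by exists (Gal (And4 sB s1 sb sF)).
Qed.

(** If the minimal polynomial of x over F had degree at least 2, separability would give a second
    root y, and the embedding $x\mapsto y$ would extend to an automorphism moving x. *)
Lemma gal_fixed_field x : (forall s : gal iota, s x = x) -> exists a, x = iota a.
Proof.
move=> xfix; have gF := embedding_graph_base.
have [M [N [MN Mm Mx sN ext]]] := graph_extend x gF.
have MNE : M = N by apply/polyP => i; have [a [-> ->]] := MN i.
rewrite -{}MNE in MN sN ext => {N}.
have [P ME] := factor_theorem _ _ Mx.
have P0 : P != 0 by apply: contraTneq (monic_neq0 Mm) => P0; rewrite ME P0 mul0r eqxx.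
have sP : size M = (size P).+1.
  by rewrite ME size_Mmonic ?monicXsubC // size_XsubC addn2.
have [P1|P1] := leqP (size P) 1.
  have M1 : M = 'X - x%:P.
    move: Mm; rewrite ME; have [c ->] : exists c, P = c%:P by exists P`_0; exact: size1_polyC.
    by rewrite monicE lead_coefM lead_coefC lead_coefXsubC mulr1 => /eqP ->; rewrite mul1r.
  have [a [aE _]] := MN 0%N; exists (- a); rewrite rmorphN -aE M1.
  by rewrite coefB coefX coefC sub0r opprK.
have /and3P[_ sepP cop] : [&& separable_poly ('X - x%:P), separable_poly P & coprimep ('X - x%:P) P].
  by rewrite -separable_mul mulrC -ME.
have [y Py] := iota_sep.2 P sepP P1.
have yx : y != x.
  apply/negP => /eqP yx; move: cop; rewrite yx in Py.
  by rewrite coprimep_sym coprimep_XsubC Py.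
have My : root M y by rewrite ME rootM Py.
have [S' [gS' _ S'xy]] := ext y My.
have [T [gT S'T Ttot]] := embedding_graph_total gS'.
have [s sT] := embedding_graph_gal gT Ttot.
by move: yx; rewrite -(sT _ _ (S'T _ S'xy)) xfix eqxx.
Qed.

End PartialEmbeddings.

(** * Galois descent *)

Section GaloisAction.
Variables (F E : fieldType) (iota : {rmorphism F -> E}) (V : lmodType F).
Local Notation Gamma := (gal iota).
Implicit Types (s t : Gamma) (x y : tensor iota V).

Lemma gal_mulE s t (a : E) : (s * t)%g a = s (t a). Proof. by []. Qed.
Lemma gal_invK s (a : E) : (s^-1)%g (s a) = a.
Proof. by rewrite -gal_mulE mulVg. Qed.
Lemma gal_invKV s (a : E) : s ((s^-1)%g a) = a.
Proof. by rewrite -gal_mulE mulgV. Qed.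

Lemma gal_nbhs s (xs : seq E) : nbhs s [set t : Gamma | {in xs, t =1 s}].
Proof.
apply: open_nbhs_nbhs; split=> //; rewrite gal_openE => t /= ts.
by exists xs => u ut a axs; rewrite ut // ts.
Qed.

Lemma tensor_gal_tens s a (v : V) : tensor_gal s (tens iota a v) = tens iota (s a) v.
Proof. by rewrite /tensor_gal tensor_map_tens // => b; exact: gal_fix. Qed.

Lemma tensor_gal_semilinear s a x y :
  tensor_gal s (a *: x + y) = s a *: tensor_gal s x + tensor_gal s y.
Proof. by rewrite /tensor_gal tensor_map_semilinear // => b; exact: gal_fix. Qed.

Lemma tensor_galD s x y : tensor_gal s (x + y) = tensor_gal s x + tensor_gal s y.
Proof. by have := tensor_gal_semilinear s 1 x y; rewrite rmorph1 !scale1r. Qed.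

Lemma tensor_gal0 s : tensor_gal s (0 : tensor iota V) = 0.
Proof. by apply: (addrI (tensor_gal s 0)); rewrite -tensor_galD !addr0. Qed.

Lemma tensor_galZ s a x : tensor_gal s (a *: x) = s a *: tensor_gal s x.
Proof. by have := tensor_gal_semilinear s a x 0; rewrite tensor_gal0 !addr0. Qed.

Lemma tensor_galM s t x : tensor_gal (s * t)%g x = tensor_gal s (tensor_gal t x).
Proof.
elim/tensor_ind: x => [a v|x y Hx Hy]; first by rewrite !tensor_gal_tens.
by rewrite !tensor_galD Hx Hy.
Qed.

Lemma tensor_gal1 x : tensor_gal (1%g : Gamma) x = x.
Proof.
elim/tensor_ind: x => [a v|x y Hx Hy]; first by rewrite !tensor_gal_tens.
by rewrite !tensor_galD Hx Hy.
Qed.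

Lemma tensor_galK s x : tensor_gal (s^-1)%g (tensor_gal s x) = x.
Proof. by rewrite -tensor_galM mulVg tensor_gal1. Qed.
Lemma tensor_galKV s x : tensor_gal s (tensor_gal (s^-1)%g x) = x.
Proof. by rewrite -tensor_galM mulgV tensor_gal1. Qed.

Lemma tensor_gal_locally_constant x : locally_constant (fun s : Gamma => tensor_gal s x).
Proof.
elim/tensor_ind: x => [a v|x y Hx Hy].
  move=> s; apply: filterS (gal_nbhs s [:: a]) => t /= ts.
  by rewrite !tensor_gal_tens ts ?mem_head.
have := locally_constant_op2 +%R Hx Hy.
by congr locally_constant; apply/funext => s; rewrite tensor_galD.
Qed.

Variable Q : V -> F.
Hypothesis Q_quad : quadratic_form Q.
Local Notation QE := (ext_form (iota := iota) Q).

Lemma ext_form_gal s x : QE (tensor_gal s x) = s (QE x).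
Proof.
have hE := ext_form_quad iota Q_quad.
have sD y z : QE (tensor_gal s (y + z)) = QE (tensor_gal s y + tensor_gal s z).
  by rewrite tensor_galD.
suff H : (fun y => (s^-1)%g (QE (tensor_gal s y))) =1 QE by rewrite -(H x) gal_invKV.
apply: quadratic_form_ext => //; last first.
  by move=> v; rewrite tensor_gal_tens rmorph1 (ext_form1 iota Q_quad) gal_fix.
have pE y z : polar (fun y => (s^-1)%g (QE (tensor_gal s y))) y z =
    (s^-1)%g (polar QE (tensor_gal s y) (tensor_gal s z)).
  by rewrite /polar sD !rmorphB.
split=> [a y|a y z w].
  by rewrite tensor_galZ hE.1 rmorphM rmorphXn /= gal_invK.
by rewrite !pE tensor_gal_semilinear hE.2 rmorphD rmorphM /= gal_invK.
Qed.

End GaloisAction.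

Section ExtendedIsometry.
Variables (F L : fieldType) (j : {rmorphism F -> L}) (V : lmodType F) (Q : V -> F).
Hypothesis Q_quad : quadratic_form Q.
Local Notation QL := (ext_form (iota := j) Q).
Implicit Types g h : orthogonal_group Q.

Lemma tensor_lin_tens (u : V -> V) a v : linear u ->
  tensor_lin u (tens j a v) = tens j a (u v).
Proof. by move=> ul; rewrite /tensor_lin (@tensor_map_tens _ _ _ _ _ _ _ idfun). Qed.

Lemma tensor_lin_linear (u : V -> V) : linear u -> linear (tensor_lin (iota := j) u).
Proof.
by move=> ul a x y; rewrite /tensor_lin (@tensor_map_semilinear _ _ _ _ _ _ _ idfun).
Qed.

Lemma orth_linear g : linear g.
Proof. by case: g => g []. Qed.

Lemma tensor_linM g h x : tensor_lin (iota := j) (g * h)%g x = tensor_lin g (tensor_lin h x).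
Proof.
have gl := tensor_lin_linear (@orth_linear g).
have hl := tensor_lin_linear (@orth_linear h).
have ghl := tensor_lin_linear (@orth_linear (g * h)%g).
elim/tensor_ind: x => [a v|x y Hx Hy].
  by rewrite !tensor_lin_tens //; exact: orth_linear.
by rewrite (linD ghl) (linD hl) (linD gl) Hx Hy.
Qed.

Lemma tensor_lin1 x : tensor_lin (iota := j) (1%g : orthogonal_group Q) x = x.
Proof.
have l1 := tensor_lin_linear (@orth_linear (1%g : orthogonal_group Q)).
elim/tensor_ind: x => [a v|x y Hx Hy].
  by rewrite !tensor_lin_tens //; exact: orth_linear.
by rewrite (linD l1) Hx Hy.
Qed.

Lemma tensor_lin_isometry g : qf_isometry QL QL (tensor_lin g).
Proof.
have gl := tensor_lin_linear (@orth_linear g).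
have hE := ext_form_quad j Q_quad.
split=> //.
  by exists (tensor_lin (g^-1)%g) => x; rewrite -tensor_linM ?mulVg ?mulgV tensor_lin1.
suff : (fun x => QL (tensor_lin g x)) =1 QL by [].
apply: quadratic_form_ext => //; last first.
  move=> v; rewrite tensor_lin_tens ?(ext_form1 j Q_quad); last exact: orth_linear.
  by have [_ _ ->] := orth_isometry g.
have pE y z : polar (fun x => QL (tensor_lin g x)) y z =
    polar QL (tensor_lin g y) (tensor_lin g z).
  by rewrite /polar (linD gl).
split=> [a y|a y z w]; first by rewrite (linZ _ gl) hE.1.
by rewrite !pE gl hE.2.
Qed.

End ExtendedIsometry.

(** Applied to the restriction of automorphisms to a finite list, this gives coset representatives
    of the open subgroup fixing that list. *)
Lemma uniq_representatives (T : Type) (K : eqType) (key : T -> K) (L : seq K) :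
  (forall t, key t \in L) ->
  exists2 rs : seq T, uniq (map key rs) & forall t, key t \in map key rs.
Proof.
move=> keyL; suff [rs urs rsP] : exists2 rs : seq T, uniq (map key rs) &
    forall t, key t \in L -> key t \in map key rs by exists rs => // t; exact: rsP.
elim: L {keyL} => [|k L [rs urs rsP]]; first by exists [::].
have [[t [tk ntk]]|no] := pselect (exists t, key t = k /\ key t \notin map key rs).
  exists (t :: rs); first by rewrite /= ntk.
  by move=> u; rewrite !inE -tk => /orP[->//|/rsP ->]; rewrite orbT.
exists rs => // t; rewrite inE => /orP[/eqP tk|]; last exact: rsP.
by apply: contrapT => /negP tn; apply: no; exists t.
Qed.

(** * Independence of characters and descent for the twist *)

Section LocallyConstantCharacters.
Variables (F E : fieldType) (iota : {rmorphism F -> E}).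
Hypothesis iota_sep : separable_closure iota.
Local Notation Gamma := (gal iota).

Lemma gal_values_finite (xs : seq E) :
  exists L : seq (seq E), forall s : Gamma, map s xs \in L.
Proof.
elim: xs => [|x xs [L LP]]; first by exists [:: [::]].
have [p /separable_poly_neq0 p0 px] := iota_sep.1 x.
have [|rs _ rsP] := @poly_roots_seq _ (map_poly iota p); first by rewrite map_poly_eq0.
exists [seq y :: l | y <- rs, l <- L] => s /=.
apply/allpairsP; exists (s x, map s xs); split=> //=.
rewrite -rsP; move: px; rewrite !rootE => /eqP px.
have <- : map_poly s (map_poly iota p) = map_poly iota p.
  by rewrite -map_poly_comp; apply: eq_map_poly => a /=; rewrite gal_fix.
by rewrite horner_map px rmorph0.
Qed.

(* Artin's proof of the independence of characters, modulo a submodule. *)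
Lemma characters_independent (M : lmodType E) (U : M -> Prop) (A : E -> Prop)
    (xs : seq E) (rs : seq Gamma) (w : Gamma -> M) :
  (forall a x y, U x -> U y -> U (a *: x + y)) -> U 0 ->
  (forall x, x \in xs -> A x) -> A 1 -> (forall a b, A a -> A b -> A (a * b)) ->
  uniq [seq map s xs | s : gal iota <- rs] ->
  (forall a, A a -> U (\sum_(s <- rs) s a *: w s)) ->
  forall s, s \in rs -> U (w s).
Proof.
move=> Ul U0 xsA A1 AM.
have UD x y : U x -> U y -> U (x + y) by move=> Ux; rewrite -[x]scale1r; exact: Ul.
have UZ a x : U x -> U (a *: x) by move=> Ux; rewrite -[_ *: _]addr0; exact: Ul.
elim: rs w => [//|s rs IH] w /= /andP[srs urs] Us.
have Urs t : t \in rs -> U (w t).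
  move=> trs.
  have [b bxs tsb] : exists2 b, b \in xs & t b != s b.
    have /eqP : map t xs != map s xs.
      by apply: contraNneq srs => <-; exact: (map_f (fun u : gal iota => map u xs)).
    move=> ts; apply: contrapT => no; apply: ts; apply/eq_in_map => b bxs.
    by apply/eqP/negPn/negP => tsb; apply: no; exists b.
  suff : U ((t b - s b) *: w t).
    by move/(UZ (t b - s b)^-1); rewrite scalerA mulVf ?scale1r ?subr_eq0.
  apply: (IH (fun u => (u b - s b) *: w u)) => // a Aa.
  (* Evaluating at $ba$ and subtracting $s(b)$ times the value at a removes the term of s and
     multiplies that of u by $u(b)-s(b)$. *)
  have := UD _ _ (Us _ (AM _ _ (xsA b bxs) Aa)) (UZ (- s b) _ (Us _ Aa)).
  rewrite !big_cons scalerDr addrACA scalerA mulNr scaleNr rmorphM /= addrN add0r.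
  rewrite scaler_sumr -big_split /=; congr U; apply: eq_bigr => u _.
  by rewrite rmorphM /= !scalerA -scalerDl -mulrDl mulrC.
move=> t; rewrite inE => /orP[/eqP ->|]; last exact: Urs.
have := Us 1 A1; rewrite big_cons rmorph1 scale1r => Us1.
have Urest : U (\sum_(t <- rs) t 1 *: w t).
  rewrite big_seq; apply: big_ind => // u urs'; exact/UZ/Urs.
by have := UD _ _ Us1 (UZ (-1) _ Urest); rewrite scaleN1r addrK.
Qed.

Variables (V : lmodType F) (Q : V -> F).
Hypothesis Q_quad : quadratic_form Q.
Variable phi : gal iota -> orthogonal_group Q.
Hypothesis phi_morph : {morph phi : s t / (s * t)%g}.
Hypothesis phi_open : open [set s : gal iota | phi s = 1%g].
Local Notation QE := (ext_form (iota := iota) Q).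
Local Notation VE := (tensor iota V).
Local Notation Vphi := (twist phi).

Lemma phi1 : phi 1%g = 1%g.
Proof. by apply: (mulgI (phi 1%g)); rewrite -phi_morph !mulg1. Qed.

Lemma open_kernel_keys :
  exists xs : seq E, forall s t : Gamma, {in xs, s =1 t} -> phi s = phi t.
Proof.
move: phi_open; rewrite gal_openE => /(_ 1%g phi1)[xs xsP].
exists xs => s t st; rewrite -[s](mulVKg t) phi_morph.
rewrite (_ : phi (t^-1 * s)%g = 1%g) ?mulg1 //; apply: xsP => x xxs.
by rewrite gal_mulE st // gal_invK.
Qed.

Lemma phi_locally_constant : locally_constant phi.
Proof.
have [xs xsP] := open_kernel_keys => s.
by apply: filterS (gal_nbhs s xs) => t /= ts; exact: xsP.
Qed.

(** The twisted semilinear action, whose fixed vectors form [twist phi]. *)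
Let tau s (y : VE) : VE := tensor_lin (phi s) (tensor_gal s y).

Let tau_lin s a x y : tau s (a *: x + y) = s a *: tau s x + tau s y.
Proof. exact: twist_semilinear. Qed.

Let tau_tens s a v : tau s (tens iota a v) = tens iota (s a) (phi s v).
Proof. by rewrite /tau tensor_gal_tens tensor_lin_tens //; exact: orth_linear. Qed.

Let tauD s x y : tau s (x + y) = tau s x + tau s y.
Proof. by have := tau_lin s 1 x y; rewrite rmorph1 !scale1r. Qed.

Let tau0 s : tau s 0 = 0.
Proof. by apply: (addrI (tau s 0)); rewrite -tauD !addr0. Qed.

Let tauZ s a x : tau s (a *: x) = s a *: tau s x.
Proof. by have := tau_lin s a x 0; rewrite tau0 !addr0. Qed.

Let tau_sum s (I : Type) (r : seq I) (f : I -> VE) :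
  tau s (\sum_(i <- r) f i) = \sum_(i <- r) tau s (f i).
Proof. by apply: big_morph; [exact: tauD|exact: tau0]. Qed.

Let twistP (x : Vphi) s : tau s (twist_val x) = twist_val x.
Proof. by case: x => x xP; move/asboolP: (xP); apply. Qed.
Let ext_form_tau s y : QE (tau s y) = s (QE y).
Proof.
rewrite /tau; have [_ _ ->] := tensor_lin_isometry iota Q_quad (phi s).
exact: ext_form_gal.
Qed.

(** The value is Galois invariant because [tau s] fixes x and changes the form by s; so it comes
    from F, and [xget] does not return its default. *)
Lemma twist_formE (x : Vphi) : iota (twist_form phi x) = QE (twist_val x).
Proof.
have [a aE] : exists a, QE (twist_val x) = iota a.
  by apply: (gal_fixed_field iota_sep) => s; rewrite -ext_form_tau twistP.
by apply: (@xgetI _ 0 [set a | iota a = QE (twist_val x)] a).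
Qed.

Lemma twist_valD (x y : Vphi) : twist_val (x + y) = twist_val x + twist_val y.
Proof. exact: (raddfD val). Qed.

Lemma twist_polarE (x y : Vphi) :
  iota (polar (twist_form phi) x y) = polar QE (twist_val x) (twist_val y).
Proof. by rewrite /polar !rmorphB !twist_formE twist_valD. Qed.

Lemma twist_form_quad : quadratic_form (twist_form phi).
Proof.
have hE := ext_form_quad iota Q_quad.
have fi : injective iota := @fmorph_inj _ _ iota.
split=> [a x|a x y z]; apply: fi.
  by rewrite rmorphM rmorphXn !twist_formE /= hE.1.
by rewrite [RHS]rmorphD rmorphM !twist_polarE twist_valD /= hE.2.
Qed.

Fixpoint descent_term (t : tterm E Vphi) : VE :=
  match t with
  | TPure a x => a *: twist_val x
  | TAdd s t => descent_term s + descent_term t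
  end.

Definition descent_map (x : tensor iota Vphi) : VE := descent_term (repr x).

Lemma descent_mapE t : descent_map (\pi_(tensor iota Vphi) t) = descent_term t.
Proof.
rewrite /descent_map; have := tensor_repr iota t; move: (repr _) => s st.
elim: s t / st => //=.
- by move=> r s t _ -> _ ->.
- by move=> s s' t t' _ -> _ ->.
- by move=> r s t; rewrite addrA.
- by move=> s t; rewrite addrC.
- by move=> t; rewrite scale0r add0r.
- by move=> a b v; rewrite scalerDl.
- by move=> a v w; rewrite scalerDr.
- by move=> a c v; rewrite scalerA.
Qed.

Lemma descent_map_tens a x : descent_map (tens iota a x) = a *: twist_val x.
Proof. exact: descent_mapE. Qed.

Lemma descent_mapD x y : descent_map (x + y) = descent_map x + descent_map y.
Proof.
by elim/quotW: x => x; elim/quotW: y => y; rewrite tensor_piD !descent_mapE.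
Qed.

Lemma descent_map_linear : linear descent_map.
Proof.
move=> a x y; rewrite descent_mapD; congr (_ + _).
elim/tensor_ind: x => [b v|x x' Hx Hx'].
  by have [_ _ -> _] := tens_is_bilinear iota Vphi; rewrite !descent_map_tens scalerA.
by rewrite scalerDr !descent_mapD scalerDr Hx Hx'.
Qed.

Lemma descent_map_gal s x : descent_map (tensor_gal s x) = tau s (descent_map x).
Proof.
elim/tensor_ind: x => [a v|x y Hx Hy].
  by rewrite tensor_gal_tens !descent_map_tens tauZ twistP.
by rewrite tensor_galD !descent_mapD tauD Hx Hy.
Qed.

Lemma descent_map_form x : QE (descent_map x) = ext_form (iota := iota) (twist_form phi) x.
Proof.
have hE := ext_form_quad iota Q_quad; have hphi := twist_form_quad.
have ml := descent_map_linear.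
apply: (quadratic_form_ext (q1 := fun x => QE (descent_map x))).
- have pE y z : polar (fun x => QE (descent_map x)) y z =
      polar QE (descent_map y) (descent_map z) by rewrite /polar (linD ml).
  split=> [a y|a y z w]; first by rewrite (linZ _ ml) hE.1.
  by rewrite !pE ml hE.2.
- exact: ext_form_quad.
- by move=> v; rewrite descent_map_tens scale1r (ext_form1 iota hphi) twist_formE.
Qed.

(* The traces [sum_s s(a) phi(s)(v)] over a finite quotient of the Galois group
   lie in the twist; independence of characters shows that they span. *)
Lemma descent_map_surj y : exists x, descent_map x = y.
Proof.
have ml := descent_map_linear.
pose U y := exists x, descent_map x = y; rewrite -/(U y).
have Ul a x z : U x -> U z -> U (a *: x + z).
  by move=> [x' <-] [z' <-]; exists (a *: x' + z'); rewrite ml.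
have U0 : U 0 by exists 0; exact: (lin0 ml).
have [xs xsP] := open_kernel_keys.
have [L LP] := gal_values_finite xs.
have [rs urs rsP] := uniq_representatives LP.
(* Elements on which an automorphism depends only through its restriction to [xs]; for these the
   sums over [rs] do not depend on the representatives. *)
pose A a := forall s t : Gamma, {in xs, s =1 t} -> s a = t a.
have U1 v : U (tens iota 1 v).
  have /mapP[r rrs /eq_in_map r1] := rsP 1%g.
  have phir : phi r = 1%g by rewrite -phi1; apply: xsP => x xxs; rewrite r1.
  have -> : tens iota 1 v = tens iota 1 (phi r v) by rewrite phir.
  apply: (@characters_independent _ U A xs rs (fun s => tens iota 1 (phi s v))) => //.
  - by move=> x xxs s t; apply.
  - by move=> s t _; rewrite !rmorph1.
  - by move=> a b Aa Ab s t st; rewrite !rmorphM /= (Aa _ _ st) (Ab _ _ st).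
  - move=> a Aa; pose f (s : Gamma) := s a *: tens iota 1 (phi s v).
    (* Applying [tau t] replaces [rs] by its left translate, again a system of representatives, and
       [f s] depends only on the restriction of s to [xs]. *)
    have Tinv : \sum_(s <- rs) f s \in twist_pred phi.
      apply/asboolP => t; rewrite -/(tau t _) tau_sum.
      have tf s : tau t (f s) = f (t * s)%g.
        by rewrite /f tauZ tau_tens rmorph1 phi_morph.
      pose key (s : Gamma) := [seq s i | i <- xs].
      have fkey s u : key s = key u -> f s = f u.
        by move=> /eq_in_map su; rewrite /f (xsP _ _ su) (Aa _ _ su).
      pose g k := f (xget 1%g [set s | key s = k]).
      have fg s : f s = g (key s).
        by apply: fkey; rewrite (@xgetI _ 1%g [set u | key u = key s] s).
      under eq_bigr do rewrite tf fg; under [RHS]eq_bigr do rewrite fg.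
      rewrite -(big_map (fun s => key (t * s)%g) xpredT g) -(big_map key xpredT g).
      apply: perm_big; apply: uniq_perm => //.
        have -> : [seq key (t * s)%g | s <- rs] = map (map t) (map key rs).
          by rewrite -map_comp; apply: eq_map => s /=; rewrite /key -map_comp.
        by rewrite map_inj_uniq //; apply: inj_map; exact: fmorph_inj.
      move=> k; apply/mapP/mapP => -[s _ ->].
        by have /mapP[u urs' uE] := rsP (t * s)%g; exists u.
      have /mapP[u urs' uE] := rsP (t^-1 * s)%g; exists u => //.
      move: uE => /eq_in_map uE; apply/eq_in_map => x xxs.
      by rewrite gal_mulE -uE // gal_mulE gal_invKV.
    exists (tens iota 1 (Twist Tinv)); rewrite descent_map_tens scale1r.
    by rewrite /=; apply: eq_bigr.
elim/tensor_scalar_span: y => [a v|x y Ux Uy].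
  by rewrite -[_ *: _]addr0; exact: Ul.
by rewrite -[x]scale1r; exact: Ul.
Qed.

Lemma tensor_sum_tens (M : lmodType F) (t : tensor iota M) :
  exists N (a : 'I_N -> E) (x : 'I_N -> M), t = \sum_i tens iota (a i) (x i).
Proof.
suff [s ->] : exists s : seq (E * M), t = \sum_(p <- s) tens iota p.1 p.2.
  exists (size s), (fun i => (tnth (in_tuple s) i).1), (fun i => (tnth (in_tuple s) i).2).
  by rewrite big_tnth.
elim/tensor_ind: t => [a v|_ _ [s ->] [s' ->]].
  by exists [:: (a, v)]; rewrite big_seq1.
by exists (s ++ s'); rewrite big_cat.
Qed.

Lemma tens10 (M : lmodType F) : tens iota 1 (0 : M) = 0.
Proof.
have := tens1_semilinear iota (-1) (0 : M) 0.
by rewrite scaler0 addr0 rmorphN1 scaleN1r addNr.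
Qed.

(* Induction on the number of nonzero coefficients of a relation. *)
Lemma descent_map_inj x : descent_map x = 0 -> x = 0.
Proof.
have [hD1 hD2 hZ hF] := tens_is_bilinear iota Vphi.
have [N [a0 [v ->]]] := tensor_sum_tens x.
have mE a : descent_map (\sum_i tens iota (a i) (v i)) = \sum_i a i *: twist_val (v i).
  rewrite (big_morph _ descent_mapD (lin0 descent_map_linear)).
  by apply: eq_bigr => i _; rewrite descent_map_tens.
rewrite mE; have [n] := ubnP #|[pred i | a0 i != 0]|.
elim: n a0 => [//|n IH] a /ltnSE an am.
have [i0 ai0|noi] := pickP [pred i | a i != 0]; last first.
  rewrite big1 // => i _; have /negbFE/eqP -> := noi i.
  by have := hZ 0 0 (v i); rewrite scale0r mul0r.
pose b i := (a i0)^-1 * a i.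
have bm : \sum_i b i *: twist_val (v i) = 0.
  transitivity ((a i0)^-1 *: \sum_i a i *: twist_val (v i)); last by rewrite am scaler0.
  by rewrite scaler_sumr; apply: eq_bigr => i _; rewrite scalerA.
suff b0 : \sum_i tens iota (b i) (v i) = 0.
  transitivity (a i0 *: \sum_i tens iota (b i) (v i)); last by rewrite b0 scaler0.
  by rewrite scaler_sumr; apply: eq_bigr => i _; rewrite hZ /b mulVKf.
have bi0 : b i0 = 1 by rewrite /b mulVf.
have supp (c : 'I_N -> E) i : b i != 0 -> c i = 0 -> (forall k, b k = 0 -> c k = 0) ->
    (#|[pred k | c k != 0%R]| < n)%N.
  move=> bi ci bc; apply: leq_trans an; apply: proper_card; apply/properP; split.
    apply/fintype.subsetP => k; rewrite !inE; apply: contra_neq => ak.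
    by apply: bc; rewrite /b ak mulr0.
  exists i; rewrite !inE ?ci ?eqxx //; apply: contra_neq bi => ai.
  by rewrite /b ai mulr0.
have [/choice[f fE]|] := pselect (forall i, exists c, b i = iota c).
  have -> : \sum_i tens iota (b i) (v i) = tens iota 1 (\sum_i f i *: v i).
    rewrite (big_morph _ (hD1 1) (tens10 Vphi)).
    by apply: eq_bigr => i _; rewrite fE -hF mul1r.
  suff -> : \sum_i f i *: v i = 0 by rewrite tens10.
  apply: val_inj; rewrite -[RHS]bm raddf_sum; apply: eq_bigr => i _ /=.
  by rewrite fE.
(* Some s moves $b_k$. Then $d=b-s(b)$ vanishes at [i0] and $c=b-(b_k/d_k)d$ vanishes at k; both are
   shorter relations, and b is recovered from them. *)
move=> /existsNP[k /forallNP bk].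
have [s sbk] : exists s : Gamma, s (b k) != b k.
  apply: contrapT => /forallNP no; have [|c /bk//] := gal_fixed_field iota_sep (x := b k).
  by move=> s; apply/eqP/negPn/negP; exact: no.
pose d i := b i - s (b i).
have dm : \sum_i d i *: twist_val (v i) = 0.
  have := congr1 (tau s) bm; rewrite tau0 tau_sum => sbm.
  under eq_bigr do rewrite scalerBl; rewrite sumrB bm sub0r.
  apply/eqP; rewrite oppr_eq0; apply/eqP; rewrite -[RHS]sbm.
  by apply: eq_bigr => i _; rewrite tauZ twistP.
have d0 : \sum_i tens iota (d i) (v i) = 0.
  apply: IH => //; apply: (supp _ i0); first by rewrite bi0 oner_neq0.
    by rewrite /d bi0 rmorph1 subrr.
  by move=> i bi; rewrite /d bi rmorph0 subrr.
have dk : d k != 0 by rewrite subr_eq0 eq_sym.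
pose c i := b i - b k / d k * d i.
have cE (M : lmodType E) (w : 'I_N -> M) : \sum_i c i *: w i =
    \sum_i b i *: w i - (b k / d k) *: \sum_i d i *: w i.
  by rewrite scaler_sumr -sumrB; apply: eq_bigr => i _; rewrite scalerBl scalerA.
have tZ (e : 'I_N -> E) : \sum_i tens iota (e i) (v i) = \sum_i e i *: tens iota 1 (v i).
  by apply: eq_bigr => i _; rewrite hZ mulr1.
have : \sum_i tens iota (c i) (v i) = 0.
  apply: IH; last by rewrite cE bm dm scaler0 subrr.
  apply: (supp _ k).
  - by apply: contraNneq dk => bk0; rewrite /d bk0 rmorph0 subrr.
  - by rewrite /c divfK // subrr.
  - by move=> i bi; rewrite /c /d bi rmorph0 subrr mulr0 subrr.
by rewrite !tZ cE -tZ => /eqP; rewrite subr_eq0 => /eqP ->; rewrite -tZ d0 scaler0.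
Qed.

Lemma descent_isometry : exists2 u, qf_isometry QE (ext_form (iota := iota) (twist_form phi)) u
  & forall s, u \o tensor_lin (phi s) = gal_conj s u.
Proof.
have ml := descent_map_linear.
have [u uK] := choice descent_map_surj.
have mK x : u (descent_map x) = x.
  apply/eqP; rewrite -subr_eq0; apply/eqP/descent_map_inj.
  by rewrite (linD ml) (linN ml) uK subrr.
exists u; first split.
- by move=> a x y; apply: (can_inj mK); rewrite ml !uK.
- by exists descent_map.
- by move=> x; rewrite -descent_map_form uK.
move=> s; apply/funext => x; apply: (can_inj mK); rewrite /gal_conj /= uK.
by rewrite descent_map_gal uK /tau tensor_galKV.
Qed.

End LocallyConstantCharacters.

(** * Cohomology classes and the homomorphism xi *)

Lemma funBE (T : Type) (M : zmodType) (f g : T -> M) x : (f - g) x = f x - g x.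
Proof. by []. Qed.

Section CohomologyClasses.
Variables (F E : fieldType) (iota : {rmorphism F -> E}).
Local Notation Gamma := (gal iota).

Lemma locally_constant_comp (X : topologicalType) (T U : Type) (f : X -> T) (g : T -> U) :
  locally_constant f -> locally_constant (g \o f).
Proof. by move=> fc x; apply: filterS (fc x) => y /= ->. Qed.

Lemma locally_constant_fst (X Y : topologicalType) (T : Type) (f : X -> T) :
  locally_constant f -> locally_constant (fun p : X * Y => f p.1).
Proof.
by move=> fc [x y]; exact: (@cvg_fst _ _ (nbhs x) (nbhs y) _ _ (fc x)).
Qed.

Lemma locally_constant_snd (X Y : topologicalType) (T : Type) (f : Y -> T) :
  locally_constant f -> locally_constant (fun p : X * Y => f p.2).
Proof.
by move=> fc [x y]; exact: (@cvg_snd _ _ (nbhs x) (nbhs y) _ _ (fc y)).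
Qed.

Variable M : gmod iota.

Lemma Z1P (c : Gamma -> M) : c \in Z1_pred (M := M) <->
  locally_constant c /\ forall s t, c (s * t)%g = c s + gact s (c t).
Proof. by split=> /asboolP. Qed.

Lemma Z2P (z : Gamma * Gamma -> M) : z \in Z2_pred (M := M) <->
  locally_constant z /\ forall s t u, gact s (z (t, u)) - z ((s * t)%g, u)
                    + z (s, (t * u)%g) - z (s, t) = 0.
Proof. by split=> /asboolP. Qed.

Lemma H1_cocycle_Z1 (x : H1 M) : H1_cocycle x \in Z1_pred (M := M).
Proof. exact: valP. Qed.
Lemma H2_cocycle_Z2 (x : H2 M) : H2_cocycle x \in Z2_pred (M := M).
Proof. exact: valP. Qed.

Lemma H1_cocycleK (x : H1 M) : H1_class (H1_cocycle x) = x.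
Proof. by rewrite /H1_class /H1_cocycle valKd reprK. Qed.
Lemma H2_cocycleK (x : H2 M) : H2_class (H2_cocycle x) = x.
Proof. by rewrite /H2_class /H2_cocycle valKd reprK. Qed.

Lemma H1_class_eqP (c d : Gamma -> M) : c \in Z1_pred (M := M) -> d \in Z1_pred (M := M) ->
  H1_class c = H1_class d <-> exists m, forall s, c s = d s + (gact s m - m).
Proof.
move=> cZ dZ; rewrite /H1_class; split.
  move/eqP; rewrite -Quotient.idealrBE => /asboolP[m].
  rewrite raddfB /= !insubdK // => cd; exists m => s.
  by rewrite -[_ - m]/(coboundary0 m s) -cd funBE addrC subrK.
move=> [m cd]; apply/eqP; rewrite -Quotient.idealrBE; apply/asboolP; exists m.
by rewrite raddfB /= !insubdK //; apply/funext => s; rewrite funBE cd addrC addKr.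
Qed.

Lemma H2_class_eqP (y z : Gamma * Gamma -> M) : y \in Z2_pred (M := M) -> z \in Z2_pred (M := M) ->
  H2_class y = H2_class z <-> exists2 b, locally_constant b &
    forall st, y st = z st + coboundary1 b st.
Proof.
move=> yZ zZ; rewrite /H2_class; split.
  move/eqP; rewrite -Quotient.idealrBE => /asboolP[b bc].
  rewrite raddfB /= !insubdK // => yz; exists b => // st.
  by rewrite -yz funBE addrC subrK.
move=> [b bc yz]; apply/eqP; rewrite -Quotient.idealrBE; apply/asboolP; exists b => //.
by rewrite raddfB /= !insubdK //; apply/funext => s; rewrite funBE yz addrC addKr.
Qed.

Lemma quot_piB (R : zmodType) (I : zmodClosed R) (x y : R) :
  \pi_(Quotient.quot I) (x - y) = \pi_(Quotient.quot I) x - \pi_(Quotient.quot I) y :> Quotient.quot I.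
Proof. by rewrite !piE. Qed.

Lemma quot_piD (R : zmodType) (I : zmodClosed R) (x y : R) :
  \pi_(Quotient.quot I) (x + y) = \pi_(Quotient.quot I) x + \pi_(Quotient.quot I) y :> Quotient.quot I.
Proof. by rewrite !piE. Qed.

Lemma quot_pi0 (R : zmodType) (I : zmodClosed R) :
  \pi_(Quotient.quot I) 0 = 0 :> Quotient.quot I.
Proof. by rewrite !piE. Qed.

Lemma H1_classB (c d : Gamma -> M) : c \in Z1_pred (M := M) -> d \in Z1_pred (M := M) ->
  H1_class (c - d) = H1_class c - H1_class d.
Proof.
move=> cZ dZ; rewrite /H1_class -quot_piB; congr (\pi _).
by apply: val_inj; rewrite raddfB /= !insubdK // rpredB.
Qed.

Lemma H2_classB (y z : Gamma * Gamma -> M) : y \in Z2_pred (M := M) -> z \in Z2_pred (M := M) ->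
  H2_class (y - z) = H2_class y - H2_class z.
Proof.
move=> yZ zZ; rewrite /H2_class -quot_piB; congr (\pi _).
by apply: val_inj; rewrite raddfB /= !insubdK // rpredB.
Qed.

End CohomologyClasses.

Section TrivialModule.
Variables (F E : fieldType) (iota : {rmorphism F -> E}) (A : zmodType).
Local Notation M := (trivial_gmod iota A).
Local Notation Gamma := (gal iota).

(** Coboundaries vanish for the trivial action, so a class has only one cocycle. *)
Lemma H1_class_trivialK (c : Gamma -> M) : c \in Z1_pred (M := M) ->
  H1_cocycle (H1_class c) = c.
Proof.
move=> cZ; have := H1_cocycleK (H1_class c).
move=> /(H1_class_eqP (H1_cocycle_Z1 _) cZ)[m mE]; apply/funext => s.
by rewrite mE /= subrr addr0.
Qed.

Lemma H1_cocycle_trivialB (x y : H1 M) : H1_cocycle (x - y) = H1_cocycle x - H1_cocycle y.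
Proof.
have cx := H1_cocycle_Z1 x; have cy := H1_cocycle_Z1 y.
rewrite -{1}[x]H1_cocycleK -{1}[y]H1_cocycleK -H1_classB //.
by apply: H1_class_trivialK; exact: rpredB.
Qed.

Lemma H1_cocycle_trivial_eq (x y : H1 M) : H1_cocycle x = H1_cocycle y -> x = y.
Proof. by move=> xy; rewrite -[x]H1_cocycleK -[y]H1_cocycleK xy. Qed.

Lemma H1_cocycle_trivialD (x : H1 M) s t :
  H1_cocycle x (s * t)%g = H1_cocycle x s + H1_cocycle x t.
Proof. by have /Z1P[_ ->] := H1_cocycle_Z1 x. Qed.

Lemma H1_cocycle_lc (x : H1 M) : locally_constant (H1_cocycle x : Gamma -> A).
Proof. by have /Z1P[] := H1_cocycle_Z1 x. Qed.

End TrivialModule.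

Section GmLemmas.
Variables (K : fieldType).
Implicit Types x y : Gm K.

Lemma gm_valD x y : gm_val (x + y) = gm_val x * gm_val y. Proof. by []. Qed.
Lemma gm_valN x : gm_val (- x) = (gm_val x)^-1. Proof. by []. Qed.
Lemma gm_valMn x n : gm_val (x *+ n) = gm_val x ^+ n.
Proof. by elim: n => [|n IH] //; rewrite mulrS exprS gm_valD IH. Qed.

Lemma gm_mapD (L : fieldType) (f : {rmorphism K -> L}) x y :
  gm_map f (x + y) = gm_map f x + gm_map f y.
Proof. by apply: val_inj; rewrite /= rmorphM. Qed.
Lemma gm_mapN (L : fieldType) (f : {rmorphism K -> L}) x : gm_map f (- x) = - gm_map f x.
Proof. by apply: val_inj; rewrite /= fmorphV. Qed.
Lemma gm_map0 (L : fieldType) (f : {rmorphism K -> L}) : gm_map f 0 = 0.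
Proof. by apply: val_inj; rewrite /= rmorph1. Qed.

Lemma square_class_eq x y :
  \pi_(Quotient.quot (@gm_squares K)) x = \pi_(Quotient.quot (@gm_squares K)) y :> square_classes K
  <-> exists c, x = y + c *+ 2.
Proof.
split.
  move/eqP; rewrite -Quotient.idealrBE => /asboolP[c xy].
  by exists c; rewrite -xy addrC subrK.
move=> [c ->]; apply/eqP; rewrite -Quotient.idealrBE; apply/asboolP.
by exists c; rewrite addrC addKr.
Qed.

Lemma square_class_double (c : square_classes K) : c + c = 0.
Proof.
elim/quotW: c => x; rewrite -[LHS]quot_piD -[RHS]quot_pi0.
by apply/square_class_eq; exists x; rewrite add0r mulr2n.
Qed.

End GmLemmas.

(** * The homomorphism xi computed by square roots *)

Section Xi.
Variables (F E : fieldType) (iota : {rmorphism F -> E}).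
Variables (k : closedFieldType) (j : {rmorphism F -> k}).
Local Notation Gamma := (gal iota).
Local Notation M := (gm_gmod iota).
Local Notation sq := (square_classes F).
Local Notation pi b := (\pi_(Quotient.quot (@gm_squares F)) b : sq).
Local Notation base z := ((fun st => gm_map iota (z st)) : Gamma * Gamma -> M).

Lemma gm_map_base_fixed (s : Gamma) (b : Gm F) : gm_map s (gm_map iota b) = gm_map iota b.
Proof. by apply: val_inj; rewrite /= gal_fix. Qed.

(* The class [xi c] is computed by choosing square roots [h s] in [k] of lifts
   of the square classes [c s]: the failure of [h] to be multiplicative is a
   cocycle [z] with values in [F^x]. *)
Definition sqrt_cochain (c : Gamma -> sq) (h : Gamma -> k) (z : Gamma * Gamma -> Gm F) :=
  [/\ locally_constant h, locally_constant z,
      forall s, exists b : Gm F, h s ^+ 2 = j (gm_val b) /\ pi b = c s &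
      forall s t, h s * h t = j (gm_val (z (s, t))) * h (s * t)%g].

Lemma sqrt_cochain_neq0 c h z s : sqrt_cochain c h z -> h s != 0.
Proof.
move=> [_ _ /(_ s)[b [hb _]] _]; apply/negP => /eqP h0; move/eqP: hb.
by rewrite h0 expr0n eq_sym fmorph_eq0 (negPf (gm_neq0 b)).
Qed.

Lemma gm_val_j_inj (a b : Gm F) : j (gm_val a) = j (gm_val b) -> a = b.
Proof. by move=> /fmorph_inj ab; exact: val_inj. Qed.

(** In $k^\times$ with trivial action, z becomes the coboundary of h and so satisfies the cocycle
    identity; injectivity of j brings this back to $F^\times$, whose image in E is fixed by
    $\Gamma$. *)
Lemma sqrt_cochain_Z2 c h z : sqrt_cochain c h z -> base z \in Z2_pred (M := M).
Proof.
move=> hz; have h0 s := sqrt_cochain_neq0 s hz; have [hc zc hb hh] := hz.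
apply/Z2P; split; first exact: locally_constant_comp zc.
move=> s t u; rewrite [gact _ _]gm_map_base_fixed -!gm_mapN -!gm_mapD.
rewrite [X in gm_map _ X](_ : _ = 0) ?gm_map0 //.
apply/eqP; rewrite subr_eq0 addrAC subr_eq; apply/eqP.
apply: gm_val_j_inj; rewrite !gm_valD !rmorphM /=.
have zE v w : j (gm_val (z (v, w))) = h v * h w / h (v * w)%g by rewrite hh mulfK.
have n1 := h0 (s * t)%g; have n2 := h0 (t * u)%g; have n3 := h0 (s * t * u)%g.
by rewrite !zE mulgA; field; rewrite n1 n2 n3.
Qed.

Lemma gm_sqrt_ratio (b b' : Gm F) (x x' : k) : x ^+ 2 = j (gm_val b) ->
  x' ^+ 2 = j (gm_val b') -> pi b = pi b' -> exists d : Gm F, x = j (gm_val d) * x'.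
Proof.
move=> xb x'b /square_class_eq[d bE].
have : x ^+ 2 = (j (gm_val d) * x') ^+ 2.
  by rewrite exprMn xb x'b bE gm_valD gm_valMn rmorphM rmorphXn /= mulrC.
move/eqP; rewrite eqf_sqr => /orP[/eqP ->|/eqP ->]; first by exists d.
have dN : - gm_val d != 0 by rewrite oppr_eq0 gm_neq0.
by exists (MkGm dN); rewrite /= rmorphN mulNr.
Qed.

(** Square roots of two representatives of one square class have their ratio in $F^\times$, so
    $h/h'$ is a cochain with values in $F^\times$, and its coboundary is the difference of z and
    z'. *)
Lemma sqrt_cochain_unique c h z h' z' : sqrt_cochain c h z -> sqrt_cochain c h' z' ->
  H2_class (base z) = H2_class (base z').
Proof.
move=> hz hz'; have h0 s := sqrt_cochain_neq0 s hz; have h'0 s := sqrt_cochain_neq0 s hz'.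
apply/(H2_class_eqP (sqrt_cochain_Z2 hz) (sqrt_cochain_Z2 hz')).
have [hc zc hb hh] := hz; have [hc' zc' hb' hh'] := hz'.
have /choice[d dE] s : exists d : Gm F, h s = j (gm_val d) * h' s.
  have [b [hsb bc]] := hb s; have [b' [hsb' bc']] := hb' s.
  by apply: (gm_sqrt_ratio hsb hsb'); rewrite bc bc'.
exists (fun s => gm_map iota (d s) : M).
  apply: (locally_constant_comp (f := d)) => s.
  near=> t; apply: gm_val_j_inj; apply: (mulIf (h'0 s)).
  rewrite -dE; have <- : h' t = h' s by near: t; exact: hc'.
  by rewrite -dE; near: t; exact: hc.
move=> [s t]; rewrite /coboundary1 /= gm_map_base_fixed -gm_mapN -!gm_mapD.
congr (gm_map iota _); apply: gm_val_j_inj.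
rewrite !gm_valD gm_valN !rmorphM fmorphV /=.
have dn s' : j (gm_val (d s')) != 0 by rewrite fmorph_eq0 gm_neq0.
apply: (mulIf (h0 (s * t)%g)); rewrite -hh !dE.
rewrite mulrACA hh'; have := dn (s * t)%g; move: (dn (s * t)%g).
by move=> d0 _; field; rewrite d0.
Unshelve. all: by end_near. Qed.

Lemma sqrt_cochainB c h z c' h' z' : sqrt_cochain c h z -> sqrt_cochain c' h' z' ->
  sqrt_cochain (c - c') (fun s => h s / h' s) (z - z').
Proof.
move=> hz hz'; have h0 s := sqrt_cochain_neq0 s hz; have h'0 s := sqrt_cochain_neq0 s hz'.
have [hc zc hb hh] := hz; have [hc' zc' hb' hh'] := hz'; split.
- exact: (locally_constant_op2 (fun x y => x / y) hc hc').
- exact: (locally_constant_op2 (fun x y => x - y) zc zc').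
- move=> s; have [b [hsb bc]] := hb s; have [b' [hsb' bc']] := hb' s.
  exists (b - b'); split; last by rewrite quot_piB bc bc'.
  by rewrite exprMn exprVn hsb hsb' gm_valD rmorphM gm_valN fmorphV.
- move=> s t; rewrite funBE gm_valD gm_valN rmorphM fmorphV /= mulrACA hh -invfM hh'.
  by rewrite invfM; ring.
Qed.

(** The squares of h lie in $F^\times$, and their coboundary is twice z. *)
Lemma sqrt_cochain_double c h z : sqrt_cochain c h z ->
  H2_class (base z) \in Br2_pred (iota := iota).
Proof.
move=> hz; have zZ := sqrt_cochain_Z2 hz; have h0 s := sqrt_cochain_neq0 s hz.
have [hc zc hb hh] := hz.
pose B : Gamma * Gamma -> M := base z.
have B0 : H2_class ((B - B) - B) = - H2_class B.
  by rewrite !H2_classB ?rpredB // subrr sub0r.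
rewrite unfold_in mulr2n addr_eq0 -B0; apply/eqP.
have NZ : (B - B) - B \in Z2_pred (M := M) by rewrite !rpredB.
apply/(H2_class_eqP zZ NZ).
have /choice[b bE] s : exists b : Gm F, h s ^+ 2 = j (gm_val b).
  by have [b [? _]] := hb s; exists b.
exists (fun s => gm_map iota (b s) : M).
  apply: (locally_constant_comp (f := b)) => s; near=> t; apply: gm_val_j_inj.
  by rewrite -!bE; congr (_ ^+ 2); near: t; exact: hc.
move=> [s t]; rewrite /coboundary1 /= gm_map_base_fixed !funBE subrr sub0r /B.
rewrite -!gm_mapN -!gm_mapD; congr (gm_map iota _); apply: gm_val_j_inj.
rewrite !gm_valD !gm_valN !rmorphM !fmorphV /= -!bE.
have zE : j (gm_val (z (s, t))) = h s * h t / h (s * t)%g by rewrite hh mulfK.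
rewrite zE; have n1 := h0 s; have n2 := h0 t; have n3 := h0 (s * t)%g.
by field; rewrite n1 n2 n3.
Unshelve. all: by end_near. Qed.

Definition xi_rel (x : H1 (sq_gmod iota)) (y : Br2 iota) : Prop :=
  exists h z, sqrt_cochain (H1_cocycle x) h z /\ br2_val y = H2_class (base z).

Lemma xi_rel_fun x y y' : xi_rel x y -> xi_rel x y' -> y = y'.
Proof.
move=> [h [z [hz yE]]] [h' [z' [hz' y'E]]]; apply: val_inj => /=.
by rewrite yE y'E (sqrt_cochain_unique hz hz').
Qed.

Lemma xi_relB x y x' y' : xi_rel x y -> xi_rel x' y' -> xi_rel (x - x') (y - y').
Proof.
move=> [h [z [hz yE]]] [h' [z' [hz' y'E]]].
exists (fun s => h s / h' s), (z - z'); split.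
  by rewrite H1_cocycle_trivialB; exact: sqrt_cochainB.
have -> : br2_val (y - y') = br2_val y - br2_val y' by exact: (raddfB val).
rewrite yE y'E -H2_classB; first by congr H2_class; apply/funext => st; rewrite /= gm_mapD gm_mapN.
- exact: sqrt_cochain_Z2 hz.
- exact: sqrt_cochain_Z2 hz'.
Qed.

Lemma closed_field_sqrt (a : k) : exists x, x ^+ 2 = a.
Proof.
have /closed_rootP[x] : size ('X^2 - a%:P : {poly k}) != 1%N.
  by rewrite size_XnsubC.
by rewrite rootE !hornerE subr_eq0 => /eqP; exists x.
Qed.

Lemma xi_rel_total x : exists y, xi_rel x y.
Proof.
(* Representatives and roots are chosen once for each square class, not for each s, which makes the
   resulting cochains locally constant. *)
have /choice[r rE] : forall a : sq, exists b : Gm F, pi b = a.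
  by move=> a; exists (repr a); rewrite reprK.
have /choice[H HE] a := closed_field_sqrt (j (gm_val (r a))).
have H0 a : H a != 0.
  apply/negP => /eqP h0; move/eqP: (HE a).
  by rewrite h0 expr0n eq_sym fmorph_eq0 (negPf (gm_neq0 _)).
have /choice[D DE] (ab : sq * sq) : exists d : Gm F,
    H ab.1 * H ab.2 = j (gm_val d) * H (ab.1 + ab.2).
  apply: (@gm_sqrt_ratio (r ab.1 + r ab.2) (r (ab.1 + ab.2))) => //.
    by rewrite exprMn !HE gm_valD rmorphM.
  by rewrite quot_piD !rE.
pose c := H1_cocycle x; have cc : locally_constant c by exact: H1_cocycle_lc.
pose z (st : Gamma * Gamma) := D (c st.1, c st.2).
have hz : sqrt_cochain c (H \o c) z.
  split.
  - exact: locally_constant_comp.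
  - apply: (locally_constant_comp (f := fun st : Gamma * Gamma => (c st.1, c st.2))).
    apply: locally_constant_op2; [exact: locally_constant_fst|exact: locally_constant_snd].
  - by move=> s; exists (r (c s)); rewrite /= HE rE.
  - by move=> s t; rewrite /= [c (s * t)%g]H1_cocycle_trivialD; exact: (DE (c s, c t)).
by exists (MkBr2 (sqrt_cochain_double hz)), (H \o c), z.
Qed.

End Xi.

(** The carry in the addition of two residues 0, 1 is their product. This is the source of the
    cocycle $\chi(s)\chi(t)$ of the Bockstein class and of $b^{\chi(s)\chi(t)}$ for the symbol. *)
Lemma F2_natD (a b : 'F_2) : ((a : nat) + b = (a + b : 'F_2)%R + 2 * (a * b)%N)%N.
Proof. by move: a b => [[|[|//]] ?] [[|[|//]] ?]. Qed.

Section XiSymbol.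
Variables (F E : fieldType) (iota : {rmorphism F -> E}).
Variables (k : closedFieldType) (j : {rmorphism F -> k}).
Local Notation Gamma := (gal iota).
Local Notation M := (gm_gmod iota).
Local Notation sq := (square_classes F).
Local Notation pi b := (\pi_(Quotient.quot (@gm_squares F)) b : sq).
Local Notation base z := ((fun st => gm_map iota (z st)) : Gamma * Gamma -> M).

Lemma square_class_mulF2 (c : sq) (a b : 'F_2) : c *+ ((a + b)%R : 'F_2) = c *+ a + c *+ b.
Proof.
by rewrite -mulrnDr F2_natD mulrnDr mulnC mulrnA mulr2n square_class_double addr0.
Qed.

Lemma H1_cocycle_tensor (chi : H1 (F2_gmod iota)) (c : sq) :
  H1_cocycle (H1_tensor chi c) = fun s => c *+ (H1_cocycle chi s : nat).
Proof.
rewrite /H1_tensor H1_class_trivialK //; apply/Z1P; split.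
  exact: (locally_constant_comp (fun n : 'F_2 => c *+ (n : nat))) (H1_cocycle_lc chi).
move=> s t /=; rewrite -square_class_mulF2; congr (_ *+ _).
by rewrite [in LHS](H1_cocycle_trivialD chi).
Qed.

Lemma bockstein_cocycle (chi : H1 (F2_gmod iota)) :
  let b : Gamma * Gamma -> trivial_gmod iota int :=
    fun st => ((H1_cocycle chi st.1 : nat) * (H1_cocycle chi st.2 : nat))%N%:Z in
  b \in Z2_pred (M := trivial_gmod iota int) /\ bockstein chi = H2_class b.
Proof.
pose c : Gamma -> 'F_2 := H1_cocycle chi.
have cD s t : c (s * t)%g = c s + c t := H1_cocycle_trivialD chi s t.
split.
  apply/Z2P; split.
    apply: (locally_constant_comp (f := fun st : Gamma * Gamma => (c st.1, c st.2))
             (fun p : 'F_2 * 'F_2 => ((p.1 : nat) * (p.2 : nat))%N%:Z)).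
    apply: locally_constant_op2; [apply: locally_constant_fst|apply: locally_constant_snd];
      exact: H1_cocycle_lc.
  move=> s t u /=; rewrite -!/(c _) !cD; move: (c s) (c t) (c u).
  by move=> [[|[|//]] ?] [[|[|//]] ?] [[|[|//]] ?].
rewrite /bockstein; congr H2_class; apply/funext => -[s t] /=.
rewrite -!/(c _) cD; move: (c s) (c t).
by move=> [[|[|//]] ?] [[|[|//]] ?].
Qed.

Lemma xi_rel_symbol (chi : H1 (F2_gmod iota)) (b : Gm F) :
  exists y, xi_rel j (H1_tensor chi (pi b)) y /\ br2_val y = symbol chi b.
Proof.
pose c : Gamma -> 'F_2 := H1_cocycle chi.
have cD s t : c (s * t)%g = c s + c t := H1_cocycle_trivialD chi s t.
have cc : locally_constant c := H1_cocycle_lc chi.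
have [r rE] := closed_field_sqrt (j (gm_val b)).
pose z (st : Gamma * Gamma) := b *+ ((c st.1 : nat) * (c st.2 : nat))%N.
have hz : sqrt_cochain j (H1_cocycle (H1_tensor chi (pi b))) (fun s => r ^+ (c s : nat)) z.
  rewrite H1_cocycle_tensor; split.
  - exact: (locally_constant_comp (f := c) (fun a : 'F_2 => r ^+ (a : nat))).
  - apply: (locally_constant_comp (f := fun st : Gamma * Gamma => (c st.1, c st.2))
             (fun p : 'F_2 * 'F_2 => b *+ ((p.1 : nat) * (p.2 : nat))%N)).
    by apply: locally_constant_op2; [exact: locally_constant_fst|exact: locally_constant_snd].
  - move=> s; exists (b *+ (c s : nat)); split.
      by rewrite exprAC rE gm_valMn rmorphXn.
    rewrite -/(c s); elim: (c s : nat) => [|n IH]; first by rewrite !mulr0n; exact: quot_pi0.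
    by rewrite !mulrS -IH; exact: quot_piD.
  - move=> s t; rewrite -exprD F2_natD cD exprD mulrC exprM rE.
    by rewrite gm_valMn rmorphXn.
exists (MkBr2 (sqrt_cochain_double hz)); split; first by exists (fun s => r ^+ (c s : nat)), z.
rewrite /= /symbol /cup02.
have [bZ ->] := bockstein_cocycle chi.
set bk : Gamma * Gamma -> trivial_gmod iota int := (fun _ => _) in bZ *.
(* The definition of [symbol] uses a chosen cocycle of the Bockstein class, which differs from the
   product cocycle by the coboundary of an integral cochain n; the symbol then changes by the
   coboundary of $b^n$. *)
have [n nc nE] := (H2_class_eqP (H2_cocycle_Z2 (H2_class bk)) bZ).1 (H2_cocycleK _).
have gmz (s : Gamma) (u : Gm F) (m : int) : gm_map s (gm_map iota u *~ m) = gm_map iota u *~ m :> Gm E.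
  have := raddfMz (gact (g := M) s) m (gm_map iota u : M).
  by rewrite /= gm_map_base_fixed.
have [nlc nZ] := (Z2P _).1 (H2_cocycle_Z2 (H2_class bk)).
have mZ : (fun st => gm_map iota b *~ H2_cocycle (H2_class bk) st : M) \in Z2_pred (M := M).
  apply/Z2P; split; first exact: (locally_constant_comp (fun m => gm_map iota b *~ m)) nlc.
  move=> s t u; rewrite [gact _ _]gmz -!mulrzBr -mulrzDr -mulrzBr.
  by rewrite -[RHS](mulr0z (gm_map iota b)) -(nZ s t u).
apply/esym/(H2_class_eqP mZ (sqrt_cochain_Z2 hz)).
exists (fun s => gm_map iota b *~ n s : M).
  exact: (locally_constant_comp (fun m => gm_map iota b *~ m)) nc.
move=> st; rewrite nE /coboundary1 /= gmz mulrzDr; congr (_ + _); last by rewrite mulrzDr mulrzBr.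
rewrite /bk /z -!/(c _); elim: ((c st.1 : nat) * (c st.2 : nat))%N => [|m IH].
  by rewrite mulr0n gm_map0.
by rewrite mulrS gm_mapD -IH intS mulrzDr mulr1z.
Qed.

Definition xi_spec (f : H1 (sq_gmod iota) -> Br2 iota) := zmod_morphism f /\
  forall chi (b : Gm F), br2_val (f (H1_tensor chi (pi b))) = symbol chi b.

Lemma xi_spec_exists : exists f, xi_spec f.
Proof.
have /choice[f fP] := @xi_rel_total F E iota k j.
exists f; split.
  by move=> x y; apply: (xi_rel_fun (fP _)); exact: xi_relB.
move=> chi b; have [y [yP <-]] := xi_rel_symbol chi b.
by rewrite (xi_rel_fun (fP _) yP).
Qed.

(** Square classes are killed by 2, so using each generator at most once already gives the whole
    subgroup. *)
Fixpoint sq_span (bs : seq sq) (v : sq) : Prop :=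
  if bs is b :: bs' then sq_span bs' v \/ sq_span bs' (v - b) else v = 0.

Lemma sq_span0 bs : sq_span bs 0.
Proof. by elim: bs => [//|b bs IH] /=; left. Qed.

Lemma sq_spanB bs u v : sq_span bs u -> sq_span bs v -> sq_span bs (u - v).
Proof.
elim: bs u v => [|b bs IH] u v /=; first by move=> -> ->; rewrite subrr.
have bN : - b = b by apply/esym/eqP; rewrite -addr_eq0 square_class_double.
move=> [uS|uS] [vS|vS].
- by left; exact: IH.
- by right; have := IH _ _ uS vS; rewrite opprB addrA addrAC -{1}bN.
- by right; have := IH _ _ uS vS; rewrite addrAC.
- by left; have := IH _ _ uS vS; rewrite opprB addrA subrK.
Qed.

Lemma sq_spanD bs u v : sq_span bs u -> sq_span bs v -> sq_span bs (u + v).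
Proof.
move=> uS vS; rewrite -[v]opprK; apply: sq_spanB => //; rewrite -sub0r.
by apply: sq_spanB => //; exact: sq_span0.
Qed.

Lemma mem_sq_span bs v : v \in bs -> sq_span bs v.
Proof.
elim: bs => [//|b bs IH]; rewrite inE => /orP[/eqP ->|vbs] /=; last by left; exact: IH.
by right; rewrite subrr; exact: sq_span0.
Qed.

(** This pins down the homomorphism selected by [xi]. Subtracting one class $\chi\otimes b$ pushes
    the values of x into the span of the remaining generators. *)
Lemma xi_rel_spec f bs (x : H1 (sq_gmod iota)) : xi_spec f ->
  (forall s, sq_span bs (H1_cocycle x s)) -> xi_rel j x (f x).
Proof.
move=> [fB fsym]; have f0 : f 0 = 0 by have := fB x x; rewrite !subrr.
elim: bs x => [|b bs IH] x xS.
  have -> : x = 0.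
    rewrite -(subrr x); apply: H1_cocycle_trivial_eq; apply/funext => s.
    by rewrite H1_cocycle_trivialB funBE subrr; exact: xS.
  have [y yP] := xi_rel_total j x.
  by rewrite f0; have := xi_relB yP yP; rewrite !subrr.
pose c := H1_cocycle x.
(* The span of [bs] has index at most 2 in the span of [b :: bs], so membership of [c s] in it
   defines a character. *)
pose chi0 s : 'F_2 := if `[< sq_span bs (c s) >] then 0 else 1.
have cD s t : c (s * t)%g = c s + c t := H1_cocycle_trivialD x s t.
have chiZ : chi0 \in Z1_pred (M := F2_gmod iota).
  apply/Z1P; split.
    exact: (locally_constant_comp (f := c)
      (fun v => if `[< sq_span bs v >] then 0 else 1 : 'F_2)) (H1_cocycle_lc x).
  move=> s t /=; rewrite /chi0 cD.
  case: asboolP => stS; case: asboolP => sS; case: asboolP => tS //; try by apply: val_inj.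
  - by case: tS; have := sq_spanB stS sS; rewrite addrC addKr.
  - by case: sS; have := sq_spanB stS tS; rewrite addrK.
  - by case: stS; exact: sq_spanD.
  - case: (xS s) => // sS'; case: (xS t) => // tS'; case: stS.
    have := sq_spanD sS' tS'; rewrite addrACA -opprD square_class_double oppr0 addr0.
    by [].
pose chi : H1 (F2_gmod iota) := H1_class (M := F2_gmod iota) chi0.
have chiE : H1_cocycle chi = chi0 by exact: H1_class_trivialK.
have [b' bE] : exists b', b = pi b' by exists (repr b); rewrite reprK.
pose y := H1_tensor chi b.
have yS s : sq_span bs (H1_cocycle (x - y) s).
  rewrite H1_cocycle_trivialB funBE H1_cocycle_tensor chiE /chi0 -/c.
  case: asboolP => [cS|cS]; first by rewrite mulr0n subr0.
  by have [//|] := xS s; rewrite mulr1n.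
have h1 := IH _ yS.
have h2 : xi_rel j (0 - y) (f (0 - y)).
  have [w [wP wE]] := xi_rel_symbol chi b'.
  have -> : f (0 - y) = 0 - w.
    rewrite fB f0; congr (_ - _).
    by apply: val_inj; rewrite /= wE /y bE fsym.
  by have := xi_relB (xi_relB wP wP) wP; rewrite !subrr -bE.
have := xi_relB h1 h2; rewrite -fB sub0r opprK subrK.
by [].
Qed.

Lemma xi_relP (x : H1 (sq_gmod iota)) (L : seq sq) :
  (forall s, H1_cocycle x s \in L) -> xi_rel j x (xi x).
Proof.
move=> xL; apply: (@xi_rel_spec _ L); last by move=> s; exact: mem_sq_span.
exact: xgetPex xi_spec_exists.
Qed.

End XiSymbol.

(** * The Hasse-Witt and Stiefel-Whitney classes *)

Section IsometryOperations.
Variables (K : fieldType) (V W U : lmodType K).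
Variables (q : V -> K) (r : W -> K) (p : U -> K).

Lemma qf_isometry_comp (g : W -> U) (h : V -> W) :
  qf_isometry r p g -> qf_isometry q r h -> qf_isometry q p (g \o h).
Proof.
move=> [gl gb gq] [hl hb hq]; split=> /=.
- by move=> a x y /=; rewrite hl gl.
- exact: bij_comp.
- by move=> x; rewrite gq hq.
Qed.

Lemma qf_isometry_inv (g : V -> W) : qf_isometry q r g ->
  exists h, [/\ qf_isometry r q h, cancel g h & cancel h g].
Proof.
move=> [gl [h gh hg] gq]; exists h; split=> //; split; last by move=> x; rewrite -{2}(hg x) gq.
  by move=> a x y; apply: (can_inj gh); rewrite gl !hg.
by exists g.
Qed.

End IsometryOperations.

Section GaloisConjugation.
Variables (F E : fieldType) (iota : {rmorphism F -> E}).
Local Notation Gamma := (gal iota).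
Variables (V : lmodType F) (Q : V -> F).
Hypothesis Q_quad : quadratic_form Q.
Local Notation QE := (ext_form (iota := iota) Q).
Local Notation VE := (tensor iota V).

Lemma tensor_gal_lin (s : Gamma) (u : V -> V) (x : VE) : linear u ->
  tensor_gal s (tensor_lin u x) = tensor_lin u (tensor_gal s x).
Proof.
move=> ul; have tl := tensor_lin_linear (j := iota) ul.
elim/tensor_ind: x => [a v|x y Hx Hy].
  by rewrite tensor_lin_tens // !tensor_gal_tens tensor_lin_tens.
by rewrite (linD tl) !tensor_galD (linD tl) Hx Hy.
Qed.

Lemma gal_conj_comp (V1 V2 V3 : lmodType F) (s : Gamma)
    (g : tensor iota V2 -> tensor iota V3) (h : tensor iota V1 -> tensor iota V2) x :
  gal_conj s g (gal_conj s h x) = gal_conj s (g \o h) x.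
Proof. by rewrite /gal_conj /= tensor_galK. Qed.

Let gal_lin (s : Gamma) (a : E) (x y : VE) :
  tensor_gal s (a *: x + y) = s a *: tensor_gal s x + tensor_gal s y.
Proof. exact: tensor_gal_semilinear. Qed.

Let gal_q (s : Gamma) (x : VE) : QE (tensor_gal s x) = s (QE x).
Proof. exact: ext_form_gal. Qed.

Lemma cliff_galM (s : Gamma) x y : cliff_gal s (x * y) = cliff_gal s x * cliff_gal s y :> clifford QE.
Proof. exact: (cliff_mapM (gal_lin s) (gal_q s)). Qed.
Lemma cliff_galD (s : Gamma) x y : cliff_gal s (x + y) = cliff_gal s x + cliff_gal s y :> clifford QE.
Proof. exact: (cliff_mapD (gal_lin s) (gal_q s)). Qed.
Lemma cliff_gal_scal (s : Gamma) a : cliff_gal s (cliff_scal QE a) = cliff_scal QE (s a).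
Proof. exact: (cliff_map_scal (gal_lin s) (gal_q s)). Qed.
Lemma cliff_gal_vec (s : Gamma) v : cliff_gal s (cliff_vec QE v) = cliff_vec QE (tensor_gal s v).
Proof. exact: (cliff_map_vec (gal_lin s) (gal_q s)). Qed.
Lemma cliff_gal1 (s : Gamma) : cliff_gal s 1 = 1 :> clifford QE.
Proof. exact: (cliff_map1 (gal_lin s) (gal_q s)). Qed.

Lemma cliff_gal_comp (s t : Gamma) (x : clifford QE) :
  cliff_gal s (cliff_gal t x) = cliff_gal (s * t)%g x.
Proof.
elim/cliff_ind: x => [v|a|x y Hx Hy|x y Hx Hy].
- by rewrite !cliff_gal_vec tensor_galM.
- by rewrite !cliff_gal_scal.
- by rewrite !cliff_galD Hx Hy.
- by rewrite !cliff_galM Hx Hy.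
Qed.

Lemma cliff_gal_locally_constant (x : clifford QE) :
  locally_constant (fun s : Gamma => cliff_gal s x).
Proof.
elim/cliff_ind: x => [v|a|x y Hx Hy|x y Hx Hy].
- have := locally_constant_comp (cliff_vec QE) (tensor_gal_locally_constant v).
  by congr locally_constant; apply/funext => s; rewrite /= cliff_gal_vec.
- move=> s; apply: filterS (gal_nbhs s [:: a]) => t /= ts.
  by rewrite !cliff_gal_scal ts ?mem_head.
- have := locally_constant_op2 +%R Hx Hy.
  by congr locally_constant; apply/funext => s; rewrite cliff_galD.
- have := locally_constant_op2 *%R Hx Hy.
  by congr locally_constant; apply/funext => s; rewrite cliff_galM.
Qed.

Lemma gal_conj_lift (s : Gamma) d (x : clifford QE) (g : VE -> VE) : linear g ->
  homog_lift d x g -> homog_lift d (cliff_gal s x) (gal_conj s g).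
Proof.
move=> gl; apply: (cliff_map_lift (gal_lin s) (gal_q s)).
- move=> P PZ _ v; have := PZ 1 (tensor_gal (s^-1)%g v).
  by rewrite scale1r tensor_galKV.
- by move=> a x' y; rewrite /gal_conj /= tensor_gal_semilinear gl tensor_gal_semilinear gal_invKV.
- by move=> w; rewrite /gal_conj /= tensor_galK.
Qed.

End GaloisConjugation.

Section BaseChange.
Variables (F L : fieldType) (j : {rmorphism F -> L}) (V : lmodType F) (Q : V -> F).
Hypothesis Q_quad : quadratic_form Q.
Local Notation QL := (ext_form (iota := j) Q).

Definition cliff_base : clifford Q -> clifford QL := cliff_map QL j (tens j 1).

Let bl a (v w : V) : tens j 1 (a *: v + w) = j a *: tens j 1 v + tens j 1 w.
Proof. exact: tens1_semilinear. Qed.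
Let bq (v : V) : QL (tens j 1 v) = j (Q v).
Proof. exact: ext_form1. Qed.

Lemma cliff_baseM x y : cliff_base (x * y) = cliff_base x * cliff_base y.
Proof. exact: (cliff_mapM bl bq). Qed.
Lemma cliff_base_scal a : cliff_base (cliff_scal Q a) = cliff_scal QL (j a).
Proof. exact: (cliff_map_scal bl bq). Qed.
Lemma cliff_base_norm x b : cliff_norm_is x b -> cliff_norm_is (cliff_base x) (gm_map j b).
Proof. exact: (cliff_map_norm bl bq). Qed.

Lemma cliff_base_lift d x (g : orthogonal_group Q) :
  homog_lift d x g -> homog_lift d (cliff_base x) (tensor_lin g).
Proof.
apply: (cliff_map_lift bl bq).
- exact: tensor_scalar_span.
- by apply: tensor_lin_linear; exact: orth_linear.
- by move=> v; rewrite tensor_lin_tens //; exact: orth_linear.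
Qed.

End BaseChange.

Lemma cliff_gal_base (F E : fieldType) (iota : {rmorphism F -> E}) (V : lmodType F)
    (Q : V -> F) (Q_quad : quadratic_form Q) (s : gal iota) (x : clifford Q) :
  cliff_gal s (cliff_base iota x) = cliff_base iota x.
Proof.
have bl := tens1_semilinear iota (V := V); have bq := ext_form1 iota Q_quad.
elim/cliff_ind: x => [v|a|x y Hx Hy|x y Hx Hy].
- by rewrite /cliff_base (cliff_map_vec bl bq) cliff_gal_vec // tensor_gal_tens rmorph1.
- by rewrite /cliff_base (cliff_map_scal bl bq) cliff_gal_scal // gal_fix.
- by rewrite /cliff_base (cliff_mapD bl bq) cliff_galD // Hx Hy.
- by rewrite /cliff_base (cliff_mapM bl bq) cliff_galM // Hx Hy.
Qed.

Section DegreeAndNorm.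
Variables (K : fieldType) (W : lmodType K) (q : W -> K).
Hypothesis q_quad : quadratic_form q.
Variables (n : nat) (e e' : nat -> W).
Hypothesis ee' : dual_bases q n e e'.

Lemma isometry_surj (g : W -> W) : qf_isometry q q g -> forall w, exists w', g w' = w.
Proof. by move=> [_ [h _ gh] _] w; exists (h w). Qed.

Lemma clifford_lift_isometry x g : qf_isometry q q g ->
  clifford_lift x g <-> exists d, homog_lift d (x : clifford q) g.
Proof. by move=> /isometry_surj; exact: (clifford_liftP q_quad ee'). Qed.

Lemma orth_degE d x g : qf_isometry q q g -> homog_lift d (x : clifford q) g ->
  orth_deg q g = if d then 1 else 0.
Proof.
move=> gi xg; rewrite /orth_deg; case: d xg => xg.
  case: asboolP => // -[]; exists x; last by have [] := xg.
  by apply/clifford_lift_isometry => //; exists true.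
case: asboolP => // -[x' /(clifford_lift_isometry _ gi)[d x'g] x'1].
have [dF _] := homog_lift_unique q_quad ee' xg x'g; rewrite -dF in x'g.
have [x'0 [y [_ yx']] _] := x'g.
by have := cliff_homog_inj q_quad ee' x'0 x'1 yx'.
Qed.

Lemma cliff_norm_inj x b b' : cliff_norm_is (x : clifford q) b -> cliff_norm_is x b' -> b = b'.
Proof.
move=> h h'; apply: val_inj; apply: (cliff_scal_inj q_quad ee').
by rewrite -[LHS]h -[RHS]h'.
Qed.

Lemma cliff_normM x y b c : cliff_norm_is (x : clifford q) b -> cliff_norm_is y c ->
  cliff_norm_is (x * y) (b + c).
Proof.
rewrite /cliff_norm_is => xb yc; rewrite cliff_trM -mulrA [cliff_tr x * _]mulrA xb.
by rewrite cliff_scalC_ring mulrA yc -cliff_scalME gm_valD mulrC.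
Qed.

Lemma cliff_norm_scal (a : Gm K) : cliff_norm_is (cliff_scal q (gm_val a)) (a *+ 2).
Proof. by rewrite /cliff_norm_is cliff_tr_scal -cliff_scalME mulr2n. Qed.

Lemma spinor_normE d x b (g : orthogonal_group q) :
  homog_lift d (x : clifford q) g -> cliff_norm_is x b ->
  spinor_norm g = \pi_(Quotient.quot (@gm_squares K)) b.
Proof.
move=> xg xb; rewrite /spinor_norm; have gi := orth_isometry g.
apply: xget_unique; first by exists x, b; split=> //; apply/clifford_lift_isometry => //; exists d.
move=> _ [x' [b' [/(clifford_lift_isometry _ gi)[d' x'g] x'b' ->]]].
have [_ [a x'E]] := homog_lift_unique q_quad ee' xg x'g.
apply/square_class_eq; exists a; rewrite addrC; apply: (cliff_norm_inj x'b').
by rewrite x'E; apply: cliff_normM => //; exact: cliff_norm_scal.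
Qed.

End DegreeAndNorm.

(** * The Hasse-Witt invariant of the twist *)

Section HasseWittClass.
Variables (F E : fieldType) (iota : {rmorphism F -> E}).
Hypothesis iota_sep : separable_closure iota.
Local Notation Gamma := (gal iota).
Variables (V : lmodType F) (Q : V -> F).
Hypothesis Q_quad : quadratic_form Q.
Local Notation QE := (ext_form (iota := iota) Q).
Local Notation VE := (tensor iota V).
Local Notation M := (gm_gmod iota).
Variable phi : gal iota -> orthogonal_group Q.
Hypothesis phi_morph : {morph phi : s t / (s * t)%g}.
Hypothesis phi_open : open [set s : gal iota | phi s = 1%g].
Local Notation phiE s := (tensor_lin (iota := iota) (phi s)).

(** The isometry u selected by [HW_inv] is unknown; its inverse composed with the descent isometry
    is an element of $O(Q)(E)$ that relates its cocycle to [phi]. So the class contains [phi], and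
    all its members are cohomologous to [phi]. *)
Lemma HW_inv_twist (X := HW_inv (iota := iota) Q (twist_form phi)) :
  [/\ X (fun s => phiE s),
      forall c, X c -> forall s, qf_isometry QE QE (c s) &
      forall c, X c -> exists2 g, qf_isometry QE QE g &
        forall s x, g (c s x) = phiE s (gal_conj s g x)].
Proof.
rewrite {}/X /HW_inv; set P := [set _ | _].
have [u0 u0i u0c] := descent_isometry iota_sep Q_quad phi_morph phi_open.
have [u [c [ui uc ->]]] : P (xget set0 P).
  apply: xgetPex; exists (H1_orth_class (iota := iota) Q (fun s => phiE s)).
  by exists u0, (fun s => phiE s); split.
have [v [vi uK vK]] := qf_isometry_inv ui.
have gi : qf_isometry QE QE (v \o u0) := qf_isometry_comp vi u0i.
have [h [hi gK hK]] := qf_isometry_inv gi.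
have phic s x : (v \o u0) (phiE s x) = c s (gal_conj s (v \o u0) x).
  apply: (can_inj uK); rewrite /= vK.
  have -> : u0 (phiE s x) = gal_conj s u0 x by rewrite -u0c.
  have -> : u (c s (gal_conj s (v \o u0) x)) = gal_conj s u (gal_conj s (v \o u0) x).
    by rewrite -uc.
  rewrite gal_conj_comp; congr (gal_conj s _ x); apply/funext => y /=.
  by rewrite vK.
split.
- split; last by exists (v \o u0) => // s; apply/funext => x; exact: phic.
  split.
  + apply: (locally_constant_comp (f := phi)
      (fun g : orthogonal_group Q => tensor_lin (iota := iota) g)).
    exact: (phi_locally_constant phi_morph phi_open).
  + by move=> s; exact: tensor_lin_isometry.
  + move=> s t; apply/funext => x; rewrite /gal_conj /= phi_morph tensor_linM.
    by rewrite tensor_gal_lin ?tensor_galKV //; exact: orth_linear.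
- by move=> c' [[_ ci _] _].
- move=> c' [_ [g1 g1i g1c]]; exists (h \o g1); first exact: qf_isometry_comp hi g1i.
  move=> s x; apply: (can_inj gK); rewrite [RHS]phic /= gal_conj_comp.
  have -> : v (u0 (h (g1 (c' s x)))) = g1 (c' s x) by exact: hK.
  have -> : (v \o u0) \o (h \o g1) = g1 by apply/funext => y; exact: hK.
  by have := congr1 (fun f => f x) (g1c s).
Qed.

Variables (n : nat) (e e' : nat -> V).
Hypothesis ee' : dual_bases Q n e e'.
Let QE_quad : quadratic_form QE := ext_form_quad iota Q_quad.
Let EE := ext_dual_bases iota Q_quad ee'.

Variables (d : orthogonal_group Q -> bool) (x : orthogonal_group Q -> clifford Q).
Hypothesis x_lift : forall g, homog_lift (d g) (x g) g.
Variable zeta : orthogonal_group Q * orthogonal_group Q -> Gm F.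
Hypothesis x_mul : forall g h,
  x g * x h = cliff_scal Q (gm_val (zeta (g, h))) * x (g * h)%g.

Let xE g : clifford QE := cliff_base iota (x g).
Let xE_lift g : homog_lift (d g) (xE g) (tensor_lin g).
Proof. exact: cliff_base_lift. Qed.

(* A cocycle cohomologous to phi via g lifts to w^-1 x(phi s) s(w), for w a lift of g. *)
Let conj_lift c g dg (w w' : clifford QE) (s : Gamma) :
  qf_isometry QE QE g -> homog_lift dg w g -> w * w' = 1 ->
  (forall s x, g (c s x) = phiE s (gal_conj s g x)) ->
  homog_lift (d (phi s)) (w' * xE (phi s) * cliff_gal s w) (c s).
Proof.
move=> gi wg ww' gc; have [h [hi gK hK]] := qf_isometry_inv gi; have [gl _ _] := gi.
have w'h := homog_liftV QE_quad EE wg ww' hK.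
have := homog_liftM (homog_liftM w'h (xE_lift (phi s))) (gal_conj_lift Q_quad s gl wg).
rewrite addbC addbA addbb addFb.
by congr homog_lift; apply/funext => v /=; rewrite -gc gK.
Qed.

(** The degrees of $w^{-1}$ and $s(w)$ cancel, so all cocycles in the class have the same degree
    function, not merely cohomologous ones. *)
Lemma deg_star_twist :
  deg_star Q (HW_inv (iota := iota) Q (twist_form phi)) =
  H1_class (M := F2_gmod iota) (fun s => if d (phi s) then 1 else 0).
Proof.
have [Xphi Xi Xc] := HW_inv_twist; rewrite /deg_star.
have degc c : HW_inv (iota := iota) Q (twist_form phi) c ->
    (fun s => orth_deg QE (c s)) = (fun s => if d (phi s) then 1 else 0).
  move=> cX; apply/funext => s; have [g gi gc] := Xc c cX.
  have [dg [w wg]] := homog_lift_exists QE_quad EE gi.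
  have [_ [w' [ww' _]] _] := wg.
  by rewrite (orth_degE QE_quad EE (Xi c cX s) (conj_lift s gi wg ww' gc)).
apply: xget_unique; first by exists (fun s => phiE s) => //; rewrite degc.
by move=> y [c cX ->]; rewrite degc.
Qed.

Let base st : M := gm_map iota (zeta (phi st.1, phi st.2)).

(** The choice in [connecting] allows any cocycle c of the class and any lift u of it. Such a u
    differs by scalars a(s) from $w^{-1}x(\varphi(s))s(w)$, whose 2-cocycle is exactly that of x, so
    the two cocycles differ by the coboundary of a. *)
Lemma connecting_twist (y : Br2 iota) : base \in Z2_pred (M := M) ->
  br2_val y = H2_class base ->
  connecting Q (HW_inv (iota := iota) Q (twist_form phi)) = y.
Proof.
move=> bZ yE; have [Xphi Xi Xc] := HW_inv_twist; rewrite /connecting.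
have phi_lc := phi_locally_constant phi_morph phi_open.
have xE_mul g h : xE g * xE h = cliff_scal QE (iota (gm_val (zeta (g, h)))) * xE (g * h)%g.
  by rewrite /xE -cliff_baseM // x_mul cliff_baseM // cliff_base_scal.
have xE_lc : locally_constant (xE \o phi) := locally_constant_comp xE phi_lc.
apply: xget_unique.
  exists (fun s => phiE s), (xE \o phi), (MkZ2 bZ); split=> //.
  - move=> s; apply/(clifford_lift_isometry QE_quad EE); last by exists (d (phi s)).
    exact: tensor_lin_isometry.
  - by move=> s t; rewrite /= /xE cliff_gal_base // -/(xE _) -/(xE _) xE_mul phi_morph.
move=> y' [c [u [z [cX uc ulift umul y'E]]]]; apply: val_inj => /=.
rewrite [LHS]y'E [RHS]yE; have [g gi gc] := Xc c cX.
have [dg [w wg]] := homog_lift_exists QE_quad EE gi.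
have [_ [w' [ww' w'w]] _] := wg.
pose u1 s := w' * xE (phi s) * cliff_gal s w.
have u1_lift s : homog_lift (d (phi s)) (u1 s) (c s) := conj_lift s gi wg ww' gc.
have /choice[a aE] s : exists a : Gm E, u s = cliff_scal QE (gm_val a) * u1 s.
  have [du us] := (clifford_lift_isometry QE_quad EE _ (Xi c cX s)).1 (ulift s).
  by have [_] := homog_lift_unique QE_quad EE (u1_lift s) us.
have scal_u1 s b b' : cliff_scal QE b * u1 s = cliff_scal QE b' * u1 s -> b = b'.
  have [_ [v [u1v _]] _] := u1_lift s.
  move=> /(congr1 (fun p => p * v)); rewrite /= -[_ b * _ * v]mulrA -[_ b' * _ * v]mulrA u1v !mulr1.
  exact: (cliff_scal_inj QE_quad EE).
have u1_lc : locally_constant u1.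
  apply: locally_constant_op2; last exact: cliff_gal_locally_constant.
  exact: (locally_constant_comp (fun p => w' * p)) xE_lc.
have a_lc : locally_constant a.
  move=> s; near=> t; apply: val_inj; apply: (scal_u1 s).
  have u1ts : u1 t = u1 s by near: t; exact: u1_lc.
  rewrite -[in LHS]u1ts -!aE; near: t; exact: uc.
(* The factors $s(w)$ and $s(w^{-1})$ cancel, and the lifts coming from F are Galois invariant. *)
have u1_mul s t : u1 s * cliff_gal s (u1 t) =
    cliff_scal QE (gm_val (base (s, t))) * u1 (s * t)%g.
  rewrite /u1 !cliff_galM // cliff_gal_comp // [cliff_gal s (xE _)]cliff_gal_base //.
  rewrite -!mulrA (mulrA (cliff_gal s w)) -cliff_galM // ww' cliff_gal1 // mul1r.
  by rewrite (mulrA (xE _)) xE_mul -phi_morph -!mulrA mulrA -cliff_scalC_ring -!mulrA.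
move: u1 u1_lift u1_mul scal_u1 u1_lc aE => u1 _ u1_mul scal_u1 _ aE.
apply/(H2_class_eqP (valP z) bZ); exists a => // -[s t].
apply: val_inj; rewrite /coboundary1.
have := umul s t; rewrite !aE cliff_galM // cliff_gal_scal // -mulrA (mulrA (u1 s)).
rewrite -cliff_scalC_ring -mulrA u1_mul !mulrA -!cliff_scalME => /scal_u1 zE.
apply: (mulIf (gm_neq0 (a (s * t)%g))); rewrite [LHS]/= -zE /=.
by field; exact: gm_neq0.
Unshelve. all: by end_near. Qed.

End HasseWittClass.

Section CohomologyMaps.
Variables (F E : fieldType) (iota : {rmorphism F -> E}).
Local Notation Gamma := (gal iota).

Lemma H2_class0 (M : gmod iota) : H2_class (fun _ : Gamma * Gamma => 0 : M) = 0.
Proof.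
have Z0 : (0 : Gamma * Gamma -> M) \in Z2_pred (M := M) by exact: rpred0.
by have := H2_classB Z0 Z0; rewrite !subrr.
Qed.

Lemma H2_map_class (M N : gmod iota) (f : M -> N) (z : Gamma * Gamma -> M) :
  (forall x y, f (x + y) = f x + f y) -> (forall s x, f (gact s x) = gact s (f x)) ->
  z \in Z2_pred (M := M) ->
  f \o z \in Z2_pred (M := N) /\ H2_map f (H2_class z) = H2_class (f \o z).
Proof.
move=> fD fs zZ.
have f0 : f 0 = 0 by apply: (addrI (f 0)); rewrite -fD !addr0.
have fN x : f (- x) = - f x by apply/eqP; rewrite -addr_eq0 -fD addNr f0.
have fZ y : y \in Z2_pred (M := M) -> f \o y \in Z2_pred (M := N).
  move=> /Z2P[yc yZ]; apply/Z2P; split; first exact: locally_constant_comp.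
  by move=> s t u; rewrite /= -fs -!fN -!fD yZ f0.
split; first exact: fZ.
have hZ := H2_cocycle_Z2 (H2_class z).
apply/(H2_class_eqP (fZ _ hZ) (fZ _ zZ)).
have [b bc bE] := (H2_class_eqP hZ zZ).1 (H2_cocycleK _).
exists (f \o b); first exact: locally_constant_comp.
by move=> st; rewrite /= bE /coboundary1 /= -fs -fN -!fD.
Qed.

End CohomologyMaps.

Lemma gm_val_inj (K : fieldType) : injective (@gm_val K).
Proof. exact: val_inj. Qed.

Section Signs.
Variable K : fieldType.

Lemma gm_signD (a b : 'F_2) : gm_sign K (a + b) = gm_sign K a + gm_sign K b.
Proof.
apply: val_inj => /=; move: a b => [[|[|//]] ?] [[|[|//]] ?] /=.
all: by rewrite ?expr0 ?expr1 ?mulr1 ?mul1r ?mulrNN ?mulr1.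
Qed.

Lemma gm_map_sign (L : fieldType) (f : {rmorphism K -> L}) (a : 'F_2) :
  gm_map f (gm_sign K a) = gm_sign L a.
Proof. by apply: val_inj; rewrite /= rmorphXn rmorphN1. Qed.

Lemma gm_sign_inj : (-1 : K) != 1 -> injective (gm_sign K).
Proof.
move=> N1 a b /(congr1 (@gm_val K)) /=; move: a b.
move=> [[|[|//]] ha] [[|[|//]] hb] //= /eqP; rewrite ?expr0 ?expr1.
all: try by move=> _; exact: val_inj.
- by rewrite eq_sym (negPf N1).
- by rewrite (negPf N1).
Qed.

Lemma gm_square_sign (a : Gm K) : a *+ 2 = 0 -> exists n, a = gm_sign K n.
Proof.
move=> /(congr1 (@gm_val K)); rewrite gm_valMn => /eqP; rewrite sqrf_eq1.
by move=> /orP[/eqP a1|/eqP a1]; [exists 0|exists 1]; apply: val_inj; rewrite /= a1 ?expr1.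
Qed.

End Signs.

(** * The second Stiefel-Whitney class from lifts of norm 1 *)

Section StiefelWhitneyClass.
Variables (F E : fieldType) (iota : {rmorphism F -> E}).
Variables (k : closedFieldType) (j : {rmorphism F -> k}).
Variables (V : lmodType F) (Q : V -> F).
Hypothesis Q_quad : quadratic_form Q.
Variables (n : nat) (e e' : nat -> V).
Hypothesis ee' : dual_bases Q n e e'.
Variable phi : gal iota -> orthogonal_group Q.
Hypothesis phi_morph : {morph phi : s t / (s * t)%g}.
Hypothesis phi_lc : locally_constant phi.
Local Notation Gamma := (gal iota).
Local Notation Qk := (ext_form (iota := j) Q).
Local Notation M := (gm_gmod iota).

Variables (d : orthogonal_group Q -> bool) (y : orthogonal_group Q -> clifford Qk).
Hypothesis y_lift : forall g, homog_lift (d g) (y g) (tensor_lin g).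
Hypothesis y_norm : forall g, cliff_tr (y g) * y g = 1.
Variable nu : orthogonal_group Q * orthogonal_group Q -> 'F_2.
Hypothesis y_mul : forall g h,
  y g * y h = cliff_scal Qk (gm_val (gm_sign k (nu (g, h)))) * y (g * h)%g.

Let Qk_quad : quadratic_form Qk := ext_form_quad j Q_quad.
Let Ek := ext_dual_bases j Q_quad ee'.
Let sgn (st : Gamma * Gamma) : M := gm_sign E (nu (phi st.1, phi st.2)).
Let zn (st : Gamma * Gamma) : F2_gmod iota := nu (phi st.1, phi st.2).

Let scal_cancel g a b : cliff_scal Qk a * y g = cliff_scal Qk b * y g -> a = b.
Proof.
have [_ [v [yv _]] _] := y_lift g => /(congr1 (fun p => p * v)).
by rewrite -!mulrA yv !mulr1; exact: (cliff_scal_inj Qk_quad Ek).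
Qed.

Let zn_lc : locally_constant zn.
Proof.
apply: (locally_constant_comp (f := fun st : Gamma * Gamma => (phi st.1, phi st.2)) nu).
by apply: locally_constant_op2; [exact: locally_constant_fst|exact: locally_constant_snd].
Qed.

Let zn_Z2 : (-1 : k) != 1 -> zn \in Z2_pred (M := F2_gmod iota).
Proof.
move=> N1; apply/Z2P; split; first exact: zn_lc.
move=> s t u; rewrite /zn /= phi_morph phi_morph; move: (phi s) (phi t) (phi u) => f g h.
have nuE : gm_sign k (nu (g, h) + nu (f, (g * h)%g)) = gm_sign k (nu (f, g) + nu ((f * g)%g, h)).
  apply: gm_val_inj; apply: (@scal_cancel (f * g * h)%g).
  rewrite !gm_signD !gm_valD !cliff_scalME -!mulrA -{1}mulgA -!y_mul.
  by rewrite mulrA cliff_scalC_ring -mulrA -y_mul !mulrA -y_mul.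
have /eqP := gm_sign_inj N1 nuE; rewrite -subr_eq0 => /eqP <-.
by rewrite opprD addrA addrAC; congr (_ + _); rewrite addrAC.
Qed.

Lemma SW2_class : sgn \in Z2_pred (M := M) /\
  br2_val (sign_Br2 (SW2 j phi)) = H2_class sgn.
Proof.
(* In characteristic 2 all signs are 1 in E, in agreement with the value 0 of [SW2]. Otherwise a
   sign in k determines its exponent in $\mathbb F_2$, so identities between lifts give identities
   for [zn]. *)
rewrite /SW2; case: ifPn => [F2|F2].
  have sgn0 a : gm_sign E a = 0.
    apply: val_inj; rewrite /=; suff -> : (-1 : E) = 1 by rewrite expr1n.
    move: F2 => /andP[_ /eqP F2]; apply/eqP; rewrite eq_sym -subr_eq0 opprK.
    by have := congr1 iota F2; rewrite rmorph_nat rmorph0 mulr2n => ->.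
  have -> : sgn = fun=> 0 by apply/funext => st; exact: sgn0.
  split; first exact: (rpred0 (Z2_pred (M := M))).
  by rewrite /= /H2_map; congr H2_class; apply/funext => st; exact: sgn0.
have N1 : (-1 : k) != 1.
  apply: contraNneq F2 => N1; apply/andP; split=> //; rewrite -(fmorph_eq0 j) rmorph_nat.
  by rewrite mulr2n -{1}N1 addNr.
have signs : (forall a b : 'F_2, gm_sign E (a + b) = gm_sign E a + gm_sign E b)
  /\ forall (s : Gamma) (a : 'F_2), gm_sign E a = gm_map s (gm_sign E a).
  by split=> [|s a]; [exact: gm_signD|rewrite gm_map_sign].
have [sZ sE] := @H2_map_class _ _ _ (F2_gmod iota) M (gm_sign E) zn signs.1 signs.2 (zn_Z2 N1).
split; first exact: sZ.
rewrite -[RHS]sE /=; congr H2_map; apply: xget_unique.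
  exists (y \o phi), (MkZ2 (zn_Z2 N1)); split=> //.
  - exact: locally_constant_comp.
  - move=> s; split; last exact: y_norm.
    apply: (clifford_lift_isometry Qk_quad Ek _ (tensor_lin_isometry j Q_quad (phi s))).2.
    by exists (d (phi s)); exact: y_lift.
  - by move=> s t; rewrite /= y_mul phi_morph.
move=> _ [x [z [x_lc x_lift x_mul ->]]].
(* Two lifts of norm 1 differ by a scalar of square 1, that is, by a sign. *)
have /choice[m mE] s : exists m, x s = cliff_scal Qk (gm_val (gm_sign k m)) * y (phi s).
  have [xs xn] := x_lift s.
  have [dx xl] := (clifford_lift_isometry Qk_quad Ek _ (tensor_lin_isometry j Q_quad (phi s))).1 xs.
  have [_ [a aE]] := homog_lift_unique Qk_quad Ek (y_lift (phi s)) xl.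
  have [b bE] : exists b, a = gm_sign k b.
    apply: gm_square_sign.
    have y1 : cliff_norm_is (y (phi s)) 0 by exact: y_norm.
    have := cliff_normM (cliff_norm_scal Qk a) y1; rewrite -aE addr0.
    by move/(cliff_norm_inj Qk_quad Ek); apply.
  by exists b; rewrite aE bE.
apply/(H2_class_eqP (valP z) (zn_Z2 N1)).
exists m.
  move=> s; near=> t; apply: (gm_sign_inj N1); apply: gm_val_inj.
  apply: (@scal_cancel (phi s)); rewrite -mE.
  have <- : phi t = phi s by near: t; exact: phi_lc.
  by rewrite -mE; near: t; exact: x_lc.
move=> [s t]; have mz : m s + m t + zn (s, t) = z (s, t) + m (s * t)%g.
  apply: (gm_sign_inj N1); apply: gm_val_inj; apply: (@scal_cancel (phi (s * t)%g)).
  have := x_mul s t; rewrite !mE mulrA -[_ * y (phi s) * _]mulrA -cliff_scalC_ring.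
  rewrite mulrA -[_ * y (phi s) * _]mulrA y_mul -phi_morph !mulrA -!cliff_scalME.
  by rewrite !gm_signD !gm_valD.
rewrite -[LHS](addrK (m (s * t)%g)) -mz /coboundary1 /=.
by rewrite [RHS]addrC -addrA [_ + m s]addrC -!addrA; congr (_ + (_ + _)); rewrite addrC.
Unshelve. all: by end_near. Qed.

End StiefelWhitneyClass.

Theorem propositionG2 (F E : fieldType) (iota : {rmorphism F -> E})
    (iota_sep : separable_closure iota)
    (k : closedFieldType) (j : {rmorphism F -> k})
    (V : vectType F) (Q : V -> F)
    (Q_quadratic : quadratic_form Q) (Q_nondeg : nondegenerate_qf Q)
    (phi : gal iota -> orthogonal_group Q)
    (phi_morph : {morph phi : s t / (s * t)%g})
    (phi_open : open [set s : gal iota | phi s = 1%g]) :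
  HW iota (twist_form phi) Q =
  Brs_add (SWbar j phi)
    (Brs_of_Br2 (xi (H1_class (M := sq_gmod iota)
                       (fun s => spinor_norm (phi s))))).
Proof.
have [n [e [e' ee']]] := nondegenerate_dual_bases Q_quadratic Q_nondeg.
have phi_lc := phi_locally_constant phi_morph phi_open.
(* Lifts are chosen for each isometry over F, not for each s: whatever is built from them is a
   function of [phi s] and hence locally constant. *)
have /choice[dx dxP] (g : orthogonal_group Q) :
    exists p : bool * clifford Q, homog_lift p.1 p.2 g.
  have [d [x xg]] := homog_lift_exists Q_quadratic ee' (orth_isometry g).
  by exists (d, x).
pose d g := (dx g).1; pose x g := (dx g).2.
have x_lift g : homog_lift (d g) (x g) g := dxP g.
have /choice[N NP] g : exists b : Gm F, cliff_norm_is (x g) b.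
  by have := homog_lift_unit_norm Q_quadratic ee' (x_lift g).
have /choice[zeta zetaP] (p : orthogonal_group Q * orthogonal_group Q) :
    exists a : Gm F, x p.1 * x p.2 = cliff_scal Q (gm_val a) * x (p.1 * p.2)%g.
  by have [_] := homog_lift_unique Q_quadratic ee' (x_lift (p.1 * p.2)%g)
    (homog_liftM (x_lift p.1) (x_lift p.2)).
have x_mul g h : x g * x h = cliff_scal Q (gm_val (zeta (g, h))) * x (g * h)%g := zetaP (g, h).
have /choice[H HP] g := closed_field_sqrt (j (gm_val (N g))).
have H0 g : H g != 0.
  apply/negP => /eqP h0; move/eqP: (HP g).
  by rewrite h0 expr0n eq_sym fmorph_eq0 (negPf (gm_neq0 _)).
have N_mul g h : N g + N h = zeta (g, h) *+ 2 + N (g * h)%g.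
  apply: (cliff_norm_inj Q_quadratic ee' (cliff_normM (NP g) (NP h))).
  by rewrite x_mul; apply: cliff_normM => //; exact: cliff_norm_scal.
pose Qk := ext_form (iota := j) Q.
pose y g : clifford Qk := cliff_scal Qk (H g)^-1 * cliff_base j (x g).
have xk_lift g := cliff_base_lift j Q_quadratic (x_lift g).
have y_lift g : homog_lift (d g) (y g) (tensor_lin g).
  by have := homog_liftM (homog_lift_scal Qk (invr_neq0 (H0 g))) (xk_lift g).
have y_norm g : cliff_tr (y g) * y g = 1.
  have nH : gm_val (MkGm (invr_neq0 (H0 g))) = (H g)^-1 by [].
  have := cliff_normM (cliff_norm_scal Qk (MkGm (invr_neq0 (H0 g))))
    (cliff_base_norm j Q_quadratic (NP g)).
  rewrite /cliff_norm_is nH -/(y g) => ->.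
  rewrite gm_valD gm_valMn nH exprVn HP mulVf // fmorph_eq0 gm_neq0 //.
(* Multiplicativity of the norm, in the form [N_mul], equates the two squares; hence the ratio [eps]
   is a sign. *)
have HN g h : (j (gm_val (zeta (g, h))) * H (g * h)%g) ^+ 2 = (H g * H h) ^+ 2.
  by rewrite !exprMn !HP -rmorphXn -!rmorphM /= -gm_valMn -!gm_valD N_mul.
pose eps g h : k := j (gm_val (zeta (g, h))) * H (g * h)%g / (H g * H h).
have /choice[nu nuP] : forall p : orthogonal_group Q * orthogonal_group Q,
    exists m : 'F_2, eps p.1 p.2 = gm_val (gm_sign k m).
  move=> [g h] /=; have eps2 : eps g h ^+ 2 = 1.
    by rewrite /eps expr_div_n HN divff // expf_neq0 // mulf_neq0.
  move/eqP: eps2; rewrite sqrf_eq1 => /orP[/eqP ->|/eqP ->]; first by exists 0.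
  by exists 1; rewrite /= expr1.
have y_mul g h : y g * y h = cliff_scal Qk (gm_val (gm_sign k (nu (g, h)))) * y (g * h)%g.
  rewrite -(nuP (g, h)) /y /= -mulrA (mulrA (cliff_base j _)) -cliff_scalC_ring.
  rewrite -mulrA -cliff_baseM // x_mul cliff_baseM // cliff_base_scal // !mulrA -!cliff_scalME.
  congr (cliff_scal _ _ * _); rewrite /eps.
  by field; rewrite !H0.
(* A sign is its own inverse, so it can change sides: the defect of multiplicativity of H is zeta
   times the sign, which makes H the square root cochain computing xi. *)
have HH g h : H g * H h = j (gm_val (zeta (g, h) + gm_sign F (nu (g, h)))) * H (g * h)%g.
  have := nuP (g, h); rewrite gm_valD rmorphM /= rmorphXn rmorphN1 => <-.
  apply: (mulIf (mulf_neq0 (H0 g) (H0 h))); rewrite -expr2 -HN /eps.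
  by field; rewrite !H0.
pose c s := spinor_norm (phi s).
have cN s : c s = \pi_(Quotient.quot (@gm_squares F)) (N (phi s)).
  by have := spinor_normE Q_quadratic ee' (x_lift (phi s)) (NP (phi s)).
have cZ : c \in Z1_pred (M := sq_gmod iota).
  apply/Z1P; split; first exact: (locally_constant_comp (fun g => spinor_norm g) phi_lc).
  move=> s t; rewrite /= !cN -quot_piD phi_morph; apply/square_class_eq.
  by exists (- zeta (phi s, phi t)); rewrite N_mul mulNrn addrAC subrr add0r.
(* The spinor norm of [phi s] depends only on the restriction of s to [xs], so its values at
   finitely many representatives form the list needed by [xi_relP]. *)
have [xs xsP] := open_kernel_keys phi_morph phi_open.
have [L LP] := gal_values_finite iota_sep xs.
have [rs _ rsP] := uniq_representatives LP.
have xiP : xi_rel j (H1_class (M := sq_gmod iota) c) (xi (H1_class (M := sq_gmod iota) c)).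
  apply: (@xi_relP _ _ _ _ _ _ (map c rs)) => s; rewrite H1_class_trivialK //.
  have /mapP[r rrs /eq_in_map sr] := rsP s; apply/mapP; exists r => //.
  by rewrite /c (xsP _ _ sr).
pose z (st : gal iota * gal iota) :=
  zeta (phi st.1, phi st.2) + gm_sign F (nu (phi st.1, phi st.2)).
have cz : sqrt_cochain j c (H \o phi) z.
  split.
  - exact: locally_constant_comp.
  - apply: (locally_constant_comp (f := fun st : gal iota * gal iota => (phi st.1, phi st.2))
      (fun p => zeta p + gm_sign F (nu p))).
    by apply: locally_constant_op2; [exact: locally_constant_fst|exact: locally_constant_snd].
  - by move=> s; exists (N (phi s)); rewrite /= HP cN.
  - by move=> s t; rewrite /= HH phi_morph.
have xiE : br2_val (xi (H1_class (M := sq_gmod iota) c)) =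
    H2_class ((fun st => gm_map iota (z st)) : _ -> gm_gmod iota).
  have [h' [z' [hz' ->]]] := xiP; rewrite H1_class_trivialK // in hz'.
  exact: sqrt_cochain_unique hz' cz.
have [sZ sE] := SW2_class Q_quadratic ee' phi_morph phi_lc y_lift y_norm y_mul.
rewrite /HW /Brs_add /SWbar /Brs_of_Br2 /=; congr (_, _).
  rewrite (deg_star_twist iota_sep Q_quadratic phi_morph phi_open ee' x_lift) addr0.
  congr H1_class; apply/funext => s.
  have Ek := ext_dual_bases j Q_quadratic ee'.
  by rewrite (orth_degE (ext_form_quad j Q_quadratic) Ek
    (tensor_lin_isometry j Q_quadratic _) (xk_lift _)).
(* The second summand has first component 0, whose cocycle is 0, so the cup product in the group law
   vanishes. *)
rewrite (_ : cup_Br2 _ _ = 0) ?addr0; last first.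
  apply: val_inj; rewrite /= /cup11.
  have z0 : H1_cocycle (0 : H1 (F2_gmod iota)) = 0.
    by rewrite -{1}(subrr (0 : H1 (F2_gmod iota))) H1_cocycle_trivialB subrr.
  rewrite -[RHS](H2_class0 (gm_gmod iota)); congr H2_class; apply/funext => st.
  by rewrite z0 mulr0; exact: val_inj.
set sgn := (fun st => _) in sZ sE.
have zZ := sqrt_cochain_Z2 cz.
have zetaE : (fun st => gm_map iota (zeta (phi st.1, phi st.2)) : gm_gmod iota) =
    (fun st => gm_map iota (z st) : gm_gmod iota) - sgn.
  by apply/funext => st; rewrite funBE gm_mapD gm_map_sign addrK.
apply: (connecting_twist iota_sep Q_quadratic phi_morph phi_open ee' x_lift x_mul).
  by rewrite zetaE rpredB.
rewrite zetaE H2_classB // -xiE -sE.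
have -> (u v : Br2 iota) : br2_val (u + v) = br2_val u + br2_val v by exact: (raddfD val).
(* The cocycles give xi minus the Stiefel-Whitney term; since that term is killed by 2, the
   difference is the sum. *)
rewrite addrC; congr (_ + _); apply/eqP; rewrite -addr_eq0 -mulr2n.
exact: (valP (sign_Br2 (SW2 j phi))).
Qed.
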